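(* Let $G=\{1,\sigma\}$ be the group of order two. For every dimer tree algebra $A^0=\mathrm{Jac}(Q^0,W^0)$ and every boundary arrow $\alpha:i\to j$ in $Q^0$, the fibered product of $A^0$ with itself along $\alpha$ is a dimer tree algebra $A$ with an admissible $G$-action. The element $\sigma$ acts on the quiver $Q$ of $A$ by reflection at the line along the arrow $\alpha$, and $\sigma$ acts on the dual graph $\mathcal G$ of $Q$ by reflection at the line through the midpoint of the edge $\alpha$ and perpendicular to the edge $\alpha$ (for the planar embedding in which the two copies of $Q^0$ are glued symmetrically along $\alpha$). Moreover, the set of vertices of $Q$ fixed by $\sigma$ is $\{i,j\}$ and the set of arrows of $Q$ fixed by $\sigma$ is $\{\alpha\}$.
   Context: $\Bbbk$ is an algebraically closed field of characteristic different from 2. **Dimer tree algebras.** A chordless cycle in a quiver $Q$ is a cyclic path $x_0\to x_1\to\dots\to x_t\to x_0$ with pairwise distinct vertices such that the full subquiver on $x_0,\dots,x_t$ equals this cycle. Arrows lying in exactly one chordless cycle are boundary arrows; those lying in two or more are interior arrows. The dual graph of $Q$ has as vertices the chordless cycles and the boundary arrows of $Q$; there is an edge labelled $\alpha$ between two chordless cycles sharing the arrow $\alpha$, and an edge labelled $\alpha$ between a boundary arrow $\alpha$ and the chordless cycle containing it. A dimer tree quiver is a finite connected quiver without loops and 2-cycles such that (Q1) every arrow lies in at least one chordless cycle, (Q2) the dual graph is a tree, (Q3) the boundary arrows form a simple (non-oriented) cycle. Dimer tree quivers are planar. Its potential is $W=\sum_C(-1)^{d(C)}C$, over all chordless cycles,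 where $d(C)$ is the distance in the dual graph from $C$ to a fixed chordless cycle $C_0$ containing exactly one interior arrow (if $Q$ is a single chordless cycle, $C_0$ is that cycle); $W$ is considered up to sign. The Jacobian algebra $\mathrm{Jac}(Q,W)$ is a dimer tree algebra. **Fibered product.** Given $A^0$ and a boundary arrow $\alpha:i\to j$ of $Q^0$, let $Q$ be the quiver obtained from two copies of $Q^0$ by identifying the two copies of the arrow $\alpha$ (and its endpoints). Every vertex $x\ne i,j$ of $Q^0$ yields two vertices $x,\sigma x$ of $Q$ and every arrow $\beta\ne\alpha$ yields two arrows $\beta,\sigma\beta$; put $\sigma i=i$, $\sigma j=j$, $\sigma\alpha=\alpha$. With $W=W^0-\sigma W^0$, the algebra $A=\mathrm{Jac}(Q,W)$ is called the fibered product of $A^0$ with itself along $\alpha$; $\sigma$ induces the $G$-action on $A$. **Admissible action.** A $G$-action on an algebra given by a quiver with relations is admissible if $\sigma$ acts as an algebra automorphism mapping vertices to vertices and arrows to arrows and fixes at least one vertex. *)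

(* Defs.v *)
From HB Require Import structures.
From mathcomp Require Import all_boot all_order all_algebra all_fingroup.
From mathcomp Require Import finmap.
From mathcomp Require Import monalg.
From mathcomp Require Import generic_quotient.
From mathcomp Require Import classical_sets boolp reals topology normedtype.

Set Implicit Arguments.
Unset Strict Implicit.
Unset Printing Implicit Defensive.

Import Order.TTheory GRing.Theory Num.Theory.
Import numFieldNormedType.Exports.

(* Multigraphs: finitely many edges, each with its set of (one or two)
   endpoints; parallel edges are allowed. *)

Record mgraph := MGraph {
  mvert : finType;
  medge : finType;
  mends : medge -> {set mvert} }.

Section Multigraph.
Variable G : mgraph.

Definition madj (x y : mvert G) : bool :=
  [exists e : medge G, mends e == [set x; y]].

Definition mconnected : bool :=
  (0 < #|mvert G|) && [forall x, forall y, connect madj x y].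

(* A simple cycle x_0 -e_0- x_1 -e_1- ... -e_t- x_0 is given by the sequence of
   the pairs (x_l, e_l); its vertices are pairwise distinct, and so are its
   edges.  Two parallel edges form a simple cycle. *)
Definition simple_cycle (s : seq (mvert G * medge G)) : bool :=
  [&& s != [::], uniq [seq z.1 | z <- s], uniq [seq z.2 | z <- s]
    & path.cycle (fun z z' => mends z.2 == [set z.1; z'.1]) s].

Definition is_tree : Prop := mconnected /\ forall s, ~~ simple_cycle s.

(* Number of edges of a shortest walk from x to y (and #|mvert G| if there is
   no such walk). *)
Definition mdist (x y : mvert G) : nat :=
  find (fun n => [exists p : n.-tuple (mvert G),
                    path madj x p && (last x p == y)])
       (iota 0 #|mvert G|).

End Multigraph.

Record mgraph_aut (G : mgraph) := MGraphAut {
  autv : {perm mvert G};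
  aute : {perm medge G};
  aut_ends : forall e, mends (aute e) = autv @: mends e }.

Record quiver := Quiver {
  vert : finType;
  arr : finType;
  src : arr -> vert;
  tgt : arr -> vert }.

Definition underlying (Q : quiver) : mgraph :=
  MGraph (fun a : arr Q => [set src a; tgt a]).

Record qhom (Q Q' : quiver) := QHom {
  homv : vert Q -> vert Q';
  homa : arr Q -> arr Q';
  hom_src : forall a, src (homa a) = homv (src a);
  hom_tgt : forall a, tgt (homa a) = homv (tgt a) }.

Section DimerTreeQuiver.
Variable Q : quiver.

(* A chordless cycle is represented by its set of arrows C, which determines
   the cyclic path up to rotation.  Below s is the list of the successive
   arrows of the cyclic path, and the last clause says that the full subquiver
   on its vertices has no other arrow. *)
Definition chordless_walk (s : seq (arr Q)) : bool :=
  [&& s != [::], path.cycle (fun a b => tgt a == src b) s,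
      uniq [seq src a | a <- s]
    & [forall a : arr Q, (src a \in [seq src b | b <- s]) &&
         (tgt a \in [seq src b | b <- s]) ==> (a \in s)]].

Definition chordless (C : {set arr Q}) : bool :=
  [exists s : #|C|.-tuple (arr Q), chordless_walk s && (C == [set a in s])].

Definition ccycle := {C : {set arr Q} | chordless C}.

Definition ncycles (a : arr Q) : nat := #|[set C | chordless C & a \in C]|.

Definition boundary (a : arr Q) : bool := ncycles a == 1.
Definition interior_arrow (a : arr Q) : bool := 1 < ncycles a.

Definition barrow := {a : arr Q | boundary a}.

Definition dnode : finType := (ccycle + barrow)%type.

(* (a, N) is an edge of the dual graph labelled a between the two elements
   of N. *)
Definition is_dedge (e : arr Q * {set dnode}) : bool :=
  [exists C : ccycle, exists D : ccycle,
     [&& C != D, e.1 \in val C, e.1 \in val D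
       & e.2 == [set inl C; inl D]]] ||
  [exists C : ccycle, exists b : barrow,
     [&& e.1 == val b, e.1 \in val C & e.2 == [set inl C; inr b]]].

Definition dedge := {e : arr Q * {set dnode} | is_dedge e}.

Definition dual : mgraph := MGraph (fun e : dedge => (val e).2).

Definition dlabel (e : medge dual) : arr Q := (val e).1.

Definition dimer_tree_quiver : Prop :=
  [/\ mconnected (underlying Q),
      forall a : arr Q, src a != tgt a,
      forall a b : arr Q, ~~ ((tgt a == src b) && (tgt b == src a)),
      forall a : arr Q, exists2 C, chordless C & a \in C
    & is_tree dual /\
      exists2 s : seq (mvert (underlying Q) * medge (underlying Q)),
        simple_cycle s & [seq z.2 | z <- s] =i boundary].

(* Admissible choices of the cycle C_0 from which the distances d(C) in the
   definition of the potential are measured. *)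
Definition base_cycle (C0 : ccycle) : bool :=
  (#|{: ccycle}| == 1) || (#|[set a in val C0 | interior_arrow a]| == 1).

Definition dcyc (C0 C : ccycle) : nat :=
  mdist (inl C0 : mvert dual) (inl C : mvert dual).

(* A cyclic path running through C, from an arbitrarily chosen start. *)
Definition cycle_walk (C : ccycle) : seq (arr Q) :=
  xchoose (existsP (valP C)).

End DimerTreeQuiver.

Local Open Scope ring_scope.

(* The linear extension of a function on basis elements.  It is locked because
   unification would otherwise unfold products in path algebras. *)
HB.lock Definition lext (k : fieldType) (K : choiceType) (V : lmodType k)
    (f : K -> V) (x : {malg k[K]}) : V :=
  \sum_(p <- msupp x) x@_p *: f p.

Section LinearExtension.
Variables (k : fieldType) (K : choiceType) (V : lmodType k).

Lemma lextE (f : K -> V) (x : {malg k[K]}) :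
  lext f x = \sum_(p <- msupp x) x@_p *: f p.
Proof. by rewrite unlock. Qed.

Lemma lextEw (f : K -> V) (x : {malg k[K]}) (d : {fset K}) :
  (msupp x `<=` d)%fset -> lext f x = \sum_(p <- d) x@_p *: f p.
Proof.
move=> /fsubsetP sub_xd; rewrite lextE.
rewrite [RHS](bigID (mem (msupp x))) /= [X in _ + X]big1_seq ?addr0; last first.
  by move=> p /andP[/mcoeff_outdom -> _]; rewrite scale0r.
rewrite -[RHS]big_filter; apply: perm_big; apply: uniq_perm => [||p].
- exact: fset_uniq.
- exact/filter_uniq/fset_uniq.
- rewrite mem_filter /=.
  by case: (boolP (p \in msupp x)) => //= /sub_xd ->.
Qed.

Lemma lext_is_linear (f : K -> V) : linear (lext f).
Proof.
move=> c x y; pose d := (msupp x `|` msupp y `|` msupp (c *: x + y))%fset.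
rewrite (@lextEw f x d) ?(@lextEw f y d) ?(@lextEw f (c *: x + y) d); last first.
- by rewrite /d; apply/fsubsetP=> p; rewrite !in_fsetE => ->; rewrite ?orbT.
- by rewrite /d; apply/fsubsetP=> p; rewrite !in_fsetE => ->; rewrite ?orbT.
- by rewrite /d; apply/fsubsetP=> p; rewrite !in_fsetE => ->; rewrite ?orbT.
rewrite scaler_sumr -big_split /=; apply: eq_bigr => p _.
by rewrite mcoeffD mcoeffZ scalerDl scalerA.
Qed.

HB.instance Definition _ (f : K -> V) :=
  GRing.isLinear.Build k {malg k[K]} V _ (lext f) (lext_is_linear f).

Lemma lextD (f : K -> V) x y : lext f (x + y) = lext f x + lext f y.
Proof. exact: linearD. Qed.

Lemma lextZ (f : K -> V) c x : lext f (c *: x) = c *: lext f x.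
Proof. exact: linearZ. Qed.

Lemma lext_sum (f : K -> V) I (r : seq I) (F : I -> {malg k[K]}) :
  lext f (\sum_(l <- r) F l) = \sum_(l <- r) lext f (F l).
Proof. exact: linear_sum. Qed.

Lemma lext_fun (c : k) (f g h : K -> V) x :
  (forall p, h p = c *: f p + g p) -> lext h x = c *: lext f x + lext g x.
Proof.
move=> hE; rewrite unlock scaler_sumr -big_split; apply: eq_bigr => p _.
by rewrite hE scalerDr !scalerA mulrC.
Qed.

Lemma lextU (f : K -> V) (p : K) : lext f << p >> = f p.
Proof.
rewrite (@lextEw _ _ [fset p]%fset) ?msuppU_le //.
by rewrite big_seq_fset1 mcoeffUU scale1r.
Qed.

Lemma lext_ext (f g : K -> V) x : f =1 g -> lext f x = lext g x.
Proof. by rewrite unlock => fg; apply: eq_bigr => p _; rewrite fg. Qed.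

End LinearExtension.

Lemma lext_id (k : fieldType) (K : choiceType) (x : {malg k[K]}) :
  lext (fun p => << p >> : {malg k[K]}) x = x.
Proof.
rewrite lextE [RHS]monalgE; apply: eq_bigr => p _; apply/malgP => q.
by rewrite mcoeffZ !mcoeffU mulr_natr.
Qed.

Lemma lext_comp (k : fieldType) (K K' : choiceType) (V : lmodType k)
    (f : K -> V) (g : K' -> {malg k[K]}) x :
  lext f (lext g x) = lext (fun p => lext f (g p)) x.
Proof.
rewrite [RHS]lextE (lextE g) lext_sum.
by apply: eq_bigr => p _; rewrite lextZ.
Qed.

(* Paths v = x_0 -a_1-> x_1 -> ... -a_n-> x_n are pairs (v, [:: a_1; ...; a_n]);
   the trivial path at v is (v, [::]), and paths are composed from left to
   right. *)

Section Paths.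
Variable Q : quiver.

Fixpoint walk (v : vert Q) (s : seq (arr Q)) : bool :=
  if s is a :: s' then (src a == v) && walk (tgt a) s' else true.

Definition walk_end (v : vert Q) (s : seq (arr Q)) : vert Q :=
  last v [seq tgt a | a <- s].

Lemma walk_cat v s t : walk v (s ++ t) = walk v s && walk (walk_end v s) t.
Proof. by elim: s v => //= a s IHs v; rewrite IHs andbA. Qed.

Lemma walk_end_cat v s t : walk_end v (s ++ t) = walk_end (walk_end v s) t.
Proof. by rewrite /walk_end map_cat last_cat. Qed.

Definition qpath := {p : vert Q * seq (arr Q) | walk p.1 p.2}.
HB.instance Definition _ := SubChoice.on qpath.

Definition pstart (p : qpath) : vert Q := (val p).1.
Definition parrs (p : qpath) : seq (arr Q) := (val p).2.
Definition pend (p : qpath) : vert Q := walk_end (pstart p) (parrs p).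

Definition trivial_path (v : vert Q) : qpath := exist _ (v, [::]) isT.

Lemma arrow_path_subproof (a : arr Q) : walk (src a) [:: a].
Proof. by rewrite /= eqxx. Qed.

Definition arrow_path (a : arr Q) : qpath :=
  exist _ (src a, [:: a]) (arrow_path_subproof a).

Definition pcat (p q : qpath) : option qpath :=
  if pend p == pstart q then insub (pstart p, parrs p ++ parrs q) else None.

Lemma pcat_Some (p q : qpath) : pend p = pstart q ->
  exists r, [/\ pcat p q = Some r, pstart r = pstart p
              & parrs r = parrs p ++ parrs q].
Proof.
move=> epq; have w : walk (pstart p) (parrs p ++ parrs q).
  rewrite walk_cat; apply/andP; split; first exact: (valP p).
  by rewrite -/(pend p) epq; exact: (valP q).
exists (exist _ (pstart p, parrs p ++ parrs q) w).
by rewrite /pcat epq eqxx insubT.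
Qed.

Lemma pcat_None (p q : qpath) : pend p <> pstart q -> pcat p q = None.
Proof. by move=> /eqP/negbTE npq; rewrite /pcat npq. Qed.

Lemma pend_cat (p q r : qpath) :
  pstart r = pstart p -> parrs r = parrs p ++ parrs q ->
  pend p = pstart q -> pend r = pend q.
Proof.
by move=> sr ar epq; rewrite /pend sr ar walk_end_cat -/(pend p) epq.
Qed.

Lemma qpath_inj (p q : qpath) : pstart p = pstart q -> parrs p = parrs q -> p = q.
Proof.
case: p q => [[v s] ?] [[w t] ?]; rewrite /pstart /parrs /= => ? ?; subst.
exact: val_inj.
Qed.

Lemma pcatA (p q r : qpath) :
  obind (pcat p) (pcat q r) = obind (pcat^~ r) (pcat p q).
Proof.
have [epq|npq] := eqVneq (pend p) (pstart q);
  have [eqr|nqr] := eqVneq (pend q) (pstart r).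
- have [u [-> su au]] := pcat_Some epq; have [v [-> sv av]] := pcat_Some eqr.
  have eur : pend u = pstart r by rewrite (pend_cat su au epq).
  have epv : pend p = pstart v by rewrite sv.
  have [y [/= -> sy ay]] := pcat_Some eur.
  have [z [-> sz az]] := pcat_Some epv.
  by congr Some; apply: qpath_inj; rewrite ?sy ?sz // ay az au av catA.
- have [u [-> su au]] := pcat_Some epq.
  rewrite (pcat_None (elimN eqP nqr)) /= pcat_None //.
  by rewrite (pend_cat su au epq); apply/eqP.
- have [v [-> sv av]] := pcat_Some eqr.
  by rewrite (pcat_None (elimN eqP npq)) /= pcat_None // sv; apply/eqP.
- by rewrite (pcat_None (elimN eqP npq)) (pcat_None (elimN eqP nqr)).
Qed.

End Paths.

(* The path algebra kQ: formal linear combinations of paths.  The zero algebra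
   (quiver without vertices) is not excluded, so the ring structure is that of
   a possibly trivial ring. *)

Definition pathalg (k : fieldType) (Q : quiver) : Type := {malg k[qpath Q]}.

Section PathAlgebra.
Variables (k : fieldType) (Q : quiver).

Local Notation kQ := {malg k[qpath Q]}.

Definition obase (o : option (qpath Q)) : kQ :=
  if o is Some p then << p >> else 0.

Definition palg_mul (x y : kQ) : kQ :=
  lext (fun p => lext (fun q => obase (pcat p q)) y) x.

Definition palg_one : kQ := \sum_v << trivial_path v >>.

Fact palg_mulDl : left_distributive palg_mul +%R.
Proof. by move=> x y z; rewrite /palg_mul lextD. Qed.

Fact palg_scaleAl (c : k) (x y : kQ) :
  c *: palg_mul x y = palg_mul (c *: x) y.
Proof. by rewrite /palg_mul lextZ. Qed.

Fact palg_mulDr : right_distributive palg_mul +%R.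
Proof.
move=> x y z; rewrite /palg_mul -[X in _ = X + _]scale1r.
by apply: lext_fun => p; rewrite lextD scale1r.
Qed.

Fact palg_scaleAr (c : k) (x y : kQ) :
  c *: palg_mul x y = palg_mul x (c *: y).
Proof.
have lext0 : lext (fun=> 0 : kQ) x = 0.
  by rewrite lextE big1 // => p _; rewrite scaler0.
rewrite /palg_mul -[LHS]addr0 -[X in _ + X]lext0; apply/esym.
by apply: lext_fun => p; rewrite lextZ addr0.
Qed.

Fact palg_mul0 x : palg_mul x 0 = 0.
Proof. by rewrite -[0](scale0r (0 : kQ)) -palg_scaleAr !scale0r. Qed.

Fact palg_0mul x : palg_mul 0 x = 0.
Proof. by rewrite -[0](scale0r (0 : kQ)) -palg_scaleAl !scale0r. Qed.

Fact palg_mulUU p q : palg_mul << p >> << q >> = obase (pcat p q).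
Proof. by rewrite /palg_mul !lextU. Qed.

Fact palg_mulA : associative palg_mul.
Proof.
move=> x y z; rewrite /palg_mul lext_comp; apply: lext_ext => p.
rewrite !lext_comp; apply: lext_ext => q; rewrite lext_comp.
have -> : lext (fun p' => lext (fun r => obase (pcat p' r)) z)
            (obase (pcat p q)) =
          lext (fun r => obase (obind (@pcat Q ^~ r) (pcat p q))) z.
  case: (pcat p q) => [u|] /=; first by rewrite lextU.
  by rewrite raddf0 [RHS]lextE big1 // => r _; rewrite scaler0.
apply: lext_ext => r; rewrite -pcatA.
by case: (pcat q r) => [u|] /=; rewrite ?lextU ?raddf0.
Qed.

Fact palg_mul1 : right_id palg_one palg_mul.
Proof.
move=> x; rewrite /palg_mul -[RHS]lext_id; apply: lext_ext => p.
rewrite /palg_one lext_sum (bigD1 (pend p)) //=.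
rewrite big1 ?addr0 => [|v npv]; last first.
  by rewrite lextU pcat_None // => epv; rewrite epv eqxx in npv.
rewrite lextU; have [|r [-> sr ar]] := @pcat_Some Q p (trivial_path (pend p)).
  by [].
by congr (<< _ >>); apply: qpath_inj => //; rewrite ar cats0.
Qed.

Fact palg_1mul : left_id palg_one palg_mul.
Proof.
move=> x; rewrite /palg_mul /palg_one lext_sum -[RHS]lext_id lextE.
under eq_bigr => v _ do rewrite lextU lextE.
rewrite exchange_big /=; apply: eq_bigr => p _; rewrite (bigD1 (pstart p)) //=.
rewrite big1 ?addr0 => [|v npv]; last first.
  by rewrite pcat_None ?scaler0 // => epv; rewrite -epv eqxx in npv.
have [|r [-> sr ar]] := @pcat_Some Q (trivial_path (pstart p)) p.
  by [].
by congr (_ *: << _ >>); apply: qpath_inj.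
Qed.

HB.instance Definition _ := GRing.Lmodule.copy (pathalg k Q) kQ.
HB.instance Definition _ := GRing.Zmodule_isPzRing.Build (pathalg k Q)
  palg_mulA palg_1mul palg_mul1 palg_mulDl palg_mulDr.

Lemma pathalg_scaleAl (c : k) (x y : pathalg k Q) : c *: (x * y) = (c *: x) * y.
Proof. exact: palg_scaleAl. Qed.

Lemma pathalg_scaleAr (c : k) (x y : pathalg k Q) : c *: (x * y) = x * (c *: y).
Proof. exact: palg_scaleAr. Qed.

Definition pvtx (v : vert Q) : pathalg k Q := << trivial_path v >>.
Definition parrow (a : arr Q) : pathalg k Q := << arrow_path a >>.

(* The element a_1 a_2 ... a_n of kQ; it is 0 if the arrows do not compose. *)
Definition pword (s : seq (arr Q)) : pathalg k Q := \prod_(a <- s) parrow a.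

(* Potentials are linear combinations of cyclic paths of positive length,
   considered up to cyclic equivalence a_1 a_2 ... a_n ~ a_2 ... a_n a_1. *)

Definition cyclic_walk (s : seq (arr Q)) : bool :=
  (s != [::]) && path.cycle (fun a b => tgt a == src b) s.

Definition is_potential (w : pathalg k Q) : Prop :=
  forall p, p \in msupp w -> cyclic_walk (parrs p).

Definition cyc_equiv (w w' : pathalg k Q) : Prop :=
  exists2 l : seq (k * seq (arr Q)), all (fun t => cyclic_walk t.2) l &
    w - w' = \sum_(t <- l) t.1 *: (pword t.2 - pword (rot 1 t.2)).

(* The cyclic derivative: on a cyclic path a_1 ... a_n it is the sum of the
   a_{l+1} ... a_n a_1 ... a_{l-1} over all l with a_l = a. *)
Definition cderiv (a : arr Q) : pathalg k Q -> pathalg k Q :=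
  lext (fun p => let s := parrs p in
    if cyclic_walk s then
      \sum_(0 <= l < size s | nth a s l == a)
        pvtx (tgt a) * pword (drop l.+1 s ++ take l s)
    else 0 : pathalg k Q).

Definition jacobian_ideal (w x : pathalg k Q) : Prop :=
  exists l : seq (pathalg k Q * arr Q * pathalg k Q),
    x = \sum_(t <- l) t.1.1 * cderiv t.1.2 w * t.2.

Definition dimer_potential (C0 : ccycle Q) : pathalg k Q :=
  \sum_(C : ccycle Q) (-1) ^+ dcyc C0 C *: pword (cycle_walk C).

(* Jac(Q, w) is a dimer tree algebra: Q is a dimer tree quiver and w is its
   potential, which is only defined up to cyclic equivalence and sign. *)
Definition dimer_tree_qp (w : pathalg k Q) : Prop :=
  [/\ dimer_tree_quiver Q, is_potential w
    & exists2 C0 : ccycle Q, base_cycle C0 &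
        cyc_equiv w (dimer_potential C0) \/ cyc_equiv w (- dimer_potential C0)].

End PathAlgebra.

(* The linear map kQ -> kQ' induced by a morphism of quivers. *)
Definition palg_map (k : fieldType) (Q Q' : quiver) (f : qhom Q Q') :
    pathalg k Q -> pathalg k Q' :=
  lext (fun p => pvtx k (homv f (pstart p)) * pword k [seq homa f a | a <- parrs p]).

Section JacobianAlgebra.
Variables (k : fieldType) (Q : quiver) (w : pathalg k Q).
Local Open Scope quotient_scope.

Fact jideal0 : jacobian_ideal w 0.
Proof. by exists [::]; rewrite big_nil. Qed.

Fact jidealD x y :
  jacobian_ideal w x -> jacobian_ideal w y -> jacobian_ideal w (x + y).
Proof. by move=> [l ->] [m ->]; exists (l ++ m); rewrite big_cat. Qed.

Fact jidealMl u x : jacobian_ideal w x -> jacobian_ideal w (u * x).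
Proof.
move=> [l ->]; exists [seq (u * t.1.1, t.1.2, t.2) | t <- l].
by rewrite big_map /= mulr_sumr; apply: eq_bigr => t _; rewrite !mulrA.
Qed.

Fact jidealMr u x : jacobian_ideal w x -> jacobian_ideal w (x * u).
Proof.
move=> [l ->]; exists [seq (t.1, t.2 * u) | t <- l].
by rewrite big_map /= mulr_suml; apply: eq_bigr => t _; rewrite !mulrA.
Qed.

Fact jidealZ c x : jacobian_ideal w x -> jacobian_ideal w (c *: x).
Proof.
move=> Jx; rewrite -[x]mul1r.
by rewrite pathalg_scaleAl; exact: jidealMl.
Qed.

Fact jidealN x : jacobian_ideal w x -> jacobian_ideal w (- x).
Proof. by move=> Jx; rewrite -scaleN1r; exact: jidealZ. Qed.

Definition jac_rel (x y : pathalg k Q) : bool := `[< jacobian_ideal w (x - y) >].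

Fact jac_rel_is_equiv : equiv_class_of jac_rel.
Proof.
split=> [x|x y|y x z].
- by rewrite /jac_rel subrr; apply/asboolP; exact: jideal0.
- by apply/asboolP/asboolP => /jidealN; rewrite opprB.
- move=> /asboolP Jxy /asboolP Jyz; apply/asboolP.
  by rewrite -[x](subrK y) -addrA; exact: jidealD.
Qed.

Canonical jac_equiv := EquivRelPack jac_rel_is_equiv.

Definition Jac := {eq_quot jac_equiv}.
HB.instance Definition _ : EqQuotient _ jac_equiv Jac := EqQuotient.on Jac.
HB.instance Definition _ := Choice.on Jac.

Definition jpi (x : pathalg k Q) : Jac := \pi_Jac x.

Fact jpi_eq x y : jacobian_ideal w (x - y) -> jpi x = jpi y.
Proof. by move=> Jxy; apply/eqmodP/asboolP. Qed.

Fact jpiP x y : jpi x = jpi y <-> jacobian_ideal w (x - y).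
Proof. by split=> [/eqmodP/asboolP|/jpi_eq]. Qed.

Fact jac_reprK (x : Jac) : jpi (repr x) = x.
Proof. exact: reprK. Qed.

Fact jac_repr_pi x : jacobian_ideal w (repr (jpi x) - x).
Proof. by apply/jpiP; rewrite jac_reprK. Qed.

Definition jac_add : Jac -> Jac -> Jac :=
  locked (fun x y => jpi (repr x + repr y)).
Definition jac_opp : Jac -> Jac := locked (fun x => jpi (- repr x)).
Definition jac_mul : Jac -> Jac -> Jac :=
  locked (fun x y => jpi (repr x * repr y)).
Definition jac_scale : k -> Jac -> Jac :=
  locked (fun c x => jpi (c *: repr x)).

Fact jpi_add x y : jac_add (jpi x) (jpi y) = jpi (x + y).
Proof.
rewrite /jac_add -lock; apply: jpi_eq; rewrite opprD addrACA.
by apply: jidealD; exact: jac_repr_pi.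
Qed.

Fact jpi_opp x : jac_opp (jpi x) = jpi (- x).
Proof.
by rewrite /jac_opp -lock; apply: jpi_eq; rewrite -opprD;
  apply/jidealN/jac_repr_pi.
Qed.

Fact jpi_mul x y : jac_mul (jpi x) (jpi y) = jpi (x * y).
Proof.
rewrite /jac_mul -lock; apply: jpi_eq.
rewrite -[X in X - _](subrK (x * repr (jpi y))) -mulrBl -addrA.
by rewrite -mulrBr; apply: jidealD;
  [apply: jidealMr|apply: jidealMl]; exact: jac_repr_pi.
Qed.

Fact jpi_scale c x : jac_scale c (jpi x) = jpi (c *: x).
Proof.
by rewrite /jac_scale -lock; apply: jpi_eq; rewrite -scalerBr;
  apply/jidealZ/jac_repr_pi.
Qed.

Fact jac_ind (P : Jac -> Prop) : (forall x, P (jpi x)) -> forall x, P x.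
Proof. by move=> Ppi x; rewrite -(jac_reprK x). Qed.

Fact jac_addA : associative jac_add.
Proof.
elim/jac_ind=> x; elim/jac_ind=> y; elim/jac_ind=> z.
by rewrite !jpi_add addrA.
Qed.

Fact jac_addC : commutative jac_add.
Proof. by elim/jac_ind=> x; elim/jac_ind=> y; rewrite !jpi_add addrC. Qed.

Fact jac_add0 : left_id (jpi 0) jac_add.
Proof. by elim/jac_ind=> x; rewrite jpi_add add0r. Qed.

Fact jac_addN : left_inverse (jpi 0) jac_opp jac_add.
Proof. by elim/jac_ind=> x; rewrite jpi_opp jpi_add addNr. Qed.

HB.instance Definition _ := GRing.isZmodule.Build Jac
  jac_addA jac_addC jac_add0 jac_addN.

Fact jpiD x y : jpi (x + y) = jpi x + jpi y.
Proof. exact: esym (jpi_add x y). Qed.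

Fact jac_mulA : associative jac_mul.
Proof.
elim/jac_ind=> x; elim/jac_ind=> y; elim/jac_ind=> z.
by rewrite !jpi_mul mulrA.
Qed.

Fact jac_mul1 : right_id (jpi 1) jac_mul.
Proof. by elim/jac_ind=> x; rewrite jpi_mul mulr1. Qed.

Fact jac_1mul : left_id (jpi 1) jac_mul.
Proof. by elim/jac_ind=> x; rewrite jpi_mul mul1r. Qed.

Fact jac_mulDl : left_distributive jac_mul +%R.
Proof.
elim/jac_ind=> x; elim/jac_ind=> y; elim/jac_ind=> z.
by rewrite -jpiD !jpi_mul -jpiD mulrDl.
Qed.

Fact jac_mulDr : right_distributive jac_mul +%R.
Proof.
elim/jac_ind=> x; elim/jac_ind=> y; elim/jac_ind=> z.
by rewrite -jpiD !jpi_mul -jpiD mulrDr.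
Qed.

HB.instance Definition _ := GRing.Zmodule_isPzRing.Build Jac
  jac_mulA jac_1mul jac_mul1 jac_mulDl jac_mulDr.

Fact jpiM x y : jpi (x * y) = jpi x * jpi y.
Proof. exact: esym (jpi_mul x y). Qed.

Fact jac_scaleA c d x : jac_scale c (jac_scale d x) = jac_scale (c * d) x.
Proof. by elim/jac_ind: x => x; rewrite !jpi_scale scalerA. Qed.

Fact jac_scale1 : left_id 1 jac_scale.
Proof. by elim/jac_ind=> x; rewrite jpi_scale scale1r. Qed.

Fact jac_scaleDr : right_distributive jac_scale +%R.
Proof.
move=> c; elim/jac_ind=> x; elim/jac_ind=> y.
by rewrite -jpiD !jpi_scale -jpiD scalerDr.
Qed.

Fact jac_scaleDl x : {morph jac_scale^~ x : c d / c + d}.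
Proof.
move=> c d; elim/jac_ind: x => x.
by rewrite !jpi_scale -jpiD scalerDl.
Qed.

HB.instance Definition _ := GRing.Zmodule_isLmodule.Build k Jac
  jac_scaleA jac_scale1 jac_scaleDr jac_scaleDl.

Fact jpiZ c x : jpi (c *: x) = c *: jpi x.
Proof. exact: esym (jpi_scale c x). Qed.

Fact jac_scaleAl (c : k) (x y : Jac) : c *: (x * y) = (c *: x) * y.
Proof.
elim/jac_ind: x => x; elim/jac_ind: y => y.
by rewrite -?(jpiZ, jpiM) palg_scaleAl.
Qed.

Fact jac_scaleAr (c : k) (x y : Jac) : c *: (x * y) = x * (c *: y).
Proof.
elim/jac_ind: x => x; elim/jac_ind: y => y.
by rewrite -?(jpiZ, jpiM) palg_scaleAr.
Qed.

Definition jvtx (v : vert Q) : Jac := jpi (pvtx k v).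
Definition jarrow (a : arr Q) : Jac := jpi (parrow k a).

Definition is_alg_morphism (f : Jac -> Jac) : Prop :=
  [/\ linear f, {morph f : x y / x * y} & f 1 = 1].

Definition admissible_action (gT : finGroupType) (to : {action gT &-> Jac}) :
    Prop :=
  [/\ forall g, is_alg_morphism (to^~ g),
      forall g v, exists v', to (jvtx v) g = jvtx v',
      forall g a, exists a', to (jarrow a) g = jarrow a'
    & exists v, forall g, to (jvtx v) g = jvtx v].

End JacobianAlgebra.

(* The quiver obtained from two copies of Q0 by identifying the two copies of
   the arrow a0 and of its endpoints: inl is the first copy, and inr is the
   part of the second copy that is not identified with the first one. *)

Section FiberedProduct.
Variables (Q0 : quiver) (a0 : arr Q0).

Definition fp_off_v (x : vert Q0) : bool := (x != src a0) && (x != tgt a0).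

Definition fp_vert : finType := (vert Q0 + {x : vert Q0 | fp_off_v x})%type.
Definition fp_arr : finType := (arr Q0 + {a : arr Q0 | a != a0})%type.

Definition copy2v (x : vert Q0) : fp_vert :=
  if insub x is Some x' then inr x' else inl x.

Definition copy2a (a : arr Q0) : fp_arr :=
  if insub a is Some a' then inr a' else inl a.

Definition fp_src (a : fp_arr) : fp_vert :=
  match a with inl b => inl (src b) | inr b => copy2v (src (val b)) end.

Definition fp_tgt (a : fp_arr) : fp_vert :=
  match a with inl b => inl (tgt b) | inr b => copy2v (tgt (val b)) end.

Definition fp_quiver : quiver := Quiver fp_src fp_tgt.

Definition sigmav (x : vert fp_quiver) : vert fp_quiver :=
  match x with inl y => copy2v y | inr y => inl (val y) end.

Definition sigmaa (a : arr fp_quiver) : arr fp_quiver :=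
  match a with inl b => copy2a b | inr b => inl (val b) end.

Fact copy2v_src : copy2v (src a0) = inl (src a0).
Proof. by rewrite /copy2v insubF // /fp_off_v eqxx. Qed.

Fact copy2v_tgt : copy2v (tgt a0) = inl (tgt a0).
Proof. by rewrite /copy2v insubF // /fp_off_v eqxx andbF. Qed.

Fact sigmav_copy2 x : sigmav (copy2v x) = inl x.
Proof.
rewrite /copy2v; case: insubP => [x' _ <- //|].
by rewrite negb_and !negbK => /orP[]/eqP ->; rewrite /= ?copy2v_src ?copy2v_tgt.
Qed.

Fact copy2_src a : fp_src (copy2a a) = copy2v (src a).
Proof.
rewrite /copy2a; case: insubP => [b _ <- //|]; rewrite negbK => /eqP ->.
by rewrite copy2v_src.
Qed.

Fact copy2_tgt a : fp_tgt (copy2a a) = copy2v (tgt a).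
Proof.
rewrite /copy2a; case: insubP => [b _ <- //|]; rewrite negbK => /eqP ->.
by rewrite copy2v_tgt.
Qed.

Fact sigma_src (a : arr fp_quiver) : src (sigmaa a) = sigmav (src a).
Proof. by case: a => a /=; rewrite ?copy2_src ?sigmav_copy2. Qed.

Fact sigma_tgt (a : arr fp_quiver) : tgt (sigmaa a) = sigmav (tgt a).
Proof. by case: a => a /=; rewrite ?copy2_tgt ?sigmav_copy2. Qed.

Definition fp_copy1 : qhom Q0 fp_quiver :=
  @QHom Q0 fp_quiver inl inl (fun=> erefl) (fun=> erefl).

Definition fp_sigma : qhom fp_quiver fp_quiver := QHom sigma_src sigma_tgt.

Fact sigmavK : involutive sigmav.
Proof.
case=> x /=; first exact: sigmav_copy2.
by rewrite /copy2v; case: insubP (valP x) => [y _ /val_inj ->|/negP].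
Qed.

Fact sigmaaK : involutive sigmaa.
Proof.
case=> a /=; last first.
  by rewrite /copy2a; case: insubP (valP a) => [b _ /val_inj ->|/negP].
rewrite /copy2a; case: insubP => [b _ <- //|]; rewrite negbK => /eqP -> /=.
by rewrite /copy2a insubF // eqxx.
Qed.

(* W^0 - sigma W^0 *)
Definition fp_potential (k : fieldType) (w0 : pathalg k Q0) :
    pathalg k fp_quiver :=
  palg_map fp_copy1 w0 - palg_map fp_sigma (palg_map fp_copy1 w0).

End FiberedProduct.

(* The automorphism f of the dual graph is the one induced by s: it maps a
   chordless cycle C to s(C), a boundary arrow b to s(b), and an edge labelled
   a to an edge labelled s(a). *)
Definition induced_on_dual (Q : quiver) (s : qhom Q Q)
    (f : mgraph_aut (dual Q)) : Prop :=
  [/\ forall C : ccycle Q,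
        exists2 C' : ccycle Q, autv f (inl C) = inl C'
                             & val C' = homa s @: val C,
      forall b : barrow Q,
        exists2 b' : barrow Q, autv f (inr b) = inr b' & val b' = homa s (val b)
    & forall e : medge (dual Q), dlabel (aute f e) = homa s (dlabel e)].

Section Plane.
Variable R : realType.
Local Open Scope classical_set_scope.

Definition plane := (R * R)%type.

Definition dot (x y : plane) : R := x.1 * y.1 + x.2 * y.2.
Definition scalept (c : R) (x : plane) : plane := (c * x.1, c * x.2).
Definition midpoint (x y : plane) : plane := scalept 2^-1 (x + y).

(* Quarter turn, so that perp u is orthogonal to u. *)
Definition perp (x : plane) : plane := (- x.2, x.1).

Definition segment (x y : plane) : set plane :=
  [set x + scalept t (y - x) | t in [set t : R | 0 <= t <= 1]].

(* The orthogonal reflection at the line through p with direction u <> 0. *)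
Definition reflection (p u x : plane) : plane :=
  p + scalept (2 * (dot (x - p) u / dot u u)) u - (x - p).

Record drawing (G : mgraph) := Drawing {
  dpos : mvert G -> plane;
  dcurve : medge G -> set plane }.

Definition is_arc (A : set plane) (x y : plane) : Prop :=
  exists g : R -> plane,
    [/\ {within [set t : R | 0 <= t <= 1], continuous g},
        {in [pred t : R | 0 <= t <= 1] &, injective g},
        A = g @` [set t : R | 0 <= t <= 1], g 0 = x & g 1 = y].

Definition planar_drawing (G : mgraph) (D : drawing G) : Prop :=
  [/\ injective (dpos D),
      forall e, exists x y, mends e = [set x; y]%SET /\
        is_arc (dcurve D e) (dpos D x) (dpos D y),
      forall e x, dcurve D e (dpos D x) -> x \in mends e
    & forall e e' p, e != e' -> dcurve D e p -> dcurve D e' p ->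
        exists2 x, x \in mends e :&: mends e' & p = dpos D x].

(* D' draws the dual graph across the drawing D of the quiver: the vertices of
   the dual graph lie in the complement of D, and an edge labelled a meets D in
   exactly one point, which is an inner point of the arrow a. *)
Definition dual_drawing (Q : quiver) (D : drawing (underlying Q))
    (D' : drawing (dual Q)) : Prop :=
  [/\ forall (n : mvert (dual Q)) (a : medge (underlying Q)),
        ~ dcurve D a (dpos D' n),
      forall (e : medge (dual Q)) (a : medge (underlying Q)),
        a != dlabel e -> dcurve D' e `&` dcurve D a = set0
    & forall e : medge (dual Q), exists2 p,
        dcurve D' e `&` dcurve D (dlabel e : medge (underlying Q)) = [set p]
        & forall v, p <> dpos D v].

Definition acts_by (G : mgraph) (D : drawing G) (rho : plane -> plane)
    (fv : mvert G -> mvert G) (fe : medge G -> medge G) : Prop :=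
  (forall x, dpos D (fv x) = rho (dpos D x)) /\
  (forall e, dcurve D (fe e) = rho @` dcurve D e).

(* The drawing D of the fibered product is glued along a0 from a drawing of the
   first copy of Q0 on one side of the line through a0 and from a drawing of the
   second copy on the other side; a0 itself is drawn as a segment. *)
Definition glued_along (Q0 : quiver) (a0 : arr Q0)
    (D : drawing (underlying (fp_quiver a0))) : Prop :=
  let p := dpos D (inl (src a0) : vert (fp_quiver a0)) in
  let q := dpos D (inl (tgt a0) : vert (fp_quiver a0)) in
  [/\ dcurve D (inl a0 : arr (fp_quiver a0)) = segment p q,
      forall (a : arr Q0) x,
        dcurve D (inl a : arr (fp_quiver a0)) x -> 0 <= dot (x - p) (perp (q - p))
    & forall (a : arr Q0) x,
        dcurve D (copy2a a0 a : arr (fp_quiver a0)) x ->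
        dot (x - p) (perp (q - p)) <= 0].

End Plane.

(* Main.v *)
Require Import Defs.
From HB Require Import structures.
From mathcomp Require Import all_boot all_order all_algebra all_fingroup.
From mathcomp Require Import zify ring lra.

Set Implicit Arguments.
Unset Strict Implicit.
Unset Printing Implicit Defensive.

Import Order.TTheory GRing.Theory Num.Theory.

(** Rooting the dual tree of Q0 at the boundary arrow a0 turns every part of the
    statement into an assertion about nested intervals of the line.

    Layout.  Away from a0, the chordless cycles of Q0 can be added one at a
    time, each new cycle sharing a single arrow with the earlier ones, because
    the dual graph is a tree ([cycle_order]).  That the new cycle has no further
    vertex in common with them is a matter of counting: so far there are at most
    as many vertices as arrows on the rim, and one more common vertex would
    make this strict for good, whereas in the end the rim consists of the
    boundary arrows, which form a simple cycle and so are no more numerous than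
    the vertices ([growth]).  Hence the vertices can be put on a line, the ends of
    a0 at 0 and 1, in such a way that a new cycle glued on at an arrow t divides
    the interval spanned by t into equal parts, one for each of its other arrows
    ([dimer_layout]).  Each cycle C is then reached from a0 through one of its
    arrows, the one with the largest interval, called top C.

    The fibered product.  A chordless cycle through both ends of a0 contains a0,
    being a full subquiver; therefore the chordless cycles of the fibered product
    are the copies of those of Q0 ([chordless_copyP]).  Its dual graph consists of
    two copies of a rooted tree whose roots are joined by the edge a0, which is
    again a rooted tree ([is_tree_dual_fp]), and its boundary arrows are those of
    the two copies except a0, which form a simple cycle ([boundary_cycle_fp]).  A
    cycle at the largest depth has no interior arrow but its top and may serve to
    measure the distances in the potential ([base_cycle_fp]).

    Potential and action.  In a tree the parity of a distance is a difference of
    depths, so a change of base cycle only changes a global sign.  The edge a0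
    shifts the depths in the second copy by one, whence the relative sign in
    W0 - sigma W0 ([dimer_potential_fp]).  As sigma maps this potential to its
    opposite, it maps the derivatives of the potential to derivatives up to sign,
    and so acts on the Jacobian algebra ([jideal_phi]).

    Drawings.  Lift the vertices to the parabola y = x (1 - x), so that the arrows
    become chords.  Over an interval with midpoint m and half-length h, the chord
    runs at the vertical gap h^2 - (x - m)^2 below the parabola.  The node
    of the dual graph reached through an arrow is put at x = m and gap h^2 / 2,
    between the chord and the parabola.  The dual edge of an arrow other than a0
    runs from its node to that of the next arrow on the way to a0, straight in the
    coordinates x and gap.  Because the intervals are pairwise nested or
    disjoint, and nested ones shrink by a factor of at least two, no two of these
    curves meet where they should not ([chords_meet], [link_chord], [link_link],
    [node_link], [node_chord]), and a dual edge crosses its own arrow once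
    ([link_crossing]).  The second copy is drawn as the mirror image in the
    x-axis.  The dual edge a0 is the vertical segment between the points
    (1/2, 1/8) and (1/2, -1/8), so that the reflection at the line along a0 and
    the reflection at the perpendicular bisector of the dual edge a0 are both
    the map (x, y) |-> (x, -y). *)

Local Open Scope nat_scope.

(** * Trees *)

Section Trees.
Variable G : mgraph.
Implicit Types (x y u v : mvert G) (e : medge G).

Lemma madj_sym : symmetric (@madj G).
Proof. by move=> x y; apply: eq_existsb => e; rewrite setUC. Qed.

Lemma madjP x y : reflect (exists e : medge G, mends e = [set x; y]) (madj x y).
Proof. by apply: (iffP existsP) => -[e /eqP He]; exists e; rewrite ?He. Qed.

Let step (z z' : mvert G * medge G) := mends z.2 == [set z.1; z'.1].

(** [simple_cycle] records edges as well as vertices, so closing up a path takes a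
    choice of edges.  By the last clause, once a pair (z, e) has been put in front,
    the cycle condition only asks that e joins z to u. *)
Lemma path_edges u p : path (@madj G) u p -> uniq (u :: p) ->
  exists l : seq (mvert G * medge G),
    [/\ [seq z.1 | z <- l] = belast u p, uniq [seq z.2 | z <- l],
        forall z, z \in l -> mends z.2 \subset u :: p
      & forall z e, path step (z, e) (rcons l (last u p, e)) =
                    (mends e == [set z; u])].
Proof.
elim: p u => [|y p IHp] u /=.
  by move=> _ _; exists [::]; split=> //= z e; rewrite /step /= andbT.
move=> /andP[/madjP[e He] py] /andP[unyp uyp].
have [l [l1 l2 lsub lpath]] := IHp y py uyp.
exists ((u, e) :: l); split=> /=.
- by rewrite l1.
- rewrite l2 andbT; apply/negP => /mapP[[z f] /lsub /= /subsetP sub fe].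
  have := sub u; rewrite -fe He !inE eqxx => /(_ isT).
  by rewrite -in_cons (negbTE unyp).
- move=> z; rewrite inE => /orP[/eqP -> /=|/lsub /subsetP sub].
    by rewrite He; apply/subsetP => w; rewrite !inE => /orP[]/eqP ->; rewrite eqxx ?orbT.
  by apply/subsetP => w /sub; rewrite !inE => ->; rewrite orbT.
- move=> z f; rewrite {1}/step /=.
  have -> : path step (u, e) (rcons l (last y p, f)) =
            path step (u, e) (rcons l (last y p, e)).
    case: (l) => //= a l'; congr (_ && _).
    by elim: l' a => //= b l' IH a; rewrite IH.
  by rewrite lpath He eqxx andbT.
Qed.

Hypothesis acyclic : forall s, ~~ @simple_cycle G s.

(** Two edges from a vertex v to a set joined up by paths avoiding v would form a
    simple cycle together with such a path. *)
Lemma acyclic_edge_uniq (A : {set mvert G}) v u u' e e' :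
    v \notin A -> u \in A -> u' \in A ->
    connect (fun x y => [&& madj x y, x \in A & y \in A]) u u' ->
    mends e = [set u; v] -> mends e' = [set u'; v] -> e = e'.
Proof.
move=> vA uA u'A /connectP[p0 pp0 lu'] He He'.
have [//|nee'] := eqVneq e e'.
exfalso; case/shortenP: pp0 lu' => p pp up _ lu'.
have pA : {subset u :: p <= A}.
  move=> x; rewrite inE => /orP[/eqP -> //|].
  elim: (p) (u) pp => //= y q IHq w /andP[/and3P[_ _ yA] pq].
  by rewrite inE => /orP[/eqP -> //|]; apply: IHq pq.
have pm : path (@madj G) u p by apply: sub_path pp => x y /and3P[].
have [l [l1 l2 lsub lpath]] := path_edges pm up.
have vp : v \notin u :: p by apply/negP => /pA; rewrite (negbTE vA).
have nl f x : mends f = [set x; v] -> f \notin [seq z.2 | z <- l].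
  move=> Hf; apply/mapP => -[z /lsub /subsetP sub fz].
  by have := sub v; rewrite -fz Hf !inE eqxx orbT -in_cons (negbTE vp) => /(_ isT).
apply: (negP (acyclic ((v, e) :: rcons l (u', e')))).
apply/and4P; split=> //=.
- rewrite map_rcons l1 /= lu' -lastI /= vp.
  by move: up => /= ->.
- rewrite map_rcons /= rcons_uniq mem_rcons inE negb_or nee' (nl _ _ He) (nl _ _ He').
  exact: l2.
- rewrite rcons_path last_rcons /= He' eqxx andbT.
  have := lpath v e; rewrite -lu' He setUC eqxx.
  have eqp (x : mvert G * medge G) : path step x (rcons l (u', e)) =
            path step x (rcons l (u', e')).
    by elim: (l) x => //= b l' IH a; rewrite IH.
  by rewrite eqp.
Qed.

End Trees.

Lemma connect_exit (T : finType) (e : rel T) (A : pred T) x y :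
  connect e x y -> A x -> ~~ A y -> exists u v, [/\ A u, ~~ A v & e u v].
Proof.
case/connectP => p; elim: p x => [|z p IHp] x /=; first by move=> _ -> ->.
move=> /andP[exz pz] ly Ax nAy; have [Az|nAz] := boolP (A z); first exact: (IHp z).
by exists x, z.
Qed.

(** The vertices reached so far are joined up among themselves, so a second edge from
    them to a new vertex would close a simple cycle. *)
Lemma tree_order (G : mgraph) (r : mvert G) : is_tree G ->
  exists s : seq (mvert G),
    [/\ uniq (r :: s), forall x, x \in r :: s
      & forall s1 v s2, s = s1 ++ v :: s2 ->
          exists e u, [/\ u \in r :: s1, mends e = [set u; v] &
            forall e' u', u' \in r :: s1 -> mends e' = [set u'; v] -> e' = e]].
Proof.
case=> /andP[_ /forallP conG] acyc.
pose inA (s : seq (mvert G)) x y :=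
  [&& madj x y, x \in [set z in r :: s] & y \in [set z in r :: s]].
suff H k : k < #|mvert G| -> exists s : seq (mvert G),
    [/\ size s = k, uniq (r :: s), forall x, x \in r :: s -> connect (inA s) r x
      & forall s1 v s2, s = s1 ++ v :: s2 ->
          exists e u, [/\ u \in r :: s1, mends e = [set u; v] &
            forall e' u', u' \in r :: s1 -> mends e' = [set u'; v] -> e' = e]].
  have V0 : 0 < #|mvert G| by apply/card_gt0P; exists r.
  have [|s [ss us cs os]] := H #|mvert G|.-1; first by rewrite prednK.
  exists s; split=> // x; apply/negPn/negP => xs.
  have := max_card [set z in x :: r :: s].
  by rewrite cardsE (card_uniqP _) /= ?xs // ss prednK // ltnn.
elim: k => [_|k IHk kV].
  exists [::]; split=> //= [x|[]//].
  by rewrite inE => /eqP ->.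
have [s [ss us cs os]] := IHk (ltnW kV).
have [v0 vs] : exists v0, v0 \notin r :: s.
  apply/existsP; rewrite -negb_forall; apply/negP => /forallP all_s.
  have : #|mvert G| <= #|r :: s| by apply: subset_leq_card; apply/subsetP => x _.
  by rewrite (card_uniqP us) /= ss leqNgt kV.
have [u [v [us' vs' uv]]] :
    exists u v, [/\ u \in r :: s, v \notin r :: s & madj u v].
  have cv : connect (@madj G) r v0 := forallP (conG r) v0.
  have := @connect_exit _ _ [in r :: s] _ _ cv; apply; last exact: vs.
  exact: mem_head.
have inA_sub x y : inA s x y -> inA (rcons s v) x y.
  by case/and3P=> xy; rewrite /inA xy !inE !mem_rcons !inE => /orP[]-> /orP[]->; rewrite ?orbT.
have csym : connect_sym (inA s).
  by apply: sym_connect_sym => x y; rewrite /inA madj_sym andbCA andbC -andbA; congr (_ && _); rewrite andbC.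
have rs_sub x : x \in r :: s -> connect (inA (rcons s v)) r x.
  by move=> /cs; apply: connect_sub => y z /inA_sub; apply: connect1.
exists (rcons s v); split.
- by rewrite size_rcons ss.
- by rewrite -rcons_cons rcons_uniq vs'.
- move=> x; rewrite -rcons_cons mem_rcons inE => /orP[/eqP ->|/rs_sub //].
  apply: connect_trans (rs_sub _ us') (connect1 _).
  by rewrite /inA uv !inE !mem_rcons -!in_cons !inE eqxx !orbT andbT orbCA -in_cons us' orbT.
- move=> s1 w s2; case/lastP: s2 => [|s2 x].
    rewrite cats1 => /rcons_inj[<- <-].
    have [e He] := madjP _ _ uv; exists e, u; split=> // e' u' u's He'.
    apply: (acyclic_edge_uniq acyc (A := [set z in r :: s]) _ _ _ _ He' He); rewrite ?inE //.
    by apply: connect_trans (cs _ us'); rewrite csym; apply: cs.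
  by rewrite -rcons_cons -rcons_cat => /rcons_inj[/os].
Qed.

(** At a vertex of largest depth on a simple cycle, both edges of the cycle would
    lead to vertices that are not deeper.  This vertex would then be the child end
    of both, against the injectivity of ch. *)
Lemma rooted_is_tree (G : mgraph) (r : mvert G) (d : mvert G -> nat)
    (ch pa : medge G -> mvert G) :
  (forall e, mends e = [set ch e; pa e]) ->
  (forall e, d (ch e) = (d (pa e)).+1) ->
  injective ch -> (forall x, x != r -> exists e, ch e = x) ->
  is_tree G.
Proof.
move=> He hd chI chS; split.
  have con x : connect (@madj G) x r.
    elim: {x}(d x) {-2}x (leqnn (d x)) => [|n IHn] x dx.
      have [->//|/chS[e ex]] := eqVneq x r.
      by move: dx; rewrite -ex hd.
    have [->//|/chS[e ex]] := eqVneq x r.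
    apply: connect_trans (IHn (pa e) _); last by rewrite -ltnS -hd ex.
    by apply: connect1; apply/existsP; exists e; rewrite He ex.
  apply/andP; split; first by apply/card_gt0P; exists r.
  apply/forallP=> x; apply/forallP=> y; apply: connect_trans (con x) _.
  by rewrite (sym_connect_sym (@madj_sym G)).
move=> s; apply/negP => /and4P[s0 us1 us2 cs].
have [z zs zmax] : exists2 z, z \in s & forall w, w \in s -> d w.1 <= d z.1.
  case: s s0 {us1 us2 cs} => // z0 s _.
  have [z zs zmax] := @arg_maxnP _ (Ordinal (ltn0Sn (size s))) xpredT (fun i : 'I_(size s).+1 => d (nth z0 (z0 :: s) i).1) isT.
  exists (nth z0 (z0 :: s) z); first by apply: mem_nth.
  move=> w /(nthP z0)[i iz <-]; exact: (zmax (Ordinal iz)).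
have [i s' rs] := rot_to zs.
have {}zmax w : w \in z :: s' -> d w.1 <= d z.1 by rewrite -rs mem_rot; apply: zmax.
have {}us2 : uniq [seq w.2 | w <- z :: s'] by rewrite -rs map_rot rot_uniq.
have {}us1 : uniq [seq w.1 | w <- z :: s'] by rewrite -rs map_rot rot_uniq.
have {}cs : path.cycle (fun z z' => mends z.2 == [set z.1; z'.1]) (z :: s').
  by rewrite -rs rot_cycle.
have down e x : mends e = [set z.1; x] -> d x <= d z.1 -> ch e = z.1.
  move=> ze dx; have := He e; rewrite ze => E.
  have : ch e \in [set z.1; x] by rewrite E !inE eqxx.
  have : pa e \in [set z.1; x] by rewrite E !inE eqxx orbT.
  rewrite !inE => /orP[]/eqP pe /orP[]/eqP ce //; last first.
    by have := hd e; rewrite pe ce => /eqP; rewrite eqn_leq ltnn andbF.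
  have := hd e; rewrite pe ce => E'.
  by move: dx; rewrite E' ltnn.
case/lastP: s' => [|s' w] in zmax us1 us2 cs {rs}.
  move: cs => /=; rewrite andbT => /eqP E; have := He z.2; rewrite E => E2.
  have : ch z.2 \in [set z.1; z.1] by rewrite E2 !inE eqxx.
  have : pa z.2 \in [set z.1; z.1] by rewrite E2 !inE eqxx orbT.
  rewrite !inE !orbb => /eqP e1 /eqP e2.
  by have := hd z.2; rewrite e1 e2 => /eqP; rewrite eqn_leq ltnn andbF.
have e1 : ch w.2 = z.1.
  move: cs => /=; rewrite rcons_path last_rcons => /andP[_ /eqP E].
  apply: (down _ w.1); first by rewrite E setUC.
  by apply: zmax; rewrite inE mem_rcons inE eqxx orbT.
have e2 : ch z.2 = z.1.
  move: cs; case: s' => [|z' s'] in zmax us1 us2 *.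
    by move=> /= /andP[/eqP E _]; apply: (down _ w.1 E); apply: zmax; rewrite !inE eqxx orbT.
  by move=> /= /andP[/eqP E _]; apply: (down _ z'.1 E); apply: zmax; rewrite !inE eqxx orbT.
move: us2; rewrite map_cons map_rcons /= mem_rcons inE => /andP[/norP[/eqP[]]].
by apply: chI; rewrite e1 e2.
Qed.

(** Each step of a walk changes the colour, so the length of a shortest walk has the
    parity that the colours of its ends impose. *)
Lemma mdist_color (G : mgraph) (col : mvert G -> bool) x y :
  mconnected G ->
  (forall e u v, mends e = [set u; v] -> col u != col v) ->
  odd (mdist x y) = col x (+) col y.
Proof.
move=> /andP[_ /forallP con] colP.
have walk_col p u : path (@madj G) u p -> odd (size p) = col u (+) col (last u p).
  elim: p u => [|v p IHp] u /=; first by rewrite addbb.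
  move=> /andP[/madjP[e /colP uv] /IHp ->].
  by move: uv; case: (col u); case: (col v); case: (col _).
have /connectP[p0 pp0 ly] := forallP (con x) y.
case/shortenP: pp0 ly => p pp up _ ly.
pose P n := [exists q : n.-tuple (mvert G), path (@madj G) x q && (last x q == y)].
have sp : size p < #|mvert G|.
  have := max_card [set z in x :: p].
  by rewrite cardsE (card_uniqP up).
have hP : has P (iota 0 #|mvert G|).
  apply/hasP; exists (size p); first by rewrite mem_iota.
  by apply/existsP; exists (in_tuple p); rewrite pp -ly eqxx.
rewrite /mdist -/P; have := nth_find 0 hP.
rewrite has_find size_iota in hP.
rewrite nth_iota // add0n => /existsP[q /andP[/walk_col E /eqP lq]].
by rewrite size_tuple lq in E; rewrite -E.
Qed.

Lemma set2_eq (T : finType) (a b c d : T) :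
  [set a; b] = [set c; d] -> (a = c /\ b = d) \/ (a = d /\ b = c).
Proof.
move=> E; have ac : a \in [set c; d] by rewrite -E !inE eqxx.
have bc : b \in [set c; d] by rewrite -E !inE eqxx orbT.
have ca : c \in [set a; b] by rewrite E !inE eqxx.
have da : d \in [set a; b] by rewrite E !inE eqxx orbT.
move: ac bc ca da; rewrite !inE => /orP[]/eqP-> /orP[]/eqP->; rewrite ?orbb; [| by auto | by auto |];
 by [move=> _ /eqP->; auto|move=> /eqP->; auto].
Qed.

Lemma uniq_map_inj (T U : eqType) (f : T -> U) (s : seq T) :
  uniq (map f s) -> {in s &, injective f}.
Proof.
move=> us a b /(nthP a)[i si <-] /(nthP a)[j sj <-] E; congr nth; apply/eqP.
by rewrite -(nth_uniq (f a) _ _ us) ?size_map // !(nth_map a) // E.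
Qed.

(** * Chordless cycles and the dual graph *)

Section ChordlessCycles.
Variable Q : quiver.
Implicit Types (C D : {set arr Q}) (a b : arr Q).

Definition cvert C : {set vert Q} := [set src a | a in C].

Lemma chordless_walk_uniq (s : seq (arr Q)) : chordless_walk s -> uniq s.
Proof. by case/and4P=> _ _ /map_uniq. Qed.

Lemma chordlessP C :
  reflect (exists2 s, chordless_walk s & C = [set a in s]) (chordless C).
Proof.
apply: (iffP existsP) => [[s /andP[ws /eqP E]]|[s ws E]]; first by exists s.
have sC : size s == #|C| by rewrite E cardsE (card_uniqP (chordless_walk_uniq ws)).
by exists (Tuple sC); apply/andP; split=> //; apply/eqP.
Qed.

Lemma chordless_walk_rot n (s : seq (arr Q)) :
  chordless_walk (rot n s) = chordless_walk s.
Proof.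
rewrite /chordless_walk rot_cycle !map_rot rot_uniq -!size_eq0 size_rot.
congr [&& _, _, _ & _]; apply: eq_forallb => a.
by rewrite !mem_rot.
Qed.

Lemma chordless_at C a : chordless C -> a \in C ->
  exists2 p, chordless_walk (a :: p) & C = [set b in a :: p].
Proof.
move=> /chordlessP[s ws ->]; rewrite inE => sa.
have [i p E] := rot_to sa; exists p; first by rewrite -E chordless_walk_rot.
by apply/setP=> b; rewrite !inE -in_cons -E mem_rot.
Qed.

Lemma cvert_src C a : a \in C -> src a \in cvert C.
Proof. exact: imset_f. Qed.

Lemma chordless_full C a :
  chordless C -> src a \in cvert C -> tgt a \in cvert C -> a \in C.
Proof.
move=> /chordlessP[s /and4P[_ _ _ /forallP full] ->] sa ta.
have mem x : x \in cvert [set a in s] -> x \in [seq src b | b <- s].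
  by case/imsetP=> b; rewrite inE => bs ->; apply: map_f.
by rewrite inE; apply: (implyP (full a)); rewrite !mem.
Qed.

(** The vertices of C are numbered along the path from the end of t back to its
    start, so t is the only arrow that does not raise the number by one. *)
Lemma chordless_index C t : chordless C -> t \in C ->
  exists ix : vert Q -> nat,
    [/\ ix (tgt t) = 0 /\ ix (src t) = #|C|.-1,
        forall a, a \in C -> a != t -> ix (tgt a) = (ix (src a)).+1,
        {in cvert C, forall x, ix x <= #|C|.-1},
        {in cvert C &, injective ix}
      & {in C &, injective (@src Q)} /\ forall a, a \in C -> tgt a \in cvert C].
Proof.
move=> cC tC; have [p wp EC] := chordless_at cC tC.
have up := chordless_walk_uniq wp.
have sC : #|C| = (size p).+1 by rewrite EC cardsE (card_uniqP up).
have /and4P[_ cyc us _] := wp.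
move: us; rewrite map_cons => /andP[tp us].
have memC a : (a \in C) = (a == t) || (a \in p) by rewrite EC !inE.
exists (fun x => index x [seq src a | a <- p]).
have ixlast : index (src t) [seq src a | a <- p] = size p.
  by rewrite memNindex // size_map.
have ixnth i : i < size p -> index (src (nth t p i)) [seq src a | a <- p] = i.
  by move=> ip; rewrite -(nth_map t (src t)) // index_uniq // size_map.
have tnth i : i < size p -> tgt (nth t p i) = src (nth t (rcons p t) i.+1).
  move=> ip; have /(pathP t) := cyc; rewrite size_rcons => /(_ i.+1).
  by rewrite ltnS => /(_ ip) /eqP <-; rewrite /= nth_rcons ip.
have ttgt : tgt t = src (nth t (rcons p t) 0).
  by have /(pathP t) := cyc; rewrite size_rcons => /(_ 0 isT) /eqP.
rewrite sC /=; split.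
- split=> //; rewrite ttgt; case: (p) => [|b q] /=; first by [].
  by rewrite eqxx.
- move=> a; rewrite memC => /orP[->//|ap] _.
  have ia : index a p < size p by rewrite index_mem.
  have := ixnth _ ia; rewrite nth_index // => ->.
  have := tnth _ ia; rewrite nth_index // => ->.
  rewrite nth_rcons; case: ltngtP => [/ixnth //|gt|eqs]; last by rewrite ixlast.
  by rewrite ltnS leqNgt ia in gt.
- by move=> x _; rewrite -(size_map (@src Q)) index_size.
- have mem x : x \in cvert C -> x = src t \/ x \in [seq src a | a <- p].
    case/imsetP=> a; rewrite memC => /orP[/eqP ->|ap] ->; first by left.
    by right; apply: map_f.
  move=> x y /mem[->|xp] /mem[->|yp] //; rewrite ?ixlast => E.
  + by move: yp; rewrite -index_mem -E size_map ltnn.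
  + by move: xp; rewrite -index_mem E size_map ltnn.
  + by rewrite -(nth_index (src t) xp) E nth_index.
- split.
    move=> a b aC bC sab; have : {in t :: p &, injective (@src Q)}.
      by apply: uniq_map_inj; rewrite /= tp.
    by apply; rewrite ?in_cons -?memC.
  move=> a; rewrite memC => /orP[/eqP ->|ap].
    rewrite ttgt; case E: (p) => [|b q] /=; first by apply: imset_f.
    by apply: imset_f; rewrite memC E mem_head orbT.
  have ia : index a p < size p by rewrite index_mem.
  have := tnth _ ia; rewrite nth_index // => ->.
  rewrite nth_rcons; case: ltngtP => [ia'|gt|_]; last exact: imset_f.
    by apply: imset_f; rewrite memC mem_nth ?orbT.
  by rewrite ltnS leqNgt ia in gt.
Qed.

Lemma cvert_tgt C a : chordless C -> a \in C -> tgt a \in cvert C.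
Proof. by move=> cC aC; have [ix [_ _ _ _ [_ ->]]] := chordless_index cC aC. Qed.

Lemma chordless_src_inj C : chordless C -> {in C &, injective (@src Q)}.
Proof.
by move=> cC a b aC; have [ix [_ _ _ _ [I _]]] := chordless_index cC aC; apply: I.
Qed.

Lemma card_cvert C : chordless C -> #|cvert C| = #|C|.
Proof. by move=> cC; apply: card_in_imset; apply: chordless_src_inj. Qed.

(** A chordless cycle is a full subquiver, so it contains all the arrows parallel to one
    of its arrows. *)
Lemma parallel_arrows a b : (exists2 C, chordless C & a \in C) ->
  src b = src a -> tgt b = tgt a -> b = a.
Proof.
move=> [C cC aC] sab tab.
have bC : b \in C by apply: chordless_full; rewrite ?sab ?tab ?cvert_src ?cvert_tgt.
exact: (chordless_src_inj cC).
Qed.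

End ChordlessCycles.

Section DualGraph.
Variable Q : quiver.
Implicit Types (C D : ccycle Q) (b : barrow Q) (e : medge (dual Q)).

Lemma dual_edge_cc C D a : C != D -> a \in val C -> a \in val D ->
  exists e, val e = (a, [set inl C; inl D]).
Proof.
move=> nCD aC aD; have H : is_dedge (a, [set inl C; inl D] : {set dnode Q}).
  by apply/orP; left; apply/existsP; exists C; apply/existsP; exists D; rewrite nCD aC aD /=.
by exists (exist (@is_dedge Q) _ H : dedge Q).
Qed.

Lemma dual_edge_cb C b : val b \in val C ->
  exists e, val e = (val b, [set inl C; inr b]).
Proof.
move=> bC; have H : is_dedge (val b, [set inl C; inr b] : {set dnode Q}).
  by apply/orP; right; apply/existsP; exists C; apply/existsP; exists b; rewrite eqxx bC /=.
by exists (exist (@is_dedge Q) _ H : dedge Q).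
Qed.

Variant dual_edge_spec e : Prop :=
| DualEdgeCC C D of C != D & dlabel e \in val C & dlabel e \in val D
    & mends e = [set inl C; inl D]
| DualEdgeCB C b of dlabel e = val b & dlabel e \in val C
    & mends e = [set inl C; inr b].

Lemma dual_edgeP e : dual_edge_spec e.
Proof.
have /orP[/existsP[C /existsP[D /and4P[nCD aC aD /eqP E]]]|] := valP e.
  exact: (DualEdgeCC nCD aC aD E).
by case/existsP=> C /existsP[b /and3P[/eqP ab aC /eqP E]]; exact: (DualEdgeCB ab aC E).
Qed.

Lemma boundary_uniq b C D : val b \in val C -> val b \in val D -> C = D.
Proof.
move=> bC bD; have bb : #|[set C0 | chordless C0 & val b \in C0]| == 1 := valP b.
have [E EE] := cards1P bb.
have : val C \in [set C0 | chordless C0 & val b \in C0] by rewrite inE (valP C).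
have : val D \in [set C0 | chordless C0 & val b \in C0] by rewrite inE (valP D).
rewrite EE !inE => /eqP eD /eqP eC; apply: val_inj.
by rewrite eC eD.
Qed.

Lemma pmap_split (T U : eqType) (f : T -> option U) (t : seq T) s1 x s2 :
  pmap f t = s1 ++ x :: s2 -> exists t1 y t2,
    [/\ t = t1 ++ y :: t2, f y = Some x & pmap f t1 = s1].
Proof.
elim: t s1 => [|y t IHt] [|z s1] //=.
  case E: (f y) => [u|] /=.
    by case=> <- _; exists [::], y, t.
  move/(IHt [::]) => [t1 [w [t2 [-> fw <-]]]]; exists (y :: t1), w, t2.
  by rewrite /= E.
case E: (f y) => [u|] /=.
  case=> <- /IHt[t1 [w [t2 [-> fw <-]]]]; exists (y :: t1), w, t2.
  by rewrite /= E.
move/(IHt (z :: s1)) => [t1 [w [t2 [-> fw Es]]]]; exists (y :: t1), w, t2.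
by rewrite /= E Es.
Qed.

Hypothesis treeQ : is_tree (dual Q).

(** The nodes of boundary arrows are leaves, so dropping them from an ordering of the
    whole dual tree leaves an ordering of the cycles with the same property. *)
Lemma cycle_order C1 : exists s : seq (ccycle Q),
  [/\ uniq (C1 :: s), forall C, C \in C1 :: s
    & forall s1 D s2, s = s1 ++ D :: s2 -> exists t C,
        [/\ C \in C1 :: s1, t \in val C, t \in val D
          & forall C' a, C' \in C1 :: s1 -> a \in val C' -> a \in val D ->
              a = t /\ C' = C]].
Proof.
have [l [ul al ol]] := tree_order (inl C1 : mvert (dual Q)) treeQ.
pose pr (x : mvert (dual Q)) := if x is inl C then Some C else None.
have mem_pr (t : seq (mvert (dual Q))) C : (C \in pmap pr t) = (inl C \in t).
  rewrite mem_pmap; apply/mapP/idP => [[[C'|b] // tC [->]//]|tC].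
  by exists (inl C).
have mem_pr1 t C : (C \in C1 :: pmap pr t) = (inl C \in inl C1 :: t).
  by rewrite !inE mem_pr.
have inlE (C D : ccycle Q) : (inl C : mvert (dual Q)) = inl D -> C = D by case.
exists (pmap pr l); split.
- move: ul => /= /andP[ul1 ul2]; rewrite mem_pr ul1 /=.
  apply: (@pmap_uniq _ _ pr (fun C => inl C)) => // -[C|b] //=.
- by move=> C; rewrite mem_pr1.
move=> s1 D s2 /pmap_split[t1 [[E|b] [t2 [El Ey <-]]]] //.
case: Ey => ED; rewrite {}ED in El => {E s1 s2}.
have [e [u [u1 Eu uniq_e]]] := ol _ _ _ El.
have D1 : inl D \notin inl C1 :: t1.
  move: ul; rewrite El -cat_cons cat_uniq => /and3P[_ /hasPn H _].
  by apply: H; rewrite mem_head.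
have [t [C [C1' tC tD Ee]]] : exists t C,
    [/\ (inl C : mvert (dual Q)) \in inl C1 :: t1, t \in val C, t \in val D
      & val e = (t, [set inl C; inl D])].
  have Ev : val e = (dlabel e, mends e) by exact: surjective_pairing.
  case: (dual_edgeP e) => [C D' nCD eC eD|C b eb eC] E.
    case: (set2_eq (etrans (esym E) Eu)) => [[uC [ED]]|[[ED] uD]].
      by exists (dlabel e), C; rewrite -ED Ev E; rewrite -uC in u1.
    by exists (dlabel e), D'; rewrite -uD in u1; rewrite -ED Ev E setUC.
  case: (set2_eq (etrans (esym E) Eu)) => -[] // [ED] ub.
  move: u1; rewrite -ub inE /= => /path.splitPr H.
  case: H Eu uniq_e D1 El => m1 m2 Eu uniq_e D1 El.
  have [e2 [u2 [u21 Eu2 _]]] : exists e u, [/\ u \in inl C1 :: m1, mends e = [set u; inr b]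
    & forall e' u', u' \in inl C1 :: m1 -> mends e' = [set u'; inr b] -> e' = e].
    by apply: (ol m1 (inr b) (m2 ++ inl D :: t2)); rewrite El -catA.
  have [C' uC' bC'] : exists2 C', u2 = inl C' & val b \in val C'.
    case: (dual_edgeP e2) => [C' D' nCD' _ _|C' b' eb' eC'] E'.
      by case: (set2_eq (etrans (esym E') Eu2)) => -[].
    case: (set2_eq (etrans (esym E') Eu2)) => -[] // <- [bb'].
    by exists C' => //; rewrite -bb' -eb'.
  have CD : C' = D by apply: (boundary_uniq bC'); rewrite -ED -eb.
  by move: D1; rewrite -cat_cons mem_cat -CD -uC' u21.
exists t, C; split=> //; first by rewrite mem_pr1.
move=> C' a; rewrite mem_pr1 => C'1 aC' aD.
have nC'D : C' != D by apply: contraNneq D1 => <-.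
have [e' Ee'] := dual_edge_cc nC'D aC' aD.
have : e' = e by apply: (uniq_e _ _ C'1); rewrite /= Ee'.
move/(congr1 val); rewrite Ee Ee' => -[-> /set2_eq[[[->]//]|[[E _]]]].
by rewrite E eqxx in nC'D.
Qed.

End DualGraph.

(** * Growth of a dimer tree quiver by one cycle at a time *)

Section Growth.
Variable Q : quiver.
Hypothesis dimQ : dimer_tree_quiver Q.
Implicit Types (X : seq (ccycle Q)) (C D : ccycle Q) (t : arr Q).

Lemma ncyclesE (a : arr Q) : ncycles a = #|[set C : ccycle Q | a \in val C]|.
Proof.
rewrite /ncycles -[RHS](card_imset _ val_inj); apply: eq_card => C.
rewrite !inE; apply/andP/imsetP => [[cC aC]|[D aD ->]].
  by exists (exist _ C cC); rewrite ?inE.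
by move: aD; rewrite inE => aD; split; first exact: (valP D).
Qed.

Definition cvs (X : seq (ccycle Q)) : {set vert Q} :=
  [set x | has (fun C : ccycle Q => x \in cvert (val C)) X].
(** For an initial part of an ordering of the cycles, this is the boundary of the region
    that they fill; for all the cycles, it is the set of boundary arrows. *)
Definition rim (X : seq (ccycle Q)) : {set arr Q} :=
  [set a | count (fun C : ccycle Q => a \in val C) X == 1].

Lemma cvs_rcons X D : cvs (rcons X D) = cvs X :|: cvert (val D).
Proof. by apply/setP=> x; rewrite !inE has_rcons orbC. Qed.

(** Gluing D on at t removes t from the rim and adds the other arrows of D, none of
    which is old. *)
Lemma rim_rcons X D C t : uniq X ->
  C \in X -> t \in val C -> t \in val D ->
  (forall C' a, C' \in X -> a \in val C' -> a \in val D -> a = t /\ C' = C) ->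
  #|rim (rcons X D)| + 2 = #|rim X| + #|val D|.
Proof.
move=> uX CX tC tD uni.
have ct : count (fun C : ccycle Q => t \in val C) X = 1.
  transitivity (count_mem C X); last by rewrite count_uniq_mem // CX.
  apply: eq_in_count => C' C'X /=; apply/idP/eqP => [tC'|-> //].
  by case: (uni _ _ C'X tC' tD).
have tX : t \in rim X by rewrite inE ct.
have -> : rim (rcons X D) = (rim X :\ t) :|: (val D :\ t).
  apply/setP=> a; rewrite !inE -cats1 count_cat /= addn0.
  have [->|nat_] /= := eqVneq a t; first by rewrite ct tD.
  have [aD|aD] := boolP (a \in val D); last by rewrite addn0 orbF.
  rewrite orbT; suff -> : count (fun C : ccycle Q => a \in val C) X = 0 by [].
  apply/eqP; rewrite -leqn0 leqNgt -has_count; apply/hasP => -[C' C'X aC'].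
  by case: (uni _ _ C'X aC' aD) => E; rewrite E eqxx in nat_.
rewrite cardsU (_ : _ :&: _ = set0) ?cards0 ?subn0.
  by rewrite (cardsD1 t (rim X)) (cardsD1 t (val D)) tX tD; lia.
apply/setP=> a; rewrite !inE; apply/negP => /andP[/andP[nat_ ca] /andP[_ aD]].
have : has (fun C : ccycle Q => a \in val C) X by rewrite has_count (eqP ca).
case/hasP=> C' C'X aC'; case: (uni _ _ C'X aC' aD) => E.
by rewrite E eqxx in nat_.
Qed.

Lemma cvs_full X : (forall C, C \in X) -> forall x, x \in cvs X.
Proof.
case: dimQ => [/andP[_ /forallP con] _ _ cov [_ [w sw _]]] fullX x.
have incid a : src a \in cvs X /\ tgt a \in cvs X.
  have [C cC aC] := cov a; rewrite !inE; split; apply/hasP;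
    exists (exist _ C cC : ccycle Q); rewrite ?fullX //=; first exact: cvert_src.
  exact: cvert_tgt.
have a0 : arr Q by case: w sw => [|[z a] w].
have [xs|] := boolP (x \in cvs X); first by [].
have /connectP[[|y p] /= pp lp] := forallP (con x) (src a0).
  by rewrite -lp; case: (incid a0) => ->.
case/andP: pp => /madjP[e /= Ee] _.
have : x \in [set src e; tgt e] by rewrite Ee !inE eqxx.
by rewrite in_set2 => /orP[]/eqP-> /negP[]; case: (incid e).
Qed.

Lemma rim_full X : uniq X -> (forall C, C \in X) ->
  rim X = [set a | boundary a].
Proof.
move=> uX fullX; apply/setP=> a; rewrite !inE /boundary ncyclesE -size_filter.
rewrite -(card_uniqP (filter_uniq _ uX)); congr (_ == _); apply: eq_card => C.
by rewrite !inE mem_filter fullX andbT.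
Qed.

(** A simple cycle has as many vertices as edges. *)
Lemma card_boundary : #|[set a : arr Q | boundary a]| <= #|vert Q|.
Proof.
case: dimQ => [_ _ _ _ [_ [w /and4P[_ u1 u2 _] Ew]]].
have <- : #|[seq z.2 | z <- w]| = #|[set a : arr Q | boundary a]|.
  by apply: eq_card => a; rewrite Ew inE.
rewrite (card_uniqP u2) size_map -(size_map fst) -(card_uniqP u1).
exact: max_card.
Qed.

(** The dual tree controls the arrows that a new cycle shares with the earlier ones;
    its vertices are controlled by counting.  The first cycle has as many vertices
    as arrows, and at each step the rim gains |D| - 2 arrows while at most |D| - 2
    vertices are added, with equality only if the new cycle meets the earlier ones
    just in the ends of t.  As the boundary arrows are no more numerous than the
    vertices, equality holds at every step. *)
Lemma growth C1 : exists s : seq (ccycle Q),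
  [/\ uniq (C1 :: s), forall C, C \in C1 :: s
    & forall s1 D s2, s = s1 ++ D :: s2 -> exists t C,
        [/\ C \in C1 :: s1, t \in val C, t \in val D,
          forall C' a, C' \in C1 :: s1 -> a \in val C' -> a \in val D ->
              a = t /\ C' = C
          & forall C' x, C' \in C1 :: s1 -> x \in cvert (val C') ->
              x \in cvert (val D) -> x = src t \/ x = tgt t]].
Proof.
have [_ noloop _ _ [treeQ _]] := dimQ.
have [s [us als os]] := cycle_order treeQ C1.
have cvD (D : ccycle Q) : #|cvert (val D)| = #|val D| := card_cvert (valP D).
have cvs_ge s1 D s2 t C : s = s1 ++ D :: s2 ->
    C \in C1 :: s1 -> t \in val C -> t \in val D ->
    [set src t; tgt t] \subset cvs (C1 :: s1) :&: cvert (val D).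
  move=> Es Cs tC tD; apply/subsetP => x; rewrite inE => xt.
  rewrite inE; apply/andP; split.
    rewrite inE; apply/hasP; exists C => //.
    move: xt; rewrite !inE => /orP[]/eqP->; first exact: cvert_src.
    exact: (cvert_tgt (valP C)).
  move: xt; rewrite !inE => /orP[]/eqP->; first exact: cvert_src.
  exact: (cvert_tgt (valP D)).
have step s1 D s2 : s = s1 ++ D :: s2 ->
    #|rim (C1 :: rcons s1 D)| + 2 = #|rim (C1 :: s1)| + #|val D| /\
    #|cvs (C1 :: rcons s1 D)| + 2 <= #|cvs (C1 :: s1)| + #|val D|.
  move=> Es; have [t [C [Cs tC tD uni]]] := os _ _ _ Es.
  have us1 : uniq (C1 :: s1).
    by move: us; rewrite Es -cat_cons cat_uniq => /and3P[].
  rewrite -rcons_cons (rim_rcons us1 Cs tC tD uni); split=> //.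
  rewrite cvs_rcons -cvD -(cardsUI (cvs (C1 :: s1))) leq_add2l.
  have <- : #|[set src t; tgt t]| = 2 by rewrite cards2 noloop.
  by apply/subset_leq_card/(cvs_ge _ _ _ _ _ Es Cs).
have low s1 s2 : s = s1 ++ s2 -> #|cvs (C1 :: s1)| <= #|rim (C1 :: s1)|.
  elim/last_ind: s1 s2 => [|s1 D IH] s2 Es.
    have -> : cvs [:: C1] = cvert (val C1) by apply/setP=> x; rewrite inE /= orbF.
    have -> : rim [:: C1] = val C1 by apply/setP=> x; rewrite inE /= addn0; case: (_ \in _).
    by rewrite cvD.
  rewrite cat_rcons in Es; have [E1 E2] := step _ _ _ Es; have := IH _ Es.
  by lia.
have high s2 s1 : s = s1 ++ s2 -> #|rim (C1 :: s1)| <= #|cvs (C1 :: s1)|.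
  elim: s2 s1 => [|D s2 IH] s1 Es.
    rewrite cats0 in Es; rewrite -Es rim_full //.
    apply: leq_trans card_boundary _; rewrite -cardsT; apply: subset_leq_card.
    by apply/subsetP => x _; apply: cvs_full.
  have [E1 E2] := step _ _ _ Es; have := IH (rcons s1 D); rewrite cat_rcons => /(_ Es).
  by lia.
exists s; split=> // s1 D s2 Es; have [t [C [Cs tC tD uni]]] := os _ _ _ Es.
exists t, C; split=> // C' x C's xC' xD.
have E : [set src t; tgt t] = cvs (C1 :: s1) :&: cvert (val D).
  apply/eqP; rewrite eqEcard (cvs_ge _ _ _ _ _ Es Cs) // cards2 noloop.
  have [E1 E2] := step _ _ _ Es; have L := low _ _ Es.
  have H := high s2 (rcons s1 D); rewrite cat_rcons in H; have := H Es.
  have := cardsUI (cvs (C1 :: s1)) (cvert (val D)).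
  by rewrite -cvs_rcons cvD rcons_cons; lia.
have : x \in [set src t; tgt t].
  by rewrite E inE xD andbT inE; apply/hasP; exists C'.
by rewrite !inE => /orP[]/eqP; auto.
Qed.

End Growth.

(** * Chordless cycles of the fibered product *)

Section Copies.
Variables (Q0 : quiver) (a0 : arr Q0).
Notation Q := (fp_quiver a0).
Implicit Types (b : bool) (x y : vert Q0) (a : arr Q0).

Definition copyv b x : vert Q := if b then copy2v a0 x else inl x.
Definition copya b a : arr Q := if b then copy2a a0 a else inl a.

Lemma copya_src b a : src (copya b a) = copyv b (src a).
Proof. by case: b; rewrite //= copy2_src. Qed.

Lemma copya_tgt b a : tgt (copya b a) = copyv b (tgt a).
Proof. by case: b; rewrite //= copy2_tgt. Qed.

Lemma sigmav_copy b x : sigmav (copyv b x) = copyv (~~ b) x.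
Proof. by case: b; rewrite //= sigmav_copy2. Qed.

Lemma sigmaa_copy b a : sigmaa (copya b a) = copya (~~ b) a.
Proof.
by case: b => //; rewrite -[RHS](sigmaaK (a0 := a0)).
Qed.

Lemma copyv_inj b : injective (copyv b).
Proof.
case: b => x y; last by case.
by move/(congr1 (@sigmav _ a0)); rewrite !sigmav_copy2 => -[].
Qed.

Lemma copya_inj b : injective (copya b).
Proof.
case: b => x y; last by case.
by move/(congr1 (@sigmaa _ a0)); rewrite !(sigmaa_copy true) => -[].
Qed.

Lemma copyv_ex (x : vert Q) : exists b y, x = copyv b y.
Proof.
case: x => [y|y]; first by exists false, y.
by exists true, (val y); rewrite -[LHS](sigmavK (a0 := a0)).
Qed.

Lemma copya_ex (u : arr Q) : exists b a, u = copya b a.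
Proof.
case: u => [a|a]; first by exists false, a.
by exists true, (val a); apply: (can_inj (sigmaaK (a0 := a0))); rewrite (sigmaa_copy true).
Qed.

Lemma copyv_src0 b : copyv b (src a0) = inl (src a0).
Proof. by case: b; rewrite //= copy2v_src. Qed.

Lemma copyv_tgt0 b : copyv b (tgt a0) = inl (tgt a0).
Proof. by case: b; rewrite //= copy2v_tgt. Qed.

Lemma copya0 b : copya b a0 = inl a0.
Proof. by case: b; rewrite //= /copy2a insubF // eqxx. Qed.

Lemma copyv_cross x y : copyv false x = copyv true y ->
  x = y /\ (x = src a0 \/ x = tgt a0).
Proof.
rewrite /= /copy2v; case: insubP => //= => H [->]; split=> //.
by move: H; rewrite negb_and !negbK => /orP[]/eqP; auto.
Qed.

Lemma copya_cross a (c : arr Q0) : copya false a = copya true c -> a = a0 /\ c = a0.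
Proof.
by rewrite /= /copy2a; case: insubP => //=; rewrite negbK => /eqP -> [->].
Qed.

Lemma copyv_neq b b' x y : b != b' -> copyv b x = copyv b' y ->
  x = y /\ (x = src a0 \/ x = tgt a0).
Proof.
case: b b' => [][] // _; last exact: copyv_cross.
by move=> E; have [-> //] := copyv_cross (esym E).
Qed.

Lemma copya_neq b b' a (c : arr Q0) : b != b' -> copya b a = copya b' c -> a = a0 /\ c = a0.
Proof.
case: b b' => [][] // _; last exact: copya_cross.
by move=> E; have [] := copya_cross (esym E).
Qed.

Lemma copya_eq b b' a (c : arr Q0) : a != a0 -> copya b a = copya b' c -> b = b' /\ a = c.
Proof.
move=> aa0 E; have [bb|bb] := eqVneq b b'; first by rewrite bb in E *; split=> //; apply: copya_inj E.
by have [H _] := copya_neq bb E; rewrite H eqxx in aa0.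
Qed.

Lemma sigmav_fix : [set x | sigmav (a0 := a0) x == x] = [set inl (src a0); inl (tgt a0)].
Proof.
apply/setP=> x; rewrite !inE; have [b [y ->]] := copyv_ex x.
rewrite sigmav_copy -(copyv_src0 b) -(copyv_tgt0 b) !(inj_eq (copyv_inj (b := b))).
apply/eqP/orP => [/copyv_neq|[]/eqP->]; rewrite ?copyv_src0 ?copyv_tgt0 //.
by case=> [|_]; [case: b|case=> ->; rewrite eqxx; auto].
Qed.

Lemma sigmaa_fix : [set a | sigmaa (a0 := a0) a == a] = [set inl a0].
Proof.
apply/setP=> x; rewrite !inE; have [b [y ->]] := copya_ex x.
rewrite sigmaa_copy -(copya0 b) (inj_eq (copya_inj (b := b))).
apply/eqP/eqP => [/copya_neq|->]; rewrite ?copya0 //.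
by case=> [|-> //]; case: b.
Qed.

Hypothesis noloop : forall a : arr Q0, src a != tgt a.
Hypothesis no2cycle : forall a b : arr Q0, ~~ ((tgt a == src b) && (tgt b == src a)).
Hypothesis cov : forall a : arr Q0, exists2 C, chordless C & a \in C.

(** If an arrow between two vertices of one copy came from the other copy, both of its ends
    would be ends of a0, so it would be a loop, or parallel or opposite to a0. *)
Lemma copy_full b (u : arr Q) x y :
  src u = copyv b x -> tgt u = copyv b y -> exists a, u = copya b a.
Proof.
have [b' [a ->]] := copya_ex u; rewrite copya_src copya_tgt.
have [->|nb] := eqVneq b' b; first by exists a.
move=> /(copyv_neq nb)[_ sa] /(copyv_neq nb)[_ ta].
exists a0; rewrite copya0 -(copya0 b'); congr copya.
case: sa ta => sa [] ta.
- by have := noloop a; rewrite sa ta eqxx.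
- exact: (parallel_arrows (cov a0)).
- by have := no2cycle a a0; rewrite sa ta !eqxx.
- by have := noloop a; rewrite sa ta eqxx.
Qed.

Lemma noloop_fp (u : arr Q) : src u != tgt u.
Proof.
by have [b [a ->]] := copya_ex u; rewrite copya_src copya_tgt (inj_eq (@copyv_inj b)).
Qed.

Lemma no2cycle_fp (u v : arr Q) : ~~ ((tgt u == src v) && (tgt v == src u)).
Proof.
have [b [a ->]] := copya_ex u; apply/negP => /andP[/eqP uv /eqP vu].
rewrite copya_src in vu; rewrite copya_tgt in uv.
have [c Ev] := copy_full (esym uv) vu.
have := no2cycle a c; rewrite -!(inj_eq (@copyv_inj b)) -!copya_src -!copya_tgt -Ev.
by rewrite copya_tgt copya_src uv vu !eqxx.
Qed.

Lemma copya_map b (s : seq (arr Q)) : (forall u, u \in s -> u \in codom (copya b)) ->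
  exists s0, s = map (copya b) s0.
Proof.
elim: s => [|u s IH] H; first by exists [::].
have [|s0 ->] := IH; first by move=> v vs; apply: H; rewrite inE vs orbT.
have /codomP[a ->] := H u (mem_head _ _).
by exists (a :: s0).
Qed.

Lemma copy_chordless_walk b s : chordless_walk (map (copya b) s) = chordless_walk s.
Proof.
rewrite /chordless_walk; congr [&& _, _, _ & _].
- by case: s.
- rewrite cycle_map; apply: eq_cycle => u v.
  transitivity (tgt (copya b u) == src (copya b v)); first by [].
  by rewrite copya_src copya_tgt (inj_eq (@copyv_inj b)).
- rewrite -map_comp (eq_map (g := copyv b \o @src Q0)) => [|a]; last exact: copya_src.
  by rewrite map_comp map_inj_uniq //; apply: copyv_inj.
have Es : [seq src u | u <- map (copya b) s] = map (copyv b) [seq src a | a <- s].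
  by rewrite -!map_comp; apply: eq_map => a; apply: copya_src.
rewrite Es; apply/forallP/forallP => H a; apply/implyP.
  move=> /andP[sa ta]; have := H (copya b a).
  by rewrite copya_src copya_tgt !(mem_map (@copyv_inj b)) (mem_map (@copya_inj b)) sa ta.
case/andP=> /mapP[x xs sa] /mapP[y ys ta]; have [c Ec] := copy_full sa ta.
rewrite Ec copya_src in sa *; rewrite Ec copya_tgt in ta.
rewrite (mem_map (@copya_inj b)); apply: (implyP (H c)).
by rewrite (copyv_inj sa) (copyv_inj ta) xs ys.
Qed.

Let off (x : vert Q) := (x != inl (src a0)) && (x != inl (tgt a0)).

(** A path can pass from one copy to the other only at an end of a0. *)
Lemma copy_path b (u : arr Q) p :
  path (fun v w : arr Q => tgt v == src w) u p -> all (fun c => off (src c)) p ->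
  u \in codom (copya b) -> forall v, v \in u :: p -> v \in codom (copya b).
Proof.
elim: p u => [|w p IHp] u; first by move=> _ _ ub v; rewrite inE => /eqP ->.
move=> /andP[/eqP uw pp] /andP[ow op] ub v; rewrite inE => /orP[/eqP -> //|].
apply: (IHp w) => //; have /codomP[a Ea] := ub; have [b' [c Ec]] := copya_ex w.
rewrite Ea Ec copya_tgt copya_src in uw; rewrite Ec copya_src in ow *.
have [->|nb] := eqVneq b' b; first exact: codom_f.
have [Ecs cs] := copyv_neq nb (esym uw); move: ow.
by rewrite /off; case: cs => ->; rewrite ?copyv_src0 ?copyv_tgt0 eqxx ?andbF.
Qed.

Lemma chordless_copy b (C : {set arr Q0}) :
  chordless C -> chordless [set copya b a | a in C].
Proof.
move=> /chordlessP[s ws ->]; apply/chordlessP; exists (map (copya b) s).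
  by rewrite copy_chordless_walk.
apply/setP=> u; rewrite inE; apply/imsetP/mapP => -[a].
  by rewrite inE => as_ ->; exists a.
by move=> as_ ->; exists a; rewrite ?inE.
Qed.

(** A chordless cycle through both ends of a0 contains a0, being a full subquiver.  What
    follows a0 on the cycle stays in one copy, as does a chordless cycle through at
    most one end of a0 when it is followed from there. *)
Lemma chordless_onside (s : seq (arr Q)) : chordless_walk s ->
  exists b, forall u, u \in s -> u \in codom (copya b).
Proof.
(* Only the set of arrows matters, so the starting point may be changed. *)
suff H (r : seq (arr Q)) : chordless_walk r -> exists c p b,
    [/\ perm_eq r (c :: p) & forall u, u \in c :: p -> u \in codom (copya b)].
  move=> /H[c [p [b [/perm_mem E onb]]]]; exists b => u; rewrite E; exact: onb.
move=> wr.
have key c p b : chordless_walk (c :: p) -> all (fun c => off (src c)) p ->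
    c \in codom (copya b) -> forall u, u \in c :: p -> u \in codom (copya b).
  case/and4P=> _ /= cyc _ _ op; apply: copy_path => //.
  by move: cyc; rewrite rcons_path => /andP[].
have rotP (x : vert Q) : x \in [seq src u | u <- r] ->
    exists c p, [/\ src c = x, perm_eq r (c :: p) & chordless_walk (c :: p)].
  move=> /mapP[c cr ->]; have [i p Ei] := rot_to cr; exists c, p; split=> //.
    by rewrite -Ei perm_sym perm_rot.
  by rewrite -Ei chordless_walk_rot.
have onsome c : exists b, c \in codom (copya b).
  by have [b [a ->]] := copya_ex c; exists b; apply: codom_f.
have uniq_head (c : arr Q) p : chordless_walk (c :: p) -> forall u, u \in p -> src u != src c.
  case/and4P=> _ _ /andP[cp _] _ u up; apply: contraNneq cp => <-; exact: map_f.
have [ir|ir] := boolP ((inl (src a0) : vert Q) \in [seq src u | u <- r]).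
  have [c [p [sc rc wc]]] := rotP _ ir; have uh := uniq_head _ _ wc.
  have [jp|jp] := boolP ((inl (tgt a0) : vert Q) \in [seq src u | u <- p]); last first.
    have [b cb] := onsome c; exists c, p, b; split=> //; apply: key => //.
    apply/allP => u up; rewrite /off -sc uh //=.
    by apply: contraNneq jp => <-; apply: map_f.
  have cE : c = inl a0.
    have /and4P[_ _ _ /forallP/(_ (inl a0 : arr Q))/implyP full] := wc.
    have : (inl a0 : arr Q) \in c :: p.
      apply: full; rewrite map_cons; apply/andP; split; last by rewrite inE jp orbT.
      by rewrite inE sc eqxx.
    by rewrite inE => /orP[/eqP -> //|/uh]; rewrite sc eqxx.
  case: p => [|c1 p1] // in rc wc uh jp *.
  have sc1 : src c1 = inl (tgt a0).
    by have /and4P[_ /andP[/eqP <- _] _ _] := wc; rewrite cE.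
  have [b c1b] := onsome c1; exists c, (c1 :: p1), b; split=> // u.
  rewrite inE => /orP[/eqP ->|]; first by rewrite cE -(copya0 b) codom_f.
  apply: copy_path => //.
    by have /and4P[_ + _ _] := wc; rewrite /= rcons_path => /and3P[].
  have /and4P[_ _ /and3P[_ c1p1 _] _] := wc.
  apply/allP => v vp; rewrite /off -sc uh ?inE ?vp ?orbT //= -sc1.
  by apply: contraNneq c1p1 => <-; apply: map_f.
have [jr|jr] := boolP ((inl (tgt a0) : vert Q) \in [seq src u | u <- r]).
  have [c [p [sc rc wc]]] := rotP _ jr; have uh := uniq_head _ _ wc.
  have [b cb] := onsome c; exists c, p, b; split=> //; apply: key => //.
  apply/allP => u up; rewrite /off -sc uh ?andbT //.
  apply: contraNneq ir => <-; rewrite (perm_mem (perm_map _ rc)) /=.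
  by rewrite inE map_f ?orbT.
case: r wr ir jr {rotP} => [|c p] wr ir jr; first by case/and4P: wr.
have [b cb] := onsome c; exists c, p, b; split=> //; apply: key => //.
apply/allP => u up; rewrite /off; apply/andP; split.
  by apply: contraNneq ir => <-; rewrite /= inE map_f ?orbT.
by apply: contraNneq jr => <-; rewrite /= inE map_f ?orbT.
Qed.

Lemma chordless_copyP (C : {set arr Q}) : chordless C ->
  exists b (C0 : {set arr Q0}), chordless C0 /\ C = [set copya b a | a in C0].
Proof.
move=> /chordlessP[s ws ->]; have [b onb] := chordless_onside ws.
have [s0 Es] := copya_map onb; exists b, [set a in s0]; split.
  by apply/chordlessP; exists s0; rewrite // -(copy_chordless_walk b) -Es.
apply/setP=> u; rewrite inE Es; apply/mapP/imsetP => -[a].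
  by move=> as_ ->; exists a; rewrite ?inE.
by rewrite inE => as_ ->; exists a.
Qed.

Definition copyc b (C : ccycle Q0) : ccycle Q :=
  exist _ [set copya b a | a in val C] (chordless_copy b (valP C)).

Lemma copyc_ex (C : ccycle Q) : exists b C0, C = copyc b C0.
Proof.
have [b [C0 [cC0 E]]] := chordless_copyP (valP C); exists b, (exist _ C0 cC0).
exact: val_inj.
Qed.

Lemma mem_copyc b C a : (copya b a \in val (copyc b C)) = (a \in val C).
Proof. by rewrite /= mem_imset //; apply: copya_inj. Qed.

(** In the absence of loops a chordless cycle has at least two arrows. *)
Lemma chordless_other (C : ccycle Q0) a : exists2 c, c \in val C & c != a.
Proof.
have /chordlessP[s ws E] := valP C.
case: s => [|c [|d s]] in ws E; first by case/and4P: ws.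
  case/and4P: ws => _ /=; rewrite andbT => /eqP H _ _.
  by have := noloop c; rewrite H eqxx.
have [ca|ca] := eqVneq c a; last by exists c; rewrite ?E ?inE ?eqxx.
exists d; first by rewrite E !inE eqxx orbT.
rewrite -ca; apply: contraTneq (chordless_walk_uniq ws) => ->.
by rewrite /= inE eqxx.
Qed.

Lemma copyc_mem_inv b C (u : arr Q) : u \in val (copyc b C) ->
  exists2 a, a \in val C & u = copya b a.
Proof. by case/imsetP=> a aC ->; exists a. Qed.

Lemma copyc_inj b b' C C' : copyc b C = copyc b' C' -> b = b' /\ C = C'.
Proof.
move=> E; have [c cC ca0] := chordless_other C a0.
have bb : b = b'.
  have : copya b c \in val (copyc b' C') by rewrite -E mem_copyc.
  by case/copyc_mem_inv => d _ /(copya_eq ca0)[].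
split=> //; rewrite -bb in E; apply: val_inj; apply/setP=> a.
by rewrite -(mem_copyc b) E mem_copyc.
Qed.

Lemma cov_fp (u : arr Q) : exists2 C, chordless C & u \in C.
Proof.
have [b [a ->]] := copya_ex u; have [C cC aC] := cov a.
by exists [set copya b c | c in C]; [apply: chordless_copy|apply: imset_f].
Qed.

Lemma ncycles_copy b a : a != a0 -> ncycles (copya b a) = ncycles a.
Proof.
move=> aa0; rewrite !ncyclesE.
rewrite -[RHS](card_imset _ (f := copyc b)); last by move=> C D /copyc_inj[].
apply: eq_card => D; rewrite inE; apply/idP/imsetP => [|[C aC ->]].
  have [b' [C ->]] := copyc_ex D => /copyc_mem_inv[c cC /(copya_eq aa0)[-> ac]].
  by exists C; rewrite ?inE ?ac.
by rewrite mem_copyc; rewrite inE in aC.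
Qed.

(** The cycle of a0 has two copies, and both contain a0, which therefore becomes an
    interior arrow. *)
Lemma boundary_copy b a : boundary (copya b a) = (a != a0) && boundary a.
Proof.
have [->|aa0] /= := eqVneq a a0; last by rewrite /boundary ncycles_copy.
apply/negP => /cards1P[E EE]; have [C cC aC] := cov a0.
pose C' : ccycle Q0 := exist _ C cC.
have H b' : val (copyc b' C') = E.
  apply/set1P; rewrite -EE inE (valP (copyc b' C')) /=.
  by rewrite copya0 -(copya0 b'); apply: imset_f.
by have [] : false = true /\ C' = C' by apply: copyc_inj; apply: val_inj; rewrite !H.
Qed.

End Copies.

Local Open Scope ring_scope.

(** * Laying out the arrows as nested intervals *)

Section Intervals.
Variable R : realFieldType.
Implicit Types (m h u w : R).

Let subDl u a b : u + a - (u + b) = a - b :> R. Proof. by ring. Qed.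
Let subDr u a b : a + u - (b + u) = a - b :> R. Proof. by ring. Qed.

(** Intervals are given by midpoint and half-length.  Besides inclusion, the length is
    required to shrink by a factor of at least two; this margin is what makes the
    estimates for the drawings strict. *)
Definition nested m h m' h' := (`|m - m'| <= h' - h) && (2 * h <= h').
Definition apart m h m' h' := h + h' <= `|m - m'|.

Lemma nested_trans m1 h1 m2 h2 m3 h3 : 0 < h1 ->
  nested m1 h1 m2 h2 -> nested m2 h2 m3 h3 -> nested m1 h1 m3 h3.
Proof.
move=> h10 /andP[d12 l12] /andP[d23 l23]; apply/andP; split; last by lra.
have := ler_distD m2 m1 m3; lra.
Qed.

Lemma nested_apart m1 h1 m2 h2 m3 h3 :
  nested m1 h1 m2 h2 -> apart m2 h2 m3 h3 -> apart m1 h1 m3 h3.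
Proof.
move=> /andP[d12 _]; rewrite /apart => d23.
by have := ler_distD m1 m2 m3; rewrite (distrC m2 m1); lra.
Qed.

Lemma apart_sym m1 h1 m2 h2 : apart m1 h1 m2 h2 = apart m2 h2 m1 h1.
Proof. by rewrite /apart distrC addrC. Qed.

Lemma nested_not_apart m1 h1 m2 h2 : 0 < h1 ->
  nested m1 h1 m2 h2 -> ~~ apart m1 h1 m2 h2.
Proof. by move=> h1_0 /andP[d _]; rewrite /apart -ltNge; lra. Qed.

Lemma nested_asym m1 h1 m2 h2 : 0 < h1 ->
  nested m1 h1 m2 h2 -> ~~ nested m2 h2 m1 h1.
Proof. by move=> h1_0 /andP[_ d]; rewrite negb_and -!ltNge; apply/orP; right; lra. Qed.

(** In the next four lemmas, an interval with ends u and u + n w is divided into n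
    equal parts, for w of either sign.  The halving needs at least two parts. *)
Lemma part_nested u w (n l : nat) : w != 0 -> (l < n)%N -> (1 < n)%N ->
  nested (u + w * (l%:R + 2^-1)) (`|w| / 2) (u + w * (n%:R / 2)) (`|w| * n%:R / 2).
Proof.
move=> w0 ln n1; have W0 : 0 < `|w| by rewrite normr_gt0.
have l1 : l%:R + 1 <= n%:R :> R by rewrite natr1 ler_nat.
have l0 : 0 <= l%:R :> R by [].
have n2 : 2 <= n%:R :> R by rewrite (ler_nat _ 2 n).
apply/andP; split; last by nra.
rewrite subDl -mulrBr normrM -[X in _ <= X](_ : `|w| * ((n%:R - 1) / 2) = _); last by ring.
apply: ler_wpM2l => //; rewrite ler_norml; apply/andP; split; lra.
Qed.

Lemma part_apart u w (k l : nat) : k != l ->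
  apart (u + w * (k%:R + 2^-1)) (`|w| / 2) (u + w * (l%:R + 2^-1)) (`|w| / 2).
Proof.
move=> kl; rewrite /apart subDl -mulrBr normrM.
rewrite [X in X <= _](_ : _ = `|w| * 1); last by field.
apply: ler_wpM2l => //; rewrite subDr.
case: (ltngtP k l) kl => // kl _.
  have : k%:R + 1 <= l%:R :> R by rewrite natr1 ler_nat.
  by rewrite distrC => ?; apply: le_trans (ler_norm _); lra.
have : l%:R + 1 <= k%:R :> R by rewrite natr1 ler_nat.
by move=> ?; apply: le_trans (ler_norm _); lra.
Qed.

Lemma part_empty u w (k l : nat) :
  `|w| / 2 <= `|u + w * k%:R - (u + w * (l%:R + 2^-1))|.
Proof.
rewrite subDl -mulrBr normrM; apply: ler_wpM2l => //.
case: (leqP k l) => kl.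
  have : k%:R <= l%:R :> R by rewrite ler_nat.
  by rewrite distrC => ?; apply: le_trans (ler_norm _); lra.
have : l%:R + 1 <= k%:R :> R by rewrite natr1 ler_nat.
by move=> ?; apply: le_trans (ler_norm _); lra.
Qed.

Lemma part_inside u w (n k : nat) : w != 0 -> (0 < k < n)%N ->
  `|u + w * k%:R - (u + w * (n%:R / 2))| < `|w| * n%:R / 2.
Proof.
move=> w0 /andP[k0 kn]; have W0 : 0 < `|w| by rewrite normr_gt0.
have k1 : 0 < k%:R :> R by rewrite ltr0n.
have k2 : k%:R < n%:R :> R by rewrite ltr_nat.
rewrite subDl -mulrBr normrM -mulrA ltr_pM2l // ltr_norml.
by apply/andP; split; lra.
Qed.

End Intervals.

Section PointsOfIntervals.
Variable R : realFieldType.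

Lemma empty_not_nested (x y m h : R) : x != y -> h <= `|x - m| -> h <= `|y - m| ->
  ~~ nested ((x + y) / 2) (`|x - y| / 2) m h.
Proof.
move=> xy hx hy; apply/negP => /andP[]; rewrite ler_norml => /andP[d1 d2] l.
have : 0 < `|x - y| by rewrite normr_gt0 subr_eq0.
move: hx hy d1 d2 l; case: (ger0P (x - m)) => xm; case: (ger0P (y - m)) => ym;
  case: (ger0P (x - y)) => xy'; lra.
Qed.

Lemma apart_outside (m1 h1 m2 h2 x : R) :
  apart m1 h1 m2 h2 -> `|x - m1| < h1 -> h2 <= `|x - m2|.
Proof.
rewrite /apart => d d1; have := ler_distD x m1 m2.
by rewrite (distrC m1 x); lra.
Qed.

Lemma nested_outside (m1 h1 m2 h2 x : R) :
  nested m1 h1 m2 h2 -> h2 <= `|x - m2| -> h1 <= `|x - m1|.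
Proof. by move=> /andP[d _] d2; have := ler_distD m1 x m2; lra. Qed.

End PointsOfIntervals.

Section Layout.
Variables (R : realFieldType) (Q : quiver) (a0 : arr Q).
Hypothesis noloop : forall a : arr Q, src a != tgt a.
Hypothesis no2cycle : forall a b : arr Q, ~~ ((tgt a == src b) && (tgt b == src a)).
Implicit Types (X : {set ccycle Q}) (S : {set arr Q}) (V : {set vert Q}).
Implicit Types (pos : vert Q -> R) (top : ccycle Q -> arr Q) (dep : arr Q -> nat).
Implicit Types (a b t : arr Q) (C D : ccycle Q).

Definition chord_mid pos a := (pos (src a) + pos (tgt a)) / 2.
Definition chord_half pos a := `|pos (src a) - pos (tgt a)| / 2.
Definition below pos a b := nested (chord_mid pos a) (chord_half pos a) (chord_mid pos b) (chord_half pos b).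
Definition aside pos a b := apart (chord_mid pos a) (chord_half pos a) (chord_mid pos b) (chord_half pos b).

(** The picture of the cycles X, arrows S and vertices V handled so far.  An arrow spans
    the interval between the positions of its ends, [top C] is the arrow through which C
    is reached from a0, and dep counts the cycles between an arrow and a0.  By
    [lo_sib], the arrows of C other than the top are side by side in the interval of
    top C, and any arrow nested in top C is, compared with each of them, equal to it, nested
    in it, or beside it and no longer.  By [lo_leaf], the interval of an arrow on which no cycle has been
    glued yet has no vertex inside, which leaves room for a new cycle. *)
Record laid_out X S V pos top dep : Prop := LaidOut {
  lo_a0 : a0 \in S;
  lo_ends : {in S, forall a, (src a \in V) && (tgt a \in V)};
  lo_sub : {in X, forall C, val C \subset S};
  lo_pos : {in V &, injective pos};
  lo_root : pos (src a0) = 0 /\ pos (tgt a0) = 1;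
  lo_in : {in S, forall a, a != a0 -> below pos a a0};
  lo_lam : {in S &, forall a b, a != b ->
              [|| below pos a b, below pos b a | aside pos a b]};
  lo_top : {in X, forall C, top C \in val C};
  lo_sib : {in X, forall C, {in val C, forall a, a != top C ->
    [/\ a != a0, below pos a (top C), dep a = (dep (top C)).+1
      & {in S, forall b, below pos b (top C) ->
           [|| b == a, below pos b a | aside pos b a && (chord_half pos b <= chord_half pos a)]}]}};
  lo_top_inj : {in X &, injective top};
  lo_one : {in X &, forall C D a, a \in val C -> a \in val D ->
              a != top C -> a != top D -> C = D};
  lo_ex : {in S, forall a, a != a0 ->
              exists C, [/\ C \in X, a \in val C & a != top C]};
  lo_leaf : {in S, forall t, {in X, forall C, top C != t} ->
              {in V, forall x, chord_half pos t <= `|pos x - chord_mid pos t|}} }.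

Lemma laid_out_half X S V pos top dep : laid_out X S V pos top dep ->
  {in S, forall a, 0 < chord_half pos a}.
Proof.
move=> L a aS; rewrite /chord_half divr_gt0 // normr_gt0 subr_eq0.
have /andP[sV tV] := lo_ends L aS.
by apply: contra_neq (noloop a); apply: (lo_pos L).
Qed.

(** The vertices of D are put at the points that divide the interval of t into equal
    parts.  The new arrows are then nested in t, and compare with an old arrow as t does,
    since no old arrow lies inside t. *)
Lemma laid_out_add X S V pos top dep D t : laid_out X S V pos top dep ->
  D \notin X -> t \in S -> t \in val D ->
  {in S, forall a, a \in val D -> a = t} ->
  {in V, forall x, x \in cvert (val D) -> x = src t \/ x = tgt t} ->
  {in X, forall C, top C != t} ->
  exists pos' top' dep',
    laid_out (D |: X) (S :|: val D) (V :|: cvert (val D)) pos' top' dep'.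
Proof.
move=> L DX tS tD DS DV tleaf.
have cD : chordless (val D) := valP D.
have [ix [[ix0 ixn] ixS ixle ixI [sI tV]]] := chordless_index cD tD.
set n := #|val D|.-1 in ixn ixle.
have stD : src t \in cvert (val D) by apply: cvert_src.
have ttD : tgt t \in cvert (val D) by apply: tV.
(* Without loops and 2-cycles D has at least three arrows. *)
have n1 : (1 < n)%N.
  rewrite ltnNge; apply/negP; rewrite leq_eqVlt ltnS leqn0 => /orP[/eqP n1|/eqP n0]; last first.
    by have := noloop t; rewrite (ixI _ _ stD ttD) ?eqxx // ixn n0 ix0.
  have /imsetP[a aD ta] := ttD.
  have nat_ : a != t by apply: contraNneq (noloop t) => E; rewrite ta E.
  have /ixI E : ix (tgt a) = ix (src t) by rewrite ixS // -ta ix0 ixn n1.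
  by have := no2cycle t a; rewrite ta E ?eqxx // tV.
pose u := pos (tgt t); pose w := (pos (src t) - u) / n%:R.
have n0R : n%:R != 0 :> R by rewrite pnatr_eq0 -lt0n ltnW.
have /andP[sV tgV] := lo_ends L tS.
have w0 : w != 0.
  rewrite mulf_neq0 ?invr_eq0 // subr_eq0.
  by apply: contra_neq (noloop t); apply: (lo_pos L).
have wn : pos (src t) = u + w * n%:R by rewrite /w divfK // addrC subrK.
pose pos' x := if x \in V then pos x else u + w * (ix x)%:R.
pose top' C := if C == D then t else top C.
pose dep' a := if a \in S then dep a else (dep t).+1.
have posV x : x \in V -> pos' x = pos x by rewrite /pos' => ->.
have posD x : x \in cvert (val D) -> pos' x = u + w * (ix x)%:R.
  rewrite /pos'; case: ifP => // xV xD.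
  by case: (DV _ xV xD) => ->; rewrite ?ixn ?ix0 // mulr0 addr0.
have midS a : a \in S -> chord_mid pos' a = chord_mid pos a.
  by move=> /(lo_ends L)/andP[x y]; rewrite /chord_mid !posV.
have hwS a : a \in S -> chord_half pos' a = chord_half pos a.
  by move=> /(lo_ends L)/andP[x y]; rewrite /chord_half !posV.
have belowS a b : a \in S -> b \in S -> below pos' a b = below pos a b.
  by move=> aS bS; rewrite /below !midS ?hwS.
have asideS a b : a \in S -> b \in S -> aside pos' a b = aside pos a b.
  by move=> aS bS; rewrite /aside !midS ?hwS.
have midt : chord_mid pos' t = u + w * (n%:R / 2).
  by rewrite midS // /chord_mid wn -/u; field.
have hwt : chord_half pos' t = `|w| * n%:R / 2.
  by rewrite hwS // /chord_half wn -/u (addrC u) addrK normrM normr_nat.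
have midD a : a \in val D -> a != t -> chord_mid pos' a = u + w * ((ix (src a))%:R + 2^-1).
  move=> aD at_; rewrite /chord_mid !posD ?tV ?cvert_src // ixS //.
  by rewrite -natr1; field.
have hwD a : a \in val D -> a != t -> chord_half pos' a = `|w| / 2.
  move=> aD at_; rewrite /chord_half !posD ?tV ?cvert_src // ixS // -natr1.
  by congr (_ / 2); rewrite -normrN; congr (`|_|); ring.
have hw0 := laid_out_half L.
have W0 : 0 < `|w| by rewrite normr_gt0.
have newP a : a \in S :|: val D -> a \in S \/ (a \in val D /\ a != t).
  rewrite inE; have [aS|aS] := boolP (a \in S); first by left.
  by move=> /= aD; right; split=> //; apply: contraNneq aS => ->.
have newS a : a \in val D -> a != t -> a \notin S.
  by move=> aD; apply: contraNN => /DS /(_ aD) ->.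
have ix_lt a : a \in val D -> a != t -> (ix (src a) < n)%N.
  by move=> aD at_; rewrite -ixS // ixle // tV.
have newt a : a \in val D -> a != t -> below pos' a t.
  by move=> aD at_; rewrite /below midt hwt midD ?hwD // part_nested ?ix_lt.
have new_apart a b : a \in val D -> a != t -> b \in val D -> b != t -> a != b ->
    aside pos' a b.
  move=> aD at_ bD bt ab; rewrite /aside !midD ?hwD //; apply: part_apart.
  apply: contra_neq ab => /ixI E; apply: sI => //; apply: E; exact: cvert_src.
have leaf_nsub t' b : t' \in S -> {in X, forall C, top C != t'} -> b \in S ->
    ~~ below pos b t'.
  move=> t'S t'leaf bS; have /andP[sb tb] := lo_ends L bS.
  apply: empty_not_nested; try by apply: (lo_leaf L).
  by apply: contra_neq (noloop b); apply: (lo_pos L).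
have nsubt b : b \in S -> ~~ below pos b t by apply: leaf_nsub.
have new_in x : x \notin V -> x \in cvert (val D) ->
    `|pos' x - chord_mid pos t| < chord_half pos t.
  move=> xV xD; rewrite posD // -midS // -hwS // midt hwt part_inside //.
  have ne y : y \in V -> y \in cvert (val D) -> ix x != ix y.
    by move=> yV yD; apply: contraNneq xV => /ixI ->.
  have := ne _ tgV ttD; have := ne _ sV stD; rewrite ix0 ixn => nn n0.
  by rewrite lt0n n0 ltn_neqAle nn ixle.
have V'P x : x \in V :|: cvert (val D) -> x \in V \/ (x \notin V /\ x \in cvert (val D)).
  by rewrite inE; case: (boolP (x \in V)) => /= [|xV xD]; [left|right].
have XneD C : C \in X -> C != D by move=> CX; apply: contraNneq DX => <-.
have topX C : C \in X -> top' C = top C by move=> /XneD; rewrite /top' => /negbTE ->.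
have topD : top' D = t by rewrite /top' eqxx.
have XS C a : C \in X -> a \in val C -> a \in S by move=> /(lo_sub L)/subsetP; apply.
have topS C : C \in X -> top C \in S by move=> CX; apply: (XS _ _ CX); apply: (lo_top L).
have X'P C : C \in D |: X -> C = D \/ C \in X by rewrite !inE => /orP[/eqP|]; auto.
have posne x y : x \in V -> y \notin V -> y \in cvert (val D) -> pos' x != pos' y.
  move=> xV yV yD; apply/eqP => E; have := new_in _ yV yD.
  by rewrite -E posV // ltNge (lo_leaf L).
have half'0 a : a \in S :|: val D -> 0 < chord_half pos' a.
  by case/newP=> [aS|[aD at_]]; [rewrite hwS ?hw0|rewrite hwD ?divr_gt0].
have new_old a b : a \in val D -> a != t -> b \in S ->
    [|| below pos' a b | aside pos' a b].
  move=> aD at_ bS; have at' := newt _ aD at_.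
  have a'0 : 0 < chord_half pos' a by rewrite hwD ?divr_gt0.
  have [->|bt] := eqVneq b t; first by rewrite at'.
  have := lo_lam L tS bS; rewrite eq_sym bt => /(_ isT).
  rewrite (negbTE (nsubt _ bS)) orFb -belowS // -asideS //.
  case/orP=> tb; apply/orP; first by left; exact: (nested_trans a'0 at' tb).
  by right; exact: (nested_apart at' tb).
exists pos', top', dep'; split.
- by rewrite inE (lo_a0 L).
- move=> a; rewrite !inE => /orP[/(lo_ends L)/andP[-> ->]//|aD].
  by rewrite tV ?cvert_src ?orbT.
- move=> C /X'P[->|/(lo_sub L) CS]; first exact: subsetUr.
  by apply: subset_trans CS (subsetUl _ _).
- move=> x y /V'P[xV|[xV xD]] /V'P[yV|[yV yD]] E.
  + by apply: (lo_pos L) => //; rewrite -!posV.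
  + by have := posne _ _ xV yV yD; rewrite E eqxx.
  + by have := posne _ _ yV xV xD; rewrite E eqxx.
  + apply: ixI => //; move: E; rewrite !posD // => /addrI/(mulfI w0)/eqP.
    by rewrite eqr_nat => /eqP.
- by have /andP[x y] := lo_ends L (lo_a0 L); rewrite !posV //; apply: lo_root L.
- move=> a /newP[aS|[aD at_]] aa0; first by rewrite belowS ?(lo_a0 L) // (lo_in L).
  have a'0 : 0 < chord_half pos' a by rewrite hwD ?divr_gt0.
  have [<-|ta0] := eqVneq t a0; first exact: newt.
  apply: nested_trans a'0 (newt _ aD at_) _.
  by rewrite -/(below pos' t a0) belowS ?(lo_a0 L) // (lo_in L).
- move=> a b /newP[aS|[aD at_]] /newP[bS|[bD bt]] ab.
  + by rewrite !belowS // asideS // (lo_lam L).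
  + rewrite /aside apart_sym; have := new_old _ _ bD bt aS.
    by rewrite /aside orbA => /orP[]->; rewrite ?orbT.
  + by have := new_old _ _ aD at_ bS => /orP[]->; rewrite ?orbT.
  + by rewrite new_apart ?orbT.
- by move=> C /X'P[->|CX]; rewrite ?topD // topX // (lo_top L).
- move=> C /X'P[->|CX] a aC.
    rewrite topD => at_; have aS := newS _ aC at_.
    rewrite /dep' tS (negbTE aS); split=> //.
    + by apply: contraNneq aS => ->; apply: lo_a0 L.
    + exact: newt.
    + move=> b /newP[bS|[bD bt]].
        by rewrite belowS // (negbTE (nsubt _ bS)).
      move=> _; have [//|ba] := eqVneq b a.
      by rewrite new_apart //= !hwD // lexx orbT.
  rewrite topX // => aT; have aS := XS _ _ CX aC.
  have [aa0 aT' da sib] := lo_sib L CX aC aT.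
  rewrite belowS ?topS // /dep' aS topS //; split=> // b /newP[bS|[bD bt]].
    by rewrite belowS ?topS // => /(sib _ bS); rewrite belowS // asideS // !hwS.
  have b't := newt _ bD bt; have b'0 : 0 < chord_half pos' b by rewrite hwD ?divr_gt0.
  move=> bT; apply/orP; right; have tT : t != top C by rewrite eq_sym tleaf.
  have := lo_lam L tS (topS _ CX) tT; rewrite (negbTE (nsubt _ (topS _ CX))) /=.
  case/orP=> [/(sib _ tS)/or3P[/eqP <-|ta|/andP[ta hta]]|tTa].
  + by rewrite b't.
  + by rewrite /below (nested_trans b'0 b't) // -/(below pos' t a) belowS.
  + apply/orP; right; rewrite /aside (nested_apart b't) -/(aside pos' t a) ?asideS //.
    case/andP: b't => _; rewrite (hwS t) // (hwS a) //; lra.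
  + have := nested_not_apart b'0 bT; rewrite (nested_apart b't) //.
    by rewrite -/(aside pos' t (top C)) asideS // topS.
- move=> C C' /X'P[->|CX] /X'P[->|C'X] //; rewrite ?topD ?topX //.
  + by move=> E; have := tleaf _ C'X; rewrite -E eqxx.
  + by move=> E; have := tleaf _ CX; rewrite E eqxx.
  + exact: (lo_top_inj L).
- move=> C C' /X'P[->|CX] /X'P[->|C'X] a //; rewrite ?topD ?topX //.
  + by move=> aD /(XS _ _ C'X) aS; rewrite (DS _ aS aD) eqxx.
  + by move=> /(XS _ _ CX) aS aD _; rewrite (DS _ aS aD) eqxx.
  + exact: (lo_one L).
- move=> a /newP[aS|[aD at_]] aa0.
    have [C [CX aC aT]] := lo_ex L aS aa0; exists C.
    by rewrite topX // !inE CX orbT.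
  by exists D; rewrite topD !inE eqxx.
- move=> t' /newP[t'S|[t'D t't]] t'leaf x.
    have t'leaf' : {in X, forall C, top C != t'}.
      by move=> C CX; rewrite -topX // t'leaf // !inE CX orbT.
    case/V'P=> [xV|[xV xD]]; first by rewrite posV // midS // hwS // (lo_leaf L).
    have tt' : t != t' by rewrite -topD t'leaf // !inE eqxx.
    have := lo_lam L tS t'S tt'.
    rewrite (negbTE (nsubt _ t'S)) (negbTE (leaf_nsub _ _ t'S t'leaf' tS)) /= => tt'a.
    by rewrite hwS // midS //; apply: apart_outside tt'a (new_in _ xV xD).
  case/V'P=> [xV|[_ xD]].
    apply: nested_outside (newt _ t'D t't) _.
    by rewrite posV // midS // hwS // (lo_leaf L).
  by rewrite posD // midD // hwD // part_empty.
Qed.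
End Layout.

(** Along the growth of the quiver, starting from the single arrow a0, the arrow t at which
    a cycle is glued on is never already the top of an earlier cycle: only one earlier
    cycle contains t, and it has t as an arrow other than its top, unless t = a0, which is
    a boundary arrow and lies in no second cycle. *)
Lemma dimer_layout (R : realFieldType) (Q : quiver) (a0 : arr Q) :
  dimer_tree_quiver Q -> boundary a0 ->
  exists (pos : vert Q -> R) top dep,
    laid_out a0 [set: ccycle Q] [set: arr Q] [set: vert Q] pos top dep.
Proof.
move=> dimQ ba0; have [_ noloop no2 cov _] := dimQ.
have [C1 a0C1] : exists C : ccycle Q, a0 \in val C.
  by have [C cC aC] := cov a0; exists (exist _ C cC : ccycle Q).
have [s [us als os]] := growth dimQ C1.
pose arrs (X : seq (ccycle Q)) : {set arr Q} := [set a | has (fun C : ccycle Q => a \in val C) X].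
have arrs_rcons X (D : ccycle Q) : arrs (rcons X D) = arrs X :|: val D.
  by apply/setP=> a; rewrite !inE has_rcons orbC.
suff H s1 s2 : s = s1 ++ s2 -> exists pos top dep,
    laid_out (R := R) a0 [set C in C1 :: s1] (arrs (C1 :: s1)) (cvs (C1 :: s1)) pos top dep.
  have [pos [top [dep L]]] := H s [::] (esym (cats0 s)).
  exists pos, top, dep; move: L.
  have -> : [set C in C1 :: s] = [set: ccycle Q].
    by apply/setP=> C; rewrite !inE -in_cons als.
  have -> : cvs (C1 :: s) = [set: vert Q].
    by apply/setP=> x; rewrite in_setT cvs_full.
  have -> // : arrs (C1 :: s) = [set: arr Q].
  apply/setP=> a; rewrite in_setT inE; apply/hasP.
  by have [C cC aC] := cov a; exists (exist _ C cC : ccycle Q).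
elim/last_ind: s1 s2 => [|s1 D IH] s2 Es.
  pose pos0 x : R := if x == tgt a0 then 1 else 0.
  have p0 : pos0 (src a0) = 0 by rewrite /pos0 (negbTE (noloop a0)).
  have p1 : pos0 (tgt a0) = 1 by rewrite /pos0 eqxx.
  have L0 : laid_out a0 set0 [set a0] [set src a0; tgt a0] pos0 (fun=> a0) (fun=> 0%N).
    split=> //; try by move=> C; rewrite inE.
    - by rewrite inE.
    - by move=> a; rewrite inE => /eqP ->; rewrite !inE !eqxx orbT.
    - move=> x y; rewrite !inE => /orP[]/eqP-> /orP[]/eqP-> //; rewrite p0 p1 => /eqP;
        by rewrite ?oner_eq0 // eq_sym oner_eq0.
    - by move=> a; rewrite inE => ->.
    - by move=> a b; rewrite !inE => /eqP -> /eqP ->; rewrite eqxx.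
    - by move=> a; rewrite inE => ->.
    - move=> t; rewrite inE => /eqP -> _ x; rewrite !inE /chord_half /chord_mid p0 p1.
      by move=> /orP[]/eqP->; rewrite ?p0 ?p1; do 2 case: ger0P => ?; lra.
  have := laid_out_add noloop no2 L0 (D := C1) (t := a0).
  case; rewrite ?inE //.
  - by move=> a; rewrite inE => /eqP.
  - by move=> x; rewrite !inE => /orP[]/eqP; auto.
  - by move=> C; rewrite inE.
  move=> pos [top [dep L]]; exists pos, top, dep; move: L.
  have -> : C1 |: set0 = [set C in [:: C1]] by apply/setP=> C; rewrite !inE orbF.
  have -> : [set a0] :|: val C1 = arrs [:: C1].
    by apply/setP=> a; rewrite !inE /= orbF; case: eqVneq => // ->.
  have -> // : [set src a0; tgt a0] :|: cvert (val C1) = cvs [:: C1].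
  apply/setP=> x; rewrite !inE /= orbF; case: eqVneq => [->|_] /=; first exact/esym/cvert_src.
  by case: eqVneq => [->|_] //=; apply/esym/(cvert_tgt (valP C1)).
rewrite cat_rcons in Es; have [pos [top [dep L]]] := IH _ Es.
have [t [C [Cs tC tD uni univ]]] := os _ _ _ Es.
have DX : D \notin C1 :: s1.
  move: us; rewrite Es -cat_cons cat_uniq => /and3P[_ /hasPn H _].
  by apply: H; rewrite mem_head.
have inX C' : (C' \in [set C in C1 :: s1]) = (C' \in C1 :: s1) by rewrite inE.
have [||||||pos' [top' [dep' L']]] := laid_out_add noloop no2 L (D := D) (t := t).
- by rewrite inX.
- by rewrite inE; apply/hasP; exists C.
- by [].
- by move=> a; rewrite inE => /hasP[C' C's aC'] aD; case: (uni C' a).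
- by move=> x; rewrite inE => /hasP[C' C's xC'] xD; apply: (univ C' x).
- move=> C' C'X; apply/eqP => tC'.
  have C's : C' \in C1 :: s1 by rewrite -inX.
  have tC'' := lo_top L C'X; rewrite tC' in tC''.
  have [_ C'C] := uni _ _ C's tC'' tD.
  have [ta0|ta0] := eqVneq t a0.
    have bt : boundary t by rewrite ta0.
    have DC : D = C by apply: (@boundary_uniq _ (exist _ t bt)).
    by rewrite DC Cs in DX.
  have tS : t \in arrs (C1 :: s1) by rewrite inE; apply/hasP; exists C.
  have [C'' [C''X tC''2 tT]] := lo_ex L tS ta0.
  rewrite inX in C''X; have [_ C''C] := uni _ _ C''X tC''2 tD.
  by rewrite C''C -C'C tC' eqxx in tT.
exists pos', top', dep'; move: L'; rewrite -arrs_rcons -cvs_rcons -rcons_cons.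
suff -> : D |: [set C in C1 :: s1] = [set C in rcons (C1 :: s1) D] by [].
by apply/setP=> C'; rewrite !inE mem_rcons !inE orbCA.
Qed.

Local Open Scope nat_scope.

(** * The dual graph of the fibered product *)

Section Steps.
Variable G : mgraph.
(** A walk is here the list of its steps ((x, e), y); unlike the pairs (x, e) of
    [simple_cycle], steps can be reversed one by one. *)
Definition traversal (t : mvert G * medge G * mvert G) := mends t.1.2 == [set t.1.1; t.2].
Definition chained (t t' : mvert G * medge G * mvert G) := t.2 == t'.1.1.
Definition backward (t : mvert G * medge G * mvert G) := (t.2, t.1.2, t.1.1).

Lemma walk_steps (z : mvert G * medge G) p w f :
  path (fun z z' => mends z.2 == [set z.1; z'.1]) z (rcons p (w, f)) ->
  exists t T, [/\ [seq t.1 | t <- t :: T] = z :: p,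
    [seq t.2 | t <- t :: T] = rcons [seq z.1 | z <- p] w,
    all traversal (t :: T) & path chained t T].
Proof.
elim: p z => [|z' p IHp] z.
  by rewrite /= andbT => E; exists (z, w), [::]; rewrite /= /traversal /= E; case: z {E}.
rewrite rcons_cons => /andP[E /IHp[t [T [T1 T2 aT pT]]]].
exists (z, z'.1), (t :: T); split; first by rewrite map_cons T1.
- by rewrite map_cons T2.
- by apply/andP; split.
- by apply/andP; split=> //; case: T1 => <- _; apply: eqxx.
Qed.

Lemma steps_cycle T : all traversal T -> path.cycle chained T ->
  path.cycle (fun z z' => mends z.2 == [set z.1; z'.1]) [seq t.1 | t <- T].
Proof.
move=> aT cT; rewrite cycle_map; apply: sub_in_cycle cT; last exact: aT.
by move=> t t' tok _ /eqP tt'; rewrite /= -tt'.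
Qed.

Lemma backward_sorted T : sorted chained (rev (map backward T)) = sorted chained T.
Proof.
rewrite rev_sorted sorted_map; apply: eq_sorted => t t'.
by rewrite /= /chained eq_sym.
Qed.

Lemma backward_traversal T : all traversal (rev (map backward T)) = all traversal T.
Proof.
by rewrite all_rev all_map; apply: eq_all => t; rewrite /= /traversal /= setUC.
Qed.

Lemma cycle_cat_sorted (t u : mvert G * medge G * mvert G) T U :
  sorted chained (t :: T) -> sorted chained (u :: U) ->
  chained (last t T) u -> chained (last u U) t ->
  path.cycle chained ((t :: T) ++ (u :: U)).
Proof.
by rewrite /= rcons_path cat_path last_cat /= => -> -> -> ->.
Qed.

End Steps.

Lemma dimer_noloop (Q : quiver) : dimer_tree_quiver Q -> forall a : arr Q, src a != tgt a.
Proof. by case. Qed.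

Lemma dimer_no2cycle (Q : quiver) : dimer_tree_quiver Q ->
  forall a b : arr Q, ~~ ((tgt a == src b) && (tgt b == src a)).
Proof. by case. Qed.

Lemma dimer_cov (Q : quiver) : dimer_tree_quiver Q ->
  forall a : arr Q, exists2 C, chordless C & a \in C.
Proof. by case. Qed.

Section RootedDual.
Variables (R : realFieldType) (Q0 : quiver) (a0 : arr Q0).
Hypotheses (dim0 : dimer_tree_quiver Q0) (ba0 : boundary a0).
Variables (pos : vert Q0 -> R) (top : ccycle Q0 -> arr Q0) (dep : arr Q0 -> nat).
Hypothesis L : laid_out a0 [set: ccycle Q0] [set: arr Q0] [set: vert Q0] pos top dep.
Notation Q := (fp_quiver a0).
Implicit Types (C D : ccycle Q0) (a : arr Q0) (b : bool).

Local Notation noloop := (dimer_noloop dim0).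
Local Notation no2 := (dimer_no2cycle dim0).
Local Notation cov := (dimer_cov dim0).
Local Notation cpc := (copyc a0 noloop no2 cov).

Lemma topP C : top C \in val C.
Proof. by apply: (lo_top L); rewrite inE. Qed.

Lemma top_inj : injective top.
Proof. by move=> C D; apply: (lo_top_inj L); rewrite inE. Qed.

Lemma nontop_uniq C D a : a \in val C -> a \in val D -> a != top C -> a != top D -> C = D.
Proof. by apply: (lo_one L); rewrite inE. Qed.

Lemma nontop_ex a : a != a0 -> exists C, a \in val C /\ a != top C.
Proof. by move=> aa0; have [|C [_ ? ?]] := lo_ex L _ aa0; [rewrite inE|exists C]. Qed.

Lemma nontop_neq0 C a : a \in val C -> a != top C -> a != a0.
Proof. by move=> aC aT; have [] := lo_sib L (in_setT C) aC aT. Qed.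

Lemma nontop_dep C a : a \in val C -> a != top C -> dep a = (dep (top C)).+1.
Proof. by move=> aC aT; have [] := lo_sib L (in_setT C) aC aT. Qed.

Lemma top_root C : a0 \in val C -> top C = a0.
Proof.
by move=> a0C; apply/eqP; rewrite eq_sym; apply: contraT => /(nontop_neq0 a0C); rewrite eqxx.
Qed.

Lemma root_cycle : exists C, top C = a0.
Proof.
by have [C cC aC] := cov a0; exists (exist _ C cC : ccycle Q0); apply: top_root.
Qed.

(** A top other than a0 also belongs to the cycle on its other side, from which its own cycle
    hangs. *)
Lemma boundary_top C : boundary (top C) -> top C = a0.
Proof.
move=> bC; apply/eqP; apply: contraT => /nontop_ex[D [tD tT]].
have CD : C = D by apply: (@boundary_uniq _ (exist (@boundary Q0) _ bC : barrow Q0)); rewrite /= ?topP.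
by rewrite CD eqxx in tT.
Qed.

Lemma boundary_nontop C a : boundary a -> a != a0 -> a != top C.
Proof. by move=> ba; apply: contraNneq => aT; rewrite aT; apply/eqP/boundary_top; rewrite -aT. Qed.

(** Distinct cycles have distinct tops, and an arrow belongs to at most one cycle
    without being its top. *)
Lemma shared_arrow C D a : C != D -> a \in val C -> a \in val D ->
  (a = top C /\ a != top D) \/ (a = top D /\ a != top C).
Proof.
move=> CD aC aD; have [aTC|aTC] := eqVneq a (top C); have [aTD|aTD] := eqVneq a (top D); auto.
  have /top_inj E : top C = top D by rewrite -aTC.
  by rewrite E eqxx in CD.
by have E := nontop_uniq aC aD aTC aTD; rewrite E eqxx in CD.
Qed.

(** The next arrow on the way from a to a0: the top of the cycle that contains a
    without having it as its top.  For a0 there is no such cycle, and the value is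
    a0. *)
Definition par a : arr Q0 :=
  if [pick C : ccycle Q0 | (a \in val C) && (a != top C)] is Some C then top C else a.

Lemma parE C a : a \in val C -> a != top C -> par a = top C.
Proof.
move=> aC aT; rewrite /par; case: pickP => [D /andP[aD aTD]|/(_ C)].
  by rewrite (nontop_uniq aC aD aT aTD).
by rewrite aC aT.
Qed.

Lemma par_dep a : a != a0 -> dep a = (dep (par a)).+1.
Proof. by move=> /nontop_ex[C [aC aT]]; rewrite (parE aC aT) (nontop_dep aC aT). Qed.

(** The parity of the depth.  The node of the boundary arrow a0 is adjacent to the cycle
    with top a0 and so has the other parity. *)
Definition color0 (n : mvert (dual Q0)) : bool :=
  match n with
  | inl C => odd (dep (top C))
  | inr c => if val c == a0 then ~~ odd (dep a0) else odd (dep (val c)) end.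

Lemma color0P (e : medge (dual Q0)) u v : mends e = [set u; v] -> color0 u != color0 v.
Proof.
suff: exists x y, mends e = [set x; y] /\ color0 x != color0 y.
  by case=> x [y [-> H]] /set2_eq[[<- <- //]|[<- <-]]; rewrite eq_sym.
case: (dual_edgeP e) => [C D CD aC aD ->|C c ec aC ->].
  exists (inl C), (inl D); split=> //=.
  case: (shared_arrow CD aC aD) => -[E nE].
    by rewrite -E (nontop_dep aD nE) /=; case: odd.
  by rewrite -E (nontop_dep aC nE) /=; case: odd.
exists (inl C), (inr c); split=> //; rewrite ec in aC; rewrite /color0.
have [E|cn0] := eqVneq (val c) a0.
  by rewrite E in aC; rewrite (top_root aC); case: odd.
have nT : val c != top C by apply: boundary_nontop => //; apply: (valP c).
by rewrite (nontop_dep aC nT) /=; case: odd.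
Qed.

(** The arrow a0, common to both copies, is read in the first one. *)
Definition unfold_arr (u : arr Q) : bool * arr Q0 :=
  match u with inl a => (false, a) | inr a => (true, val a) end.

Lemma unfold_arrK u : copya a0 (unfold_arr u).1 (unfold_arr u).2 = u.
Proof.
case: u => //= a; apply: (can_inj (sigmaaK (a0 := a0))).
by rewrite (sigmaa_copy a0 true).
Qed.

Lemma unfold_copya b a : a != a0 -> unfold_arr (copya a0 b a) = (b, a).
Proof.
move=> aa0; have := unfold_arrK (copya a0 b a); case: (unfold_arr _) => b' a' /= E.
by have [-> ->] := copya_eq aa0 (esym E).
Qed.

Lemma ccycle_unfold_ex (C : ccycle Q) :
  exists p : bool * ccycle Q0, C == cpc p.1 p.2.
Proof. by have [b [C0 ->]] := copyc_ex noloop no2 cov C; exists (b, C0). Qed.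

(** A node is encoded by its copy and by the arrow through which it is reached from a0.
    Boundary arrows other than a0 are not tops, so the code determines the node. *)
Definition code (n : mvert (dual Q)) : bool * arr Q0 :=
  match n with
  | inl C => let p := xchoose (ccycle_unfold_ex C) in (p.1, top p.2)
  | inr c => unfold_arr (val c) end.

Lemma code_copyc b C : code (inl (cpc b C)) = (b, top C).
Proof. by rewrite /=; have /eqP/copyc_inj[<- <-] := xchooseP (ccycle_unfold_ex (cpc b C)). Qed.

Variant fp_node_spec (n : mvert (dual Q)) : Prop :=
| NodeCycle b C of n = inl (cpc b C) & code n = (b, top C)
| NodeBoundary b a (c : barrow Q) of n = inr c & val c = copya a0 b a
    & a != a0 & boundary a & code n = (b, a).

Lemma fp_nodeP n : fp_node_spec n.
Proof.
case: n => [C|c].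
  have [b [C0 ->]] := copyc_ex noloop no2 cov C.
  by apply: NodeCycle (erefl _) _; apply: code_copyc.
have [b [a E]] := copya_ex (val c).
have : boundary (val c) := valP c; rewrite E (boundary_copy a0 noloop no2 cov) => /andP[aa0 ba].
by apply: (NodeBoundary (erefl _) E aa0 ba); rewrite /= E unfold_copya.
Qed.

Lemma code_inj : injective code.
Proof.
move=> n n'; case: (fp_nodeP n) => [b C -> ->|b a c -> cE aa0 ba ->];
  case: (fp_nodeP n') => [b' C' -> ->|b' a' c' -> cE' aa0' ba' ->].
- by case=> -> /top_inj ->.
- by case=> _ E; have := boundary_nontop C ba' aa0'; rewrite E eqxx.
- by case=> _ E; have := boundary_nontop C' ba aa0; rewrite E eqxx.
- by case=> E1 E2; congr inr; apply: val_inj; rewrite cE cE' E1 E2.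
Qed.

(** Every arrow labels exactly one dual edge; these are the codes of its ends away from
    the root and towards it.  The root is the first copy of the cycle at a0, and the
    second copy of this cycle hangs from it by the edge a0. *)
Definition lower (u : arr Q) : bool * arr Q0 :=
  if u == inl a0 then (true, a0) else unfold_arr u.
Definition upper (u : arr Q) : bool * arr Q0 :=
  if u == inl a0 then (false, a0) else ((unfold_arr u).1, par (unfold_arr u).2).

Lemma copya_eq0 b a : (copya a0 b a == inl a0) = (a == a0).
Proof. by rewrite -(copya0 a0 b) (inj_eq (@copya_inj _ _ b)). Qed.

Lemma lower_inj : injective lower.
Proof.
move=> u v; rewrite -(unfold_arrK u) -(unfold_arrK v) /lower !copya_eq0.
case: (unfold_arr u) (unfold_arr v) => b a [b' a'] /=.
case: eqVneq => [->|aa0]; case: eqVneq => [->|aa0']; rewrite ?copya0 ?unfold_copya //.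
- by case=> _ E; rewrite E eqxx in aa0'.
- by case=> _ E; rewrite E eqxx in aa0.
- by case=> -> ->.
Qed.

Lemma dual_edge_ends (e : medge (dual Q)) : exists p : mvert (dual Q) * mvert (dual Q),
  [&& mends e == [set p.1; p.2], code p.1 == lower (dlabel e)
    & code p.2 == upper (dlabel e)].
Proof.
case: (dual_edgeP e) => [C D|C c ec]; last first.
  have [b [C0 ->]] := copyc_ex noloop no2 cov C.
  rewrite ec => /copyc_mem_inv[a aC Ea] ->.
  have : boundary (val c) := valP c; rewrite Ea (boundary_copy a0 noloop no2 cov) => /andP[aa0 ba].
  have aT : a != top C0 by apply: boundary_nontop.
  exists (inr c, inl (cpc b C0)); rewrite setUC eqxx /= -/(code (inl (cpc b C0))) code_copyc.
  by rewrite Ea /lower /upper copya_eq0 (negbTE aa0) unfold_copya // (parE aC aT) !eqxx.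
have [b [C0 ->]] := copyc_ex noloop no2 cov C; have [b' [D0 ->]] := copyc_ex noloop no2 cov D.
move=> CD /copyc_mem_inv[a aC ->]; have [Eb|nb] := eqVneq b b'.
  rewrite -{}Eb in CD * => {b'}; rewrite mem_copyc => aD Ee.
  have CD0 : C0 != D0 by apply: contraNneq CD => ->.
  have gen C1 D1 : mends e = [set inl (cpc b C1); inl (cpc b D1)] -> a \in val D1 ->
    a = top C1 -> a != top D1 -> exists p : mvert (dual Q) * mvert (dual Q),
     [&& mends e == [set p.1; p.2], code p.1 == lower (copya a0 b a)
     & code p.2 == upper (copya a0 b a)].
    move=> Ee' aD1 aTC aTD; have aa0 := nontop_neq0 aD1 aTD.
    exists (inl (cpc b C1), inl (cpc b D1)); rewrite Ee' eqxx !code_copyc.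
    by rewrite /lower /upper copya_eq0 (negbTE aa0) unfold_copya // (parE aD1 aTD) -aTC !eqxx.
  case: (shared_arrow CD0 aC aD) => -[E nE]; first exact: (gen C0 D0).
  by apply: (gen D0 C0) => //; rewrite Ee setUC.
move=> /copyc_mem_inv[a' aD /(copya_neq nb)[Ea Ea']] Ee.
rewrite Ea in aC *; rewrite Ea' in aD; rewrite copya0 /lower /upper eqxx.
case: b b' => [][] // in nb CD Ee *.
  exists (inl (cpc true C0), inl (cpc false D0)); rewrite Ee eqxx !code_copyc.
  by rewrite !top_root // !eqxx.
exists (inl (cpc true D0), inl (cpc false C0)); rewrite Ee setUC eqxx !code_copyc.
by rewrite !top_root // !eqxx.
Qed.

Definition lend (e : medge (dual Q)) := (xchoose (dual_edge_ends e)).1.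
Definition uend (e : medge (dual Q)) := (xchoose (dual_edge_ends e)).2.

Lemma mends_fp (e : medge (dual Q)) : mends e = [set lend e; uend e].
Proof. by have /and3P[/eqP] := xchooseP (dual_edge_ends e). Qed.
Lemma code_lend (e : medge (dual Q)) : code (lend e) = lower (dlabel e).
Proof. by have /and3P[_ /eqP] := xchooseP (dual_edge_ends e). Qed.
Lemma code_uend (e : medge (dual Q)) : code (uend e) = upper (dlabel e).
Proof. by have /and3P[_ _ /eqP] := xchooseP (dual_edge_ends e). Qed.

Lemma dlabel_inj : injective (@dlabel Q).
Proof.
move=> e e' E; apply: val_inj; rewrite [val e]surjective_pairing [val e']surjective_pairing.
have -> : (val e).2 = (val e').2.
  rewrite -[LHS]/(mends e) -[RHS]/(mends e') !mends_fp; congr [set _; _];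
    apply: code_inj; by rewrite ?code_lend ?code_uend E.
by congr pair.
Qed.

(** The second copy is one step deeper than the first. *)
Definition depth (n : mvert (dual Q)) := dep (code n).2 + (code n).1.

Lemma depth_ends (e : medge (dual Q)) : depth (lend e) = (depth (uend e)).+1.
Proof.
rewrite /depth code_lend code_uend -(unfold_arrK (dlabel e)) /lower /upper copya_eq0.
case: eqVneq => [_|aa0] /=; first by rewrite addn1 addn0.
by rewrite unfold_copya //= (par_dep aa0) addSn.
Qed.

Lemma edge_below n : code n <> (false, a0) -> exists e, lend e = n.
Proof.
suff: code n <> (false, a0) -> exists e : medge (dual Q), lower (dlabel e) = code n.
  by move=> H /H[e E]; exists e; apply: code_inj; rewrite code_lend.
case: (fp_nodeP n) => [b C _ ->|b a c _ cE aa0 ba ->] neq; last first.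
  have [C [aC _]] := nontop_ex aa0.
  have cC : val c \in val (cpc b C) by rewrite cE mem_copyc.
  have [e Ee] := dual_edge_cb cC.
  by exists e; rewrite /dlabel Ee /= /lower cE copya_eq0 (negbTE aa0) unfold_copya.
have [T0|T0] := eqVneq (top C) a0.
  have -> : b = true by case: b neq => //; rewrite T0 => -[].
  have a0C : a0 \in val C by rewrite -T0 topP.
  have [|||e Ee] := @dual_edge_cc Q (cpc true C) (cpc false C) (inl a0).
  - by apply/eqP => /copyc_inj[].
  - by rewrite -(copya0 a0 true) mem_copyc.
  - by rewrite -(copya0 a0 false) mem_copyc.
  by exists e; rewrite /dlabel Ee /lower /= eqxx T0.
have [D [tD tT]] := nontop_ex T0.
have [|||e Ee] := @dual_edge_cc Q (cpc b C) (cpc b D) (copya a0 b (top C)).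
- by apply/eqP => /copyc_inj[_ CD]; rewrite CD eqxx in tT.
- by rewrite mem_copyc topP.
- by rewrite mem_copyc.
by exists e; rewrite /dlabel Ee /lower /= copya_eq0 (negbTE T0) unfold_copya.
Qed.

Lemma is_tree_dual_fp : is_tree (dual Q).
Proof.
have [C1 TC1] := root_cycle.
apply: (@rooted_is_tree (dual Q) (inl (cpc false C1)) depth lend uend).
- exact: mends_fp.
- exact: depth_ends.
- move=> e e' /(congr1 code); rewrite !code_lend => /lower_inj; exact: dlabel_inj.
- move=> n nr; apply: edge_below => E; case/eqP: nr.
  by apply: code_inj; rewrite code_copyc TC1.
Qed.

Lemma depth_odd (e : medge (dual Q)) u v : mends e = [set u; v] ->
  odd (depth u) != odd (depth v).
Proof.
by rewrite mends_fp => /set2_eq[[<- <-]|[<- <-]]; rewrite depth_ends /=; case: odd.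
Qed.

Definition copyt b (t : mvert (underlying Q0) * medge (underlying Q0) * mvert (underlying Q0)) :
    mvert (underlying Q) * medge (underlying Q) * mvert (underlying Q) :=
  (copyv a0 b t.1.1, copya a0 b t.1.2, copyv a0 b t.2).

Lemma mends_copy b (e : medge (underlying Q0)) :
  mends (copya a0 b e : medge (underlying Q)) = copyv a0 b @: mends e.
Proof.
transitivity [set src (copya a0 b e); tgt (copya a0 b e)]; first by [].
by rewrite copya_src copya_tgt imsetU1 imset_set1.
Qed.

(** Without a0, the boundary cycle of Q0 is a walk between the ends of a0.  The first copy
    of this walk is closed up by the second copy run backwards. *)
Lemma boundary_cycle_fp :
  exists2 s : seq (mvert (underlying Q) * medge (underlying Q)),
    simple_cycle s & [seq z.2 | z <- s] =i @boundary Q.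
Proof.
case: dim0 => _ _ _ _ [_ [s /and4P[_ us1 us2 cs] Es]].
have : a0 \in [seq z.2 | z <- s] by rewrite Es.
move=> /mapP[[x a] zs /= aE]; rewrite -{}aE in zs => {a}.
have [n p rs] := rot_to zs.
have {}Es : [seq z.2 | z <- (x, a0) :: p] =i @boundary Q0.
  by move=> c; rewrite -rs map_rot mem_rot Es.
have : uniq [seq z.1 | z <- (x, a0) :: p] by rewrite -rs map_rot rot_uniq.
rewrite map_cons cons_uniq => /andP[/= xp {}us1].
have : uniq [seq z.2 | z <- (x, a0) :: p] by rewrite -rs map_rot rot_uniq.
rewrite map_cons cons_uniq => /andP[/= a0p {}us2].
move: cs; rewrite -(rot_cycle n) rs => {zs rs}.
case: p => [|z p] in Es xp us1 a0p us2 *.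
  rewrite /= andbT => /eqP E; have := noloop a0.
  have : src a0 \in [set x; x] by rewrite -E !inE eqxx.
  have : tgt a0 \in [set x; x] by rewrite -E !inE eqxx orbT.
  by rewrite !inE !orbb => /eqP -> /eqP ->; rewrite eqxx.
move=> cs; have /andP[/eqP xz /walk_steps[t [T [T1 T2 aT pT]]]] :
  (mends (a0 : medge (underlying Q0)) == [set x; z.1]) &&
  path (fun z z' : mvert (underlying Q0) * medge (underlying Q0) =>
          mends z.2 == [set z.1; z'.1]) z (rcons p (x, a0)) := cs.
have {}xz : [set src a0; tgt a0] = [set x; z.1] := xz.
have Tx : [seq t.1.1 | t <- t :: T] = [seq z.1 | z <- z :: p] by rewrite -T1 -map_comp.
have Te : [seq t.1.2 | t <- t :: T] = [seq z.2 | z <- z :: p] by rewrite -T1 -map_comp.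
have ends y : y = src a0 \/ y = tgt a0 -> y = x \/ y = z.1.
  move=> H; have : y \in [set x; z.1] by rewrite -xz !inE; case: H => ->; rewrite eqxx ?orbT.
  by rewrite !inE => /orP[]/eqP; auto.
have glue y b b' : y = x \/ y = z.1 -> copyv a0 b y = copyv a0 b' y.
  move=> H; have : y \in [set src a0; tgt a0].
    by rewrite xz !inE; case: H => ->; rewrite eqxx ?orbT.
  by rewrite !inE => /orP[]/eqP ->; rewrite ?copyv_src0 ?copyv_tgt0.
have copyt_ok b : all (@traversal _) (map (copyt b) (t :: T)).
  rewrite all_map; apply: sub_all aT => u /eqP E; apply/eqP.
  by rewrite /copyt mends_copy E imsetU1 imset_set1.
have copyt_sorted b : sorted (@chained _) (map (copyt b) (t :: T)).
  rewrite sorted_map; have := pT : sorted (@chained _) (t :: T); apply: sub_sorted => u v.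
  by rewrite /chained /= => /eqP ->.
pose A := map (copyt false) (t :: T); pose B := rev (map (@backward _) (map (copyt true) (t :: T))).
have z1 : t.1.1 = z.1 by case: Tx.
have lastT : (last t T).2 = x.
  have := congr1 (last x) T2; rewrite last_rcons /= => <-.
  by rewrite (last_map (fun t => t.2)).
have E2 : [seq z.2 | z <- [seq t.1 | t <- A ++ B]] =
    map (copya a0 false) [seq z.2 | z <- z :: p] ++
    rev (map (copya a0 true) [seq z.2 | z <- z :: p]).
  rewrite -map_comp map_cat -Te /B map_rev -!map_comp.
  by congr (_ ++ rev _); apply: eq_map => u.
exists [seq t.1 | t <- A ++ B].
  apply/and4P; split=> //.
  - rewrite -map_comp map_cat cat_uniq.
    have -> : [seq (fst \o fst) i | i <- A] = map (copyv a0 false) [seq z.1 | z <- z :: p].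
      by rewrite -Tx -!map_comp; apply: eq_map => u.
    have -> : [seq (fst \o fst) i | i <- B] = rev (map (copyv a0 true) (rcons [seq z.1 | z <- p] x)).
      by rewrite -T2 /B map_rev -!map_comp; congr rev; apply: eq_map => u.
    have [xz1 xp'] : x != z.1 /\ x \notin [seq z.1 | z <- p].
      by apply/andP; rewrite -negb_or -in_cons.
    have [zp up] : z.1 \notin [seq z.1 | z <- p] /\ uniq [seq z.1 | z <- p].
      by apply/andP; rewrite -cons_uniq.
    have uP : uniq (rcons [seq z.1 | z <- p] x) by rewrite rcons_uniq xp'.
    rewrite rev_uniq !(map_inj_uniq (@copyv_inj _ a0 _)) us1 uP andbT.
    apply/hasPn => v; rewrite mem_rev => /mapP[y yp ->].
    apply/negP => /mapP[y' y'p /esym /copyv_cross[Eyy /ends y'E]].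
    rewrite -Eyy in yp; case: y'E => E; rewrite E in yp y'p.
      by move: y'p; rewrite inE (negbTE xz1) (negbTE xp').
    by move: yp; rewrite mem_rcons inE eq_sym (negbTE xz1) (negbTE zp).
  - rewrite E2 cat_uniq.
    rewrite rev_uniq !(map_inj_uniq (@copya_inj _ a0 _)) us2 andbT.
    apply/hasPn => v; rewrite mem_rev => /mapP[y yp ->].
    apply/negP => /mapP[y' y'p /esym /copya_cross[E _]].
    by move: y'p; rewrite E; apply/negP.
  - apply: steps_cycle.
      by rewrite all_cat copyt_ok backward_traversal copyt_ok.
    have SB : sorted (@chained _) B by rewrite backward_sorted copyt_sorted.
    pose t' := copyt true (last t T); pose U := behead B.
    have EB : B = backward t' :: U.
      rewrite /U /B /t' lastI map_rcons map_rcons rev_rcons /=; congr (backward (copyt _ _) :: _).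
    have lastB : last (backward t') U = backward (copyt true t).
      have := congr1 (last (backward t')) EB; rewrite /= => <-.
      by rewrite /B !map_cons rev_cons last_rcons.
    rewrite /A map_cons EB; apply: cycle_cat_sorted.
    - exact: (copyt_sorted false).
    - by rewrite -EB.
    - by rewrite last_map; apply/eqP/(glue (last t T).2 false true); rewrite lastT; left.
    - by rewrite lastB; apply/eqP/(glue t.1.1 true false); rewrite z1; right.
have memE c : (c \in [seq z.2 | z <- z :: p]) = (c != a0) && boundary c.
  have -> : boundary c = (c \in a0 :: [seq z.2 | z <- z :: p]).
    by rewrite -[LHS]/(c \in @boundary Q0) -Es.
  rewrite [in RHS]in_cons; case: (eqVneq c a0) => [->|] //; exact: (negbTE a0p).
move=> u; have [b [c ->]] := copya_ex u.
rewrite E2 mem_cat mem_rev -[RHS]/(boundary (copya a0 b c)) (boundary_copy a0 noloop no2 cov) -memE.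
apply/orP/idP => [|cE].
  have inj d : copya a0 b c = copya a0 (~~ b) d -> d \notin [seq z.2 | z <- z :: p].
    by move=> /copya_neq [|_ ->] //; case: b.
  case: b inj => inj [] /mapP[d dE]; first by move=> /inj; rewrite dE.
  - by move/copya_inj ->.
  - by move/copya_inj ->.
  - by move=> /inj; rewrite dE.
by case: b; [right|left]; apply: map_f.
Qed.

Lemma dimer_tree_fp : dimer_tree_quiver Q.
Proof.
have [con0 _ _ _ _] := dim0.
split; [ | exact: (noloop_fp noloop) | exact: (no2cycle_fp noloop no2 cov) | exact: (cov_fp noloop no2 cov)
  | by split; [apply: is_tree_dual_fp|apply: boundary_cycle_fp]].
apply/andP; split; first by apply/card_gt0P; exists (inl (src a0)).
have con x : connect (@madj (underlying Q)) x (inl (src a0)).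
  have [b [y ->]] := copyv_ex x; rewrite -(copyv_src0 a0 b).
  have /connectP[p pp ->] : connect (@madj (underlying Q0)) y (src a0).
    by case/andP: con0 => _ /forallP/(_ y)/forallP.
  elim: p y pp => //= z p IHp y /andP[/madjP[e Ee] /IHp]; apply: connect_trans.
  by apply/connect1/madjP; exists (copya a0 b e); rewrite mends_copy Ee imsetU1 imset_set1.
apply/forallP=> x; apply/forallP=> y; apply: connect_trans (con x) _.
by rewrite (sym_connect_sym (@madj_sym _)).
Qed.

(** In a cycle at the largest depth, an interior arrow other than the top would be the
    top of a deeper cycle.  The top itself is interior, even if it is a0. *)
Lemma base_cycle_fp : exists b C, base_cycle (cpc b C).
Proof.
have [C1 _] := root_cycle.
have [C _ Cmax] := @arg_maxnP _ C1 xpredT (fun C => dep (top C)) isT.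
exists false, C; apply/orP; right; apply/cards1P; exists (copya a0 false (top C)).
apply/setP=> u; rewrite !inE; apply/andP/eqP => [[/copyc_mem_inv[a aC ->]]|->].
  have [-> //|aT] := eqVneq a (top C); rewrite /interior_arrow.
  have aa0 := nontop_neq0 aC aT.
  rewrite (ncycles_copy noloop no2 cov) // ncyclesE => /card_gt1P[D [D' []]].
  rewrite !inE => aD aD' DD'; exfalso.
  have gen (E : ccycle Q0) : a \in val E -> E = C.
    move=> aE; have [aTE|aTE] := eqVneq a (top E).
      by have : dep (top E) <= dep (top C) := Cmax E isT; rewrite -aTE (nontop_dep aC aT) ltnn.
    exact: (nontop_uniq aE aC).
  by rewrite (gen _ aD) (gen _ aD') eqxx in DD'.
rewrite mem_copyc topP; split=> //; rewrite /interior_arrow.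
rewrite ltnNge leq_eqVlt negb_or -/(boundary _) (boundary_copy a0 noloop no2 cov) negb_and negbK.
apply/andP; split.
  have [//|T0] /= := eqVneq (top C) a0.
  by apply/negP => /boundary_top E; rewrite E eqxx in T0.
have [D cD aD] := cov_fp noloop no2 cov (copya a0 false (top C)).
rewrite -leqNgt; apply/card_gt0P; exists D; by rewrite inE cD.
Qed.

(** The summand b (+) b', due to the step between the two copies, is the source of the minus
    sign in W0 - sigma W0. *)
Lemma fp_sign b b' C D :
  odd (dcyc (cpc b C) (cpc b' D)) = (b (+) b') (+) odd (dep (top C) + dep (top D)).
Proof.
rewrite (@mdist_color _ (fun n => odd (depth n))).
- by rewrite /depth !code_copyc /= !oddD !oddb; case: b b' (odd _) (odd _) => [][][][].
- by case: is_tree_dual_fp.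
- exact: depth_odd.
Qed.

Lemma base_sign C D : odd (dcyc C D) = odd (dep (top C) + dep (top D)).
Proof.
rewrite (@mdist_color _ color0).
- by rewrite /= oddD.
- by case: dim0 => _ _ _ _ [[]].
- exact: color0P.
Qed.

End RootedDual.

(** * The reflection of the dual graph *)

Section DualSymmetry.
Variables (R : realFieldType) (Q0 : quiver) (a0 : arr Q0).
Hypothesis dim0 : dimer_tree_quiver Q0.
Variables (pos : vert Q0 -> R) (top : ccycle Q0 -> arr Q0) (dep : arr Q0 -> nat).
Hypothesis L : laid_out a0 [set: ccycle Q0] [set: arr Q0] [set: vert Q0] pos top dep.
Notation Q := (fp_quiver a0).
Local Notation noloop := (dimer_noloop dim0).
Local Notation no2 := (dimer_no2cycle dim0).
Local Notation cov := (dimer_cov dim0).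
Local Notation cpc := (copyc a0 noloop no2 cov).
Local Notation code := (@code Q0 a0 dim0 top).
Local Notation lend := (lend dim0 L).
Local Notation uend := (uend dim0 L).

Lemma sigma_copy b (C : {set arr Q0}) :
  @sigmaa _ a0 @: [set copya a0 b a | a in C] = [set copya a0 (~~ b) a | a in C].
Proof. by rewrite -imset_comp; apply: eq_imset => a; rewrite /= sigmaa_copy. Qed.

Lemma chordless_sigma (C : {set arr Q}) : chordless C -> chordless (@sigmaa _ a0 @: C).
Proof.
move=> /(chordless_copyP noloop no2 cov)[b [C0 [cC0 ->]]]; rewrite sigma_copy.
exact: (chordless_copy a0 noloop no2 cov).
Qed.

Lemma boundary_sigma (u : arr Q) : boundary u -> boundary (@sigmaa _ a0 u).
Proof.
have [b [a ->]] := copya_ex u.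
by rewrite sigmaa_copy !(boundary_copy a0 noloop no2 cov).
Qed.

Definition sigman (n : dnode Q) : dnode Q :=
  match n with
  | inl C => inl (exist _ (@sigmaa _ a0 @: val C) (chordless_sigma (valP C)))
  | inr c => inr (exist _ (@sigmaa _ a0 (val c)) (boundary_sigma (valP c))) end.

Lemma sigmanK : involutive sigman.
Proof.
case=> [C|c]; [congr inl|congr inr]; apply: val_inj => /=; last exact: sigmaaK.
rewrite -imset_comp -[RHS]imset_id; apply: eq_imset => a /=; exact: sigmaaK.
Qed.

Lemma sigma_edge (e : medge (dual Q)) :
  is_dedge (@sigmaa _ a0 (dlabel e), sigman @: mends e).
Proof.
case: (dual_edgeP e) => [C D CD aC aD ->|C c ec aC ->]; rewrite imsetU1 imset_set1.
  pose sC : ccycle Q := exist _ (@sigmaa _ a0 @: val C) (chordless_sigma (valP C)).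
  pose sD : ccycle Q := exist _ (@sigmaa _ a0 @: val D) (chordless_sigma (valP D)).
  have [|||e' Ee'] := @dual_edge_cc Q sC sD (@sigmaa _ a0 (dlabel e)).
  - apply: contraNneq CD => E; apply/eqP.
    have : sigman (inl C) = sigman (inl D) by rewrite /sigman; congr inl.
    by move/(inv_inj sigmanK) => -[].
  - exact: imset_f.
  - exact: imset_f.
  by have := valP e'; rewrite Ee'.
pose sC : ccycle Q := exist _ (@sigmaa _ a0 @: val C) (chordless_sigma (valP C)).
pose sc : barrow Q := exist _ (@sigmaa _ a0 (val c)) (boundary_sigma (valP c)).
have sin : val sc \in val sC by apply: (imset_f (@sigmaa _ a0)); rewrite -ec.
have [e' Ee'] := dual_edge_cb sin.
by have := valP e'; rewrite Ee' ec.
Qed.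

Definition sigmae (e : medge (dual Q)) : medge (dual Q) :=
  (exist (@is_dedge Q) _ (sigma_edge e) : dedge Q).

Lemma sigmaeK : involutive sigmae.
Proof.
move=> e; apply: (dlabel_inj dim0 L); rewrite /dlabel /=; exact: sigmaaK.
Qed.

Lemma sigma_ends e : mends (perm (inv_inj sigmaeK) e) = perm (inv_inj sigmanK) @: mends e.
Proof. by rewrite permE; apply: eq_imset => n; rewrite permE. Qed.

Definition dual_reflection : mgraph_aut (dual Q) := @MGraphAut (dual Q)
  (perm (inv_inj sigmanK)) (perm (inv_inj sigmaeK)) sigma_ends.

Lemma dual_reflection_induced : induced_on_dual (fp_sigma a0) dual_reflection.
Proof.
split=> [C|c|e].
- by exists (exist _ (@sigmaa _ a0 @: val C) (chordless_sigma (valP C))); rewrite //= permE.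
- by exists (exist _ (@sigmaa _ a0 (val c)) (boundary_sigma (valP c))); rewrite //= permE.
- by rewrite /= permE.
Qed.

Lemma code_sigma n : code (autv dual_reflection n) = (~~ (code n).1, (code n).2).
Proof.
rewrite /= permE; case: (fp_nodeP dim0 top n) => [b C -> ->|b a c -> cE aa0 ba ->].
  have -> : sigman (inl (cpc b C)) = inl (cpc (~~ b) C).
    by congr inl; apply: val_inj => /=; apply: sigma_copy.
  exact: code_copyc.
rewrite /= -[RHS](unfold_copya (a0 := a0)) //; congr unfold_arr.
by rewrite -sigmaa_copy -cE.
Qed.

Lemma dlabel_sigma e : dlabel (aute dual_reflection e) = @sigmaa _ a0 (dlabel e).
Proof. by rewrite /= permE. Qed.

Variant fp_edge_spec (e : medge (dual Q)) : Prop :=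
| RootEdge of dlabel e = inl a0 & code (lend e) = (true, a0) & code (uend e) = (false, a0)
| SideEdge b a of a != a0 & dlabel e = copya a0 b a & code (lend e) = (b, a)
    & code (uend e) = (b, par top a).

Lemma fp_edgeP e : fp_edge_spec e.
Proof.
have := code_lend dim0 L e; have := code_uend dim0 L e.
have [b [a E]] := copya_ex (dlabel e); rewrite E /lower /upper copya_eq0.
have [aE|aa0] := eqVneq a a0.
  by move=> Eu El; apply: RootEdge => //; rewrite E aE copya0.
by rewrite unfold_copya // => Eu El; apply: SideEdge E El Eu.
Qed.

Lemma root_edge : exists e : medge (dual Q), dlabel e = inl a0.
Proof.
have [C1 TC1] := root_cycle dim0 L.
have nr : code (inl (cpc true C1)) <> (false, a0) by rewrite code_copyc.
have [e Ee] := edge_below L nr.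
exists e; apply: (@lower_inj _ a0); rewrite -(code_lend dim0 L) Ee code_copyc TC1.
by rewrite /lower eqxx.
Qed.

End DualSymmetry.

Local Open Scope ring_scope.

(** * Chords of a parabola and links between them *)

Section ArcHeights.
Variable R : realFieldType.
Implicit Types (m h x g t : R).

(** The vertical gap at x between the parabola y = x (1 - x) and its chord over the interval
    with midpoint m and half-length h. *)
Definition height m h x := h ^+ 2 - (x - m) ^+ 2.

Lemma height_ge0 m h x : 0 <= h -> (0 <= height m h x) = (`|x - m| <= h).
Proof. by move=> h0; rewrite /height subr_ge0 -(ler_sqr (normr_nneg _)) ?real_normK ?num_real. Qed.

Lemma height_le m h x : height m h x <= h ^+ 2.
Proof. by rewrite lerBlDr lerDl sqr_ge0. Qed.

Lemma height_eq0 m h x : height m h x = 0 -> x = m - h \/ x = m + h.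
Proof.
rewrite /height => /eqP; rewrite subr_eq0 eqf_sqr => /orP[]/eqP E; [right|left]; lra.
Qed.

Lemma nested_height m h m' h' x : 0 < h -> nested m h m' h' -> 0 <= height m h x ->
  height m h x <= height m' h' x /\
  (height m h x = height m' h' x -> height m h x = 0).
Proof.
move=> h0 /andP[]; rewrite ler_norml => /andP[d1 d2] l.
rewrite height_ge0 ?(ltW h0) // ler_norml => /andP[x1 x2].
rewrite /height !subr_sqr; split; first by nra.
move=> E; have : (h - (x - m)) * (h + (x - m)) = 0; last by [].
have P1 : 0 <= (h' - (x - m')) - (h - (x - m)) by lra.
have Q1 : 0 <= (h' + (x - m')) - (h + (x - m)) by lra.
have S1 : 0 < ((h' - (x - m')) - (h - (x - m))) + ((h' + (x - m')) - (h + (x - m))) by lra.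
have p0 : 0 <= h - (x - m) by lra.
have q0 : 0 <= h + (x - m) by lra.
move: E P1 Q1 S1 p0 q0.
(* With p <= P and q <= Q the distances from x to the ends of the two intervals, the
     gaps are p q and P Q. *)
move: (h - (x - m)) (h + (x - m)) (h' - (x - m')) (h' + (x - m')) => p q P Q.
move=> E P1 Q1 S1 p0 q0.
have E1 : (P - p) * Q + p * (Q - q) = 0 by rewrite -(subrr (p * q)) {1}E; ring.
have a1 : (P - p) * Q = 0 by nra.
have a2 : p * (Q - q) = 0 by nra.
move/eqP: a2; rewrite mulf_eq0 => /orP[/eqP -> | /eqP Qq]; first by rewrite mul0r.
move/eqP: a1; rewrite mulf_eq0 => /orP[/eqP Pp | /eqP Q0]; first by lra.
by rewrite (_ : q = 0) ?mulr0 //; lra.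
Qed.

Lemma apart_height m h m' h' x : 0 < h -> 0 < h' -> apart m h m' h' ->
  0 <= height m h x -> 0 <= height m' h' x -> height m h x = 0 /\ height m' h' x = 0.
Proof.
move=> h0 h'0; rewrite /apart => d.
rewrite (height_ge0 _ _ (ltW h0)) (height_ge0 _ _ (ltW h'0)) => x1 x2.
have := ler_distD x m m'; rewrite (distrC m x) => dd.
have E1 : `|x - m| = h by lra.
have E2 : `|x - m'| = h' by lra.
have sq y : y ^+ 2 = `|y| ^+ 2 :> R by rewrite real_normK ?num_real.
by rewrite /height (sq (x - m)) (sq (x - m')) E1 E2 !subrr.
Qed.

(** A link is the dual edge between the nodes of two nested arrows: the straight
    segment from (m, h^2 / 2) to (M, H^2 / 2) in the coordinates x and gap. *)
Section Link.
Variables m h M H : R.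
Hypotheses (h0 : 0 < h) (nest : nested m h M H).
Definition link_x t := m + t * (M - m).
Definition link_g t := h ^+ 2 / 2 + t * (H ^+ 2 / 2 - h ^+ 2 / 2).

Let H2 : 2 * h <= H. Proof. by case/andP: nest. Qed.
Let dMm : `|M - m| <= H - h. Proof. by case/andP: nest; rewrite distrC. Qed.

Let gap0 : 0 < H ^+ 2 / 2 - h ^+ 2 / 2.
Proof.
have l := H2; have h0' := h0; have : 0 < (H - h) * (H + h) by apply: mulr_gt0; lra.
lra.
Qed.

Lemma link_g_ge t : 0 <= t -> h ^+ 2 / 2 <= link_g t.
Proof. by move=> t0; rewrite /link_g lerDl mulr_ge0 // ltW. Qed.

Lemma link_g_le t : t <= 1 -> link_g t <= H ^+ 2 / 2.
Proof.
move=> t1; rewrite /link_g -lerBrDl -[leRHS]mul1r.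
by apply: ler_wpM2r => //; apply: ltW.
Qed.

Lemma link_g_inj : injective link_g.
Proof.
by move=> t u; rewrite /link_g => /addrI; apply: mulIf; rewrite gt_eqF.
Qed.

Lemma link_g_eq_h t : link_g t = h ^+ 2 / 2 -> t = 0.
Proof. by move=> E; apply: link_g_inj; rewrite E /link_g mul0r addr0. Qed.

Lemma link_g_eq_H t : link_g t = H ^+ 2 / 2 -> t = 1.
Proof. by move=> E; apply: link_g_inj; rewrite E /link_g; ring. Qed.

(** At t = 1 the link is at half of the gap of the outer chord.  At s = 1 - t before, that
    chord has lost s^2 (M - m)^2 of its gap, where |M - m| <= H - h, and the
    link has lost s (H^2 - h^2) / 2 of its own. *)
Lemma link_below t : 0 <= t <= 1 -> link_g t < height M H (link_x t).
Proof.
move=> /andP[t0 t1]; rewrite /link_g /height /link_x.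
have -> : m + t * (M - m) - M = - ((1 - t) * (M - m)) by ring.
have l := H2; have dM := dMm; have h0' := h0.
have d2 : (M - m) ^+ 2 <= (H - h) ^+ 2.
  by rewrite -(real_normK (num_real (M - m))) ler_sqr ?nnegrE //; lra.
rewrite sqrrN exprMn; set s := 1 - t; have s0 : 0 <= s by rewrite /s; lra.
have s1 : s <= 1 by rewrite /s; lra.
have -> : t = 1 - s by rewrite /s; ring.
have : s ^+ 2 * (M - m) ^+ 2 <= s * (H - h) ^+ 2.
  by apply: ler_pM => //; rewrite ?sqr_ge0 // expr2; nra.
have : s * (H - h) ^+ 2 < H ^+ 2 / 2 + s * (H ^+ 2 / 2 - h ^+ 2 / 2).
  have hh : 0 < h ^+ 2 by apply: exprn_gt0.
  have Hh : h * (2 * h) <= h * H by apply: ler_wpM2l => //; apply: ltW.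
  have HH : 0 <= (H - 2 * h) * H by apply: mulr_ge0; lra.
  have K0 : 0 <= (1 - s) * (H ^+ 2 / 2 - h ^+ 2 / 2) by apply: mulr_ge0; [lra|apply: ltW].
  have K1 : 0 <= s * (2 * (h * H) - 2 * h ^+ 2) by apply: mulr_ge0 => //; lra.
  rewrite -subr_gt0; move: K0 K1 hh; lra.
lra.
Qed.

(** By the time the link is over an interval beside the inner one, it has moved by at least
    h, and then its gap exceeds h^2. *)
Lemma link_avoid m' h' t : 0 <= t <= 1 -> apart m' h' m h -> 0 < h' -> h' <= h ->
  `|link_x t - m'| <= h' -> h' ^+ 2 < link_g t.
Proof.
move=> /andP[t0 t1]; rewrite /apart => d h'0 h'h; rewrite /link_x => xm'.
have l := H2; have dM := dMm; have h0' := h0.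
have tD : h <= t * (H - h).
  have : `|t * (M - m)| <= t * (H - h) by rewrite normrM ger0_norm // ler_wpM2l.
  have := ler_distD (m + t * (M - m)) m' m; rewrite (distrC m' (m + _)).
  have -> : m + t * (M - m) - m = t * (M - m) by ring.
  lra.
rewrite /link_g; have : h * (H + h) <= t * (H - h) * (H + h) by apply: ler_wpM2r => //; lra.
nra.
Qed.

End Link.
End ArcHeights.

(** The crossing is governed by an equation a t^2 + b t = c with a >= 0 and 0 < c < b, which
    has exactly one solution in [0, 1]. *)
Lemma link_crossing (R : rcfType) (m h M H : R) : 0 < h -> nested m h M H ->
  exists t, [/\ 0 < t, t < 1, link_g h H t = height m h (link_x m M t)
    & forall u, 0 <= u <= 1 -> link_g h H u = height m h (link_x m M u) -> u = t].
Proof.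
move=> h0 nest; pose a := (M - m) ^+ 2; pose b := H ^+ 2 / 2 - h ^+ 2 / 2; pose c := h ^+ 2 / 2.
have a0 : 0 <= a by apply: sqr_ge0.
have c0 : 0 < c by rewrite divr_gt0 // exprn_gt0.
have bc : 3 * c <= b.
  have /andP[_ l] := nest; rewrite /b /c.
  have : (2 * h) ^+ 2 <= H ^+ 2 by rewrite ler_sqr ?nnegrE //; lra.
  by rewrite exprMn; lra.
have eqE u : (link_g h H u = height m h (link_x m M u)) <-> a * u ^+ 2 + b * u = c.
  have E : link_g h H u - height m h (link_x m M u) = a * u ^+ 2 + b * u - c.
    by rewrite /link_g /height /link_x /a /b /c; field.
  by split=> Hu; apply/eqP; rewrite -subr_eq0; [rewrite -E Hu subrr eqxx|rewrite E Hu subrr eqxx].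
pose S := Num.sqrt (b ^+ 2 + 4 * a * c).
have S2 : S ^+ 2 = b ^+ 2 + 4 * a * c.
  rewrite /S sqr_sqrtr //; apply: addr_ge0; first exact: sqr_ge0.
  by apply: mulr_ge0; [apply: mulr_ge0|apply: ltW].
have S0 : 0 <= S by apply: sqrtr_ge0.
have D0 : 0 < b + S by lra.
(* The positive root, in a form that covers the case a = 0. *)
pose t := 2 * c / (b + S).
have t0 : 0 < t by rewrite divr_gt0 // mulr_gt0.
have tE : a * t ^+ 2 + b * t = c.
  have -> : a = (S ^+ 2 - b ^+ 2) / (4 * c) by rewrite S2; field; lra.
  by rewrite /t; field; apply/andP; split; lra.
have uniq u : 0 <= u -> a * u ^+ 2 + b * u = c -> u = t.
  move=> u0 uE; apply/eqP; rewrite -subr_eq0.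
  have : (u - t) * (a * (u + t) + b) = 0.
    by rewrite -(subrr c) -{1}uE -tE; ring.
  move/eqP; rewrite mulf_eq0 => /orP[//|/eqP E].
  have : 0 <= a * (u + t) by rewrite mulr_ge0 // addr_ge0 // ltW.
  by lra.
exists t; split=> //.
- rewrite ltNge; apply/negP => t1.
  have : 0 <= a * t ^+ 2 by rewrite mulr_ge0 // sqr_ge0.
  have : b * 1 <= b * t by apply: ler_wpM2l => //; lra.
  by lra.
- exact/eqE.
- by move=> u /andP[u0 _] /eqE; apply: uniq.
Qed.

Section LayoutGeometry.
Variables (R : realFieldType) (Q0 : quiver) (a0 : arr Q0).
Hypothesis dim0 : dimer_tree_quiver Q0.
Variables (pos : vert Q0 -> R) (top : ccycle Q0 -> arr Q0) (dep : arr Q0 -> nat).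
Hypothesis L : laid_out a0 [set: ccycle Q0] [set: arr Q0] [set: vert Q0] pos top dep.
Implicit Types (a b c : arr Q0) (x g t u : R).
Local Notation mid := (chord_mid pos).
Local Notation hw := (chord_half pos).
Local Notation par := (par top).
Local Notation chord a x := (height (mid a) (hw a) x).
Local Notation lx a t := (link_x (mid a) (mid (par a)) t).
Local Notation lg a t := (link_g (hw a) (hw (par a)) t).

Lemma half_gt0 a : 0 < hw a.
Proof. by apply: (laid_out_half (dimer_noloop dim0) L); rewrite inE. Qed.

Lemma pos_inj : injective pos.
Proof. by move=> x y; apply: (lo_pos L); rewrite inE. Qed.

Lemma chords_laminar a b : a != b -> [|| below pos a b, below pos b a | aside pos a b].
Proof. by apply: (lo_lam L); rewrite inE. Qed.

Lemma below_root a : a != a0 -> below pos a a0.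
Proof. by apply: (lo_in L); rewrite inE. Qed.

Lemma below_par a : a != a0 -> below pos a (par a).
Proof.
move=> /(nontop_ex L)[C [aC aT]]; rewrite (parE L aC aT).
by have [] := lo_sib L (in_setT C) aC aT.
Qed.

Lemma below_sib a c : a != a0 -> below pos c (par a) ->
  [|| c == a, below pos c a | aside pos c a && (hw c <= hw a)].
Proof.
move=> /(nontop_ex L)[C [aC aT]]; rewrite (parE L aC aT).
by have [_ _ _ H] := lo_sib L (in_setT C) aC aT; apply: H; rewrite inE.
Qed.

Lemma mid_root : mid a0 = 1 / 2.
Proof. by have [p0 p1] := lo_root L; rewrite /chord_mid p0 p1 add0r. Qed.

Lemma half_root : hw a0 = 1 / 2.
Proof. by have [p0 p1] := lo_root L; rewrite /chord_half p0 p1 sub0r normrN1. Qed.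

Lemma chord_root x : chord a0 x = x * (1 - x).
Proof. by rewrite mid_root half_root /height; field. Qed.

Lemma below_half a b : below pos a b -> 2 * hw a <= hw b.
Proof. by case/andP. Qed.

Lemma half_sqr_below a b : below pos a b -> 4 * hw a ^+ 2 <= hw b ^+ 2.
Proof.
move=> /below_half ab; have a_gt := half_gt0 a.
have : (2 * hw a) ^+ 2 <= hw b ^+ 2 by rewrite ler_sqr ?nnegrE //; lra.
by rewrite exprMn; lra.
Qed.

Lemma half_sqr_gt0 a : 0 < hw a ^+ 2.
Proof. by rewrite exprn_gt0 // half_gt0. Qed.

Lemma below_chord a b x : below pos a b -> 0 <= chord a x ->
  chord a x <= chord b x /\ (chord a x = chord b x -> chord a x = 0).
Proof. by move=> ab; apply: nested_height ab; apply: half_gt0. Qed.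

Lemma chord_ends a x : chord a x = 0 -> x = pos (src a) \/ x = pos (tgt a).
Proof.
move/height_eq0; rewrite /chord_mid /chord_half; case: (ger0P (pos (src a) - pos (tgt a))) => _ [] ->;
  by [left; lra|right; lra].
Qed.

Lemma chords_meet a b x : a != b -> 0 <= chord a x -> chord a x = chord b x ->
  chord a x = 0.
Proof.
move=> ab ax E; have bx : 0 <= chord b x by rewrite -E.
have /or3P[ab'|ba|aab] := chords_laminar ab.
- by have [_] := below_chord ab' ax; apply.
- by have [_] := below_chord ba bx; rewrite E; apply.
- by have [] := apart_height (half_gt0 a) (half_gt0 b) aab ax bx.
Qed.

Lemma chord_above a x : 0 <= chord a x -> chord a x <= x * (1 - x).
Proof.
rewrite -chord_root => ax; have [-> //|aa0] := eqVneq a a0.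
by have [] := below_chord (below_root aa0) ax.
Qed.

Lemma chord_above_eq a x : a != a0 -> 0 <= chord a x -> chord a x = x * (1 - x) ->
  chord a x = 0.
Proof. by rewrite -chord_root => /below_root H ax; have [_] := below_chord H ax. Qed.

Lemma link_gt0 a t : a != a0 -> 0 <= t -> 0 < lg a t.
Proof.
move=> aa0 t0; have := link_g_ge (half_gt0 a) (below_par aa0) t0.
by have := half_sqr_gt0 a; lra.
Qed.

Lemma link_under a t : a != a0 -> 0 <= t <= 1 -> lg a t < chord (par a) (lx a t).
Proof. by move=> aa0; apply: link_below (half_gt0 a) (below_par aa0) t. Qed.

Lemma link_par_in a t : a != a0 -> 0 <= t <= 1 -> `|lx a t - mid (par a)| < hw (par a).
Proof.
move=> aa0 t01; have := link_under aa0 t01; have /andP[t0 _] := t01.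
have := link_gt0 aa0 t0 => g0 gc.
have : 0 < chord (par a) (lx a t) by apply: lt_trans gc.
rewrite /height subr_gt0 => H.
rewrite -(ltr_sqr (x := `|_|)) ?nnegrE ?normr_ge0 ?ltW ?half_gt0 //.
by rewrite real_normK ?num_real.
Qed.

Lemma link_above a t : a != a0 -> 0 <= t <= 1 -> lg a t < lx a t * (1 - lx a t).
Proof.
move=> aa0 t01; apply: lt_le_trans (link_under aa0 t01) _; apply: chord_above.
by apply: le_trans (ltW (link_under aa0 t01)); apply: ltW; apply: link_gt0 => //; case/andP: t01.
Qed.

(** The chord of an arrow c nested in par a has gap at most the square of its
    half-length.  This is less than the gap along the link of a if c lies inside a, and
    otherwise c is beside a and no longer than a, so that [link_avoid] applies. *)
Lemma link_clear a c t : a != a0 -> 0 <= t <= 1 ->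
  `|lx a t - mid c| <= hw c -> lg a t <= hw c ^+ 2 ->
  below pos c (par a) -> c = a.
Proof.
move=> aa0 t01 xc gc /(below_sib aa0)/or3P[/eqP -> //|ca|/andP[ca hca]].
  have /andP[t0 _] := t01; have ge := link_g_ge (half_gt0 a) (below_par aa0) t0.
  by exfalso; have := half_sqr_below ca; have := half_sqr_gt0 c; lra.
have := link_avoid (half_gt0 a) (below_par aa0) t01 ca (half_gt0 c) hca xc.
by rewrite ltNge gc.
Qed.

Lemma link_chord a c t : a != a0 -> c != a -> 0 <= t <= 1 ->
  lg a t <> chord c (lx a t).
Proof.
move=> aa0 ca t01 E; have /andP[t0 _] := t01.
have g0 := link_gt0 aa0 t0; have gu := link_under aa0 t01.
have c0 : 0 <= chord c (lx a t) by rewrite -E ltW.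
have p0 : 0 <= chord (par a) (lx a t) by apply: ltW; apply: lt_trans gu.
have [cp|cp] := eqVneq c (par a); first by rewrite E cp ltxx in gu.
have /or3P[cp'|pc|acp] := chords_laminar cp.
- have xc : `|lx a t - mid c| <= hw c by rewrite -height_ge0 // ltW // half_gt0.
  have gc : lg a t <= hw c ^+ 2 by rewrite E height_le.
  by case/eqP: ca; apply: (link_clear aa0 t01 xc gc cp').
- by have [] := below_chord pc p0; lra.
- by have [_] := apart_height (half_gt0 c) (half_gt0 (par a)) acp c0 p0; lra.
Qed.

Lemma node_link a c t : a != a0 -> 0 <= t <= 1 ->
  lx a t = mid c -> lg a t = hw c ^+ 2 / 2 -> c = a \/ c = par a.
Proof.
move=> aa0 t01 Ex Eg; have [->|cp] := eqVneq c (par a); first by right.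
left; have c2 := half_sqr_gt0 c; have /andP[t0 t1] := t01.
have /or3P[cp'|pc|acp] := chords_laminar cp.
- have xc : `|lx a t - mid c| <= hw c by rewrite Ex subrr normr0 ltW // half_gt0.
  have gc : lg a t <= hw c ^+ 2 by rewrite Eg; lra.
  exact: (link_clear aa0 t01 xc gc cp').
- exfalso; have := link_g_le (half_gt0 a) (below_par aa0) t1; have := half_sqr_below pc.
  by have := half_sqr_gt0 (par a); lra.
- exfalso; have := link_par_in aa0 t01; rewrite Ex; have := half_gt0 c; move: acp.
  by rewrite /aside /apart; lra.
Qed.

Lemma node_chord a c : chord a (mid c) <> hw c ^+ 2 / 2.
Proof.
move=> E; have c2 := half_sqr_gt0 c; have c1 := half_gt0 c.
have a0' : 0 <= chord a (mid c) by rewrite E; lra.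
have cc : chord c (mid c) = hw c ^+ 2 by rewrite /height subrr expr0n /= subr0.
have [ac|ac] := eqVneq a c; first by move: E; rewrite ac cc; lra.
have /or3P[ac'|ca|aac] := chords_laminar ac.
- by have := half_sqr_below ac'; have := height_le (mid a) (hw a) (mid c); lra.
- by have [|+ _] := below_chord (x := mid c) ca; rewrite cc; [apply: ltW|lra].
- have c0 : 0 <= chord c (mid c) by rewrite cc ltW.
  by have [_] := apart_height (half_gt0 a) (half_gt0 c) aac a0' c0; rewrite cc; lra.
Qed.

Lemma node_inj a c : mid a = mid c -> hw a ^+ 2 / 2 = hw c ^+ 2 / 2 -> a = c.
Proof.
move=> Em Eh; have [//|ac] := eqVneq a c; exfalso; have a2 := half_sqr_gt0 a.
have /or3P[/half_sqr_below|/half_sqr_below|] := chords_laminar ac; [lra|lra|].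
by rewrite /aside /apart Em subrr normr0; have := half_gt0 a; have := half_gt0 c; lra.
Qed.

Lemma link_link_nested a b t u : a != a0 -> b != a0 -> 0 <= t <= 1 -> 0 <= u <= 1 ->
  lx a t = lx b u -> lg a t = lg b u -> below pos (par b) (par a) ->
  par b = a /\ t = 0.
Proof.
move=> aa0 ba0 t01 u01 Ex Eg bp.
have /andP[t0 _] := t01; have /andP[_ u1] := u01.
have ba : par b = a.
  have xc : `|lx a t - mid (par b)| <= hw (par b) by rewrite Ex ltW // link_par_in.
  have gc : lg a t <= hw (par b) ^+ 2.
    rewrite Eg; apply: le_trans (link_g_le (half_gt0 b) (below_par ba0) u1) _.
    by have := half_sqr_gt0 (par b); lra.
  exact: (link_clear aa0 t01 xc gc bp).
split=> //; apply: (link_g_eq_h (half_gt0 a) (below_par aa0)); apply/eqP.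
rewrite eq_le (link_g_ge (half_gt0 a) (below_par aa0) t0) andbT Eg -[in leRHS]ba.
exact: (link_g_le (half_gt0 b) (below_par ba0) u1).
Qed.

Lemma link_start a : lx a 0 = mid a /\ lg a 0 = hw a ^+ 2 / 2.
Proof. by rewrite /link_x /link_g !mul0r !addr0. Qed.

Lemma link_end a : lx a 1 = mid (par a) /\ lg a 1 = hw (par a) ^+ 2 / 2.
Proof. by rewrite /link_x /link_g !mul1r !(addrC _ (_ - _)) !subrK. Qed.

(** If the links end at different nodes, the intervals of these nodes are disjoint, which
    keeps the links apart, or nested, and then [link_clear] leaves only the node at which
    one link ends and the other starts.  Links
    with a common end have inner intervals of the same length, so equal gaps are reached
    at equal parameters, and the abscissae then differ before the end. *)
Lemma link_link a b t u : a != b -> a != a0 -> b != a0 ->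
  0 <= t <= 1 -> 0 <= u <= 1 -> lx a t = lx b u -> lg a t = lg b u ->
  exists c, [/\ c = a \/ c = par a, c = b \/ c = par b,
                lx a t = mid c & lg a t = hw c ^+ 2 / 2].
Proof.
move=> ab aa0 ba0 t01 u01 Ex Eg.
have [Ep|np] := eqVneq (par a) (par b); last first.
  have /or3P[pab|pba|apab] := chords_laminar np.
  - have [pa u0] := link_link_nested ba0 aa0 u01 t01 (esym Ex) (esym Eg) pab.
    exists b; rewrite Ex Eg u0; have [-> ->] := link_start b.
    by split; auto.
  - have [pb t0] := link_link_nested aa0 ba0 t01 u01 Ex Eg pba.
    exists a; rewrite t0; have [-> ->] := link_start a.
    by split; auto.
  - exfalso; have := link_par_in aa0 t01; have := link_par_in ba0 u01; rewrite -Ex.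
    have := ler_distD (lx a t) (mid (par a)) (mid (par b)); move: apab.
    by rewrite /aside /apart (distrC (mid (par a)) (lx a t)); lra.
have ha := half_gt0 a; have hb := half_gt0 b.
have bpa : below pos b (par a) by rewrite Ep below_par.
have apb : below pos a (par b) by rewrite -Ep below_par.
have [asd hE] : aside pos a b /\ hw a = hw b.
  have s1 := below_sib aa0 bpa; have s2 := below_sib ba0 apb.
  rewrite eq_sym (negbTE ab) /= in s1; rewrite (negbTE ab) /= in s2.
  case/orP: s1 => [nba|/andP[sba lba]]; case/orP: s2 => [nab|/andP[sab lab]].
  - by have := nested_asym hb nba; rewrite -/(below pos a b) nab.
  - by have /negP[] := nested_not_apart hb nba; rewrite apart_sym.
  - by have /negP[] := nested_not_apart ha nab; rewrite apart_sym.
  - by split=> //; apply/eqP; rewrite eq_le lab lba.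
have tu : t = u.
  apply: (link_g_inj ha (below_par aa0)); rewrite Eg -Ep hE //.
have t1 : t = 1.
  have E : (1 - t) * (mid a - mid b) = 0.
    by move: Ex; rewrite /link_x -tu -Ep => E; lra.
  move/eqP: E; rewrite mulf_eq0 !subr_eq0 => /orP[/eqP ->//|/eqP Em].
  by move: asd; rewrite /aside /apart Em subrr normr0; lra.
exists (par a); rewrite t1; have [-> ->] := link_end a.
by split; auto.
Qed.

Lemma half_sqr_root : hw a0 ^+ 2 = 1 / 4.
Proof. by rewrite half_root; field. Qed.

Lemma half_sqr_small c : c != a0 -> hw c ^+ 2 <= 1 / 16.
Proof. by move/below_root/half_sqr_below; rewrite half_sqr_root; lra. Qed.

(** The root node has gap 1/8, all the others at most 1/32. *)
Lemma link_high a t : a != a0 -> 0 <= t <= 1 -> 1 / 8 <= lg a t -> par a = a0 /\ t = 1.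
Proof.
move=> aa0 t01 g8; have /andP[_ t1] := t01.
have := link_g_le (half_gt0 a) (below_par aa0) t1 => gl.
have [pa|pa] := eqVneq (par a) a0; last by exfalso; have := half_sqr_small pa; lra.
split=> //; apply: (link_g_eq_H (half_gt0 a) (below_par aa0)).
by move: gl g8; rewrite pa half_sqr_root => gl g8; apply/eqP; rewrite eq_le; apply/andP; split; lra.
Qed.

Lemma vertex_incident (v : vert Q0) : exists a, v = src a.
Proof.
have : v \in cvs (enum [set: ccycle Q0]).
  by apply: cvs_full => // C; rewrite mem_enum inE.
by rewrite inE => /hasP[C _ /imsetP[a _ ->]]; exists a.
Qed.

Lemma chord_src a : chord a (pos (src a)) = 0.
Proof.
rewrite /height /chord_mid /chord_half.
by case: (ger0P (pos (src a) - pos (tgt a))) => _; field.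
Qed.

Lemma pos_above (v : vert Q0) : 0 <= pos v * (1 - pos v).
Proof.
by have [a ->] := vertex_incident v; rewrite -(chord_src a) chord_above // chord_src.
Qed.

End LayoutGeometry.

(** * Path algebras and their maps *)

From mathcomp Require Import finmap monalg generic_quotient.

(** The basis element of a path.  It is locked because unification would otherwise
    unfold finitely supported functions when it compares products. *)
HB.lock Definition bpath (k : fieldType) (Q : quiver) (p : qpath Q) : pathalg k Q :=
  << p >>.

Section PathBasis.
Variables (k : fieldType) (Q : quiver).
Implicit Types (a : arr Q) (p q r : qpath Q) (s : seq (arr Q)) (x : pathalg k Q).
Local Notation bpath := (@bpath k Q).

Lemma bpathE p : bpath p = << p >>. Proof. by rewrite unlock. Qed.

Lemma pvtxE v : pvtx k v = bpath (trivial_path v). Proof. exact: esym (bpathE _). Qed.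

Lemma pwordE s : pword k s = \prod_(a <- s) bpath (arrow_path a).
Proof. by apply: eq_bigr => a _; rewrite -[LHS]bpathE. Qed.

Lemma bpathM p q r : pend p = pstart q -> pstart r = pstart p ->
  parrs r = parrs p ++ parrs q -> bpath p * bpath q = bpath r.
Proof.
move=> epq sr ar; rewrite !bpathE [LHS]palg_mulUU.
have [u [-> su au]] := pcat_Some epq.
by congr (<< _ >>); apply: qpath_inj; rewrite ?su ?au.
Qed.

Lemma bpathM0 p q : pend p <> pstart q -> bpath p * bpath q = 0.
Proof. by move=> npq; rewrite !bpathE [LHS]palg_mulUU (pcat_None npq). Qed.

Lemma mul_pword p s r : walk (pend p) s -> pstart r = pstart p ->
  parrs r = parrs p ++ s -> bpath p * pword k s = bpath r.
Proof.
rewrite pwordE; elim: s p => [|a s IHs] p /=.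
  by move=> _ sr ar; rewrite big_nil mulr1; congr bpath; apply: qpath_inj; rewrite // ar cats0.
move=> /andP[/eqP sa ws] sr ar; rewrite big_cons mulrA.
have wp : walk (pstart p) (parrs p ++ [:: a]).
  by rewrite walk_cat (valP p) /= andbT -/(pend p) sa.
pose q : qpath Q := exist _ (pstart p, parrs p ++ [:: a]) wp.
rewrite (bpathM (r := q)) //; apply: IHs => //; last by rewrite ar -catA.
by rewrite (pend_cat (p := p) (q := arrow_path a)).
Qed.

Lemma pvtx_pword p : pvtx k (pstart p) * pword k (parrs p) = bpath p.
Proof. by rewrite pvtxE; apply: mul_pword => //; apply: (valP p). Qed.

Lemma pword_cons p a s : parrs p = a :: s -> pword k (parrs p) = bpath p.
Proof.
move=> E; have wp : walk (pstart p) (a :: s) by rewrite -E; apply: (valP p).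
have /andP[/eqP sa ws] := wp.
rewrite E pwordE big_cons -pwordE; apply: mul_pword => //.
Qed.

Lemma bpath_span x : exists (d : seq (qpath Q)) (c : qpath Q -> k),
  x = \sum_(p <- d) c p *: bpath p.
Proof.
exists (msupp x), (fun p => x@_p); rewrite -[LHS]lext_id lextE.
by apply: eq_bigr => p _; rewrite bpathE.
Qed.

Lemma path_walk a s :
  path (fun c d : arr Q => tgt c == src d) a s = walk (tgt a) s.
Proof. by elim: s a => //= b s IHs a; rewrite IHs eq_sym. Qed.

Lemma cyclic_walk_walk a s : cyclic_walk (a :: s) -> walk (src a) (a :: s).
Proof. by rewrite /cyclic_walk /= rcons_path path_walk eqxx => /andP[]. Qed.

Lemma cyclic_path s : cyclic_walk s ->
  exists p : qpath Q, parrs p = s /\ pword k s = bpath p.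
Proof.
case: s => [|a s] // /cyclic_walk_walk w.
pose p : qpath Q := exist _ (src a, a :: s) w.
by exists p; rewrite -(@pword_cons p a s).
Qed.

Lemma cyclic_walk_rot n s : cyclic_walk (rot n s) = cyclic_walk s.
Proof. by rewrite /cyclic_walk rot_cycle -!size_eq0 size_rot. Qed.

(** Cyclic equivalence to zero: [cyc_equiv x y] unfolds to [cyc_null (x - y)]. *)
Definition cyc_null x := exists2 l : seq (k * seq (arr Q)),
  all (fun t => cyclic_walk t.2) l &
  x = \sum_(t <- l) t.1 *: (pword k t.2 - pword k (rot 1 t.2)).

Lemma cyc_null0 : cyc_null 0.
Proof. by exists [::]; rewrite ?big_nil. Qed.

Lemma cyc_nullD x y : cyc_null x -> cyc_null y -> cyc_null (x + y).
Proof.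
by move=> [l al ->] [m am ->]; exists (l ++ m); rewrite ?all_cat ?al ?big_cat.
Qed.

Lemma cyc_nullZ c x : cyc_null x -> cyc_null (c *: x).
Proof.
move=> [l al ->]; exists [seq (c * t.1, t.2) | t <- l]; first by rewrite all_map.
by rewrite big_map scaler_sumr; apply: eq_bigr => t _; rewrite scalerA.
Qed.

Lemma cyc_nullB x y : cyc_null x -> cyc_null y -> cyc_null (x - y).
Proof. by move=> nx ny; rewrite -scaleN1r; apply: cyc_nullD => //; apply: cyc_nullZ. Qed.

Lemma cyc_null_sum I (r : seq I) (P : pred I) (F : I -> pathalg k Q) :
  (forall i, P i -> cyc_null (F i)) -> cyc_null (\sum_(i <- r | P i) F i).
Proof. by move=> H; elim/big_rec: _ => [|i x Pi]; [exact: cyc_null0|apply/cyc_nullD/H]. Qed.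

Lemma cyc_null_rot n s : cyclic_walk s -> cyc_null (pword k s - pword k (rot n s)).
Proof.
move=> cs; have [ns|sn] := leqP n (size s); last first.
  by rewrite rot_oversize ?subrr ?(ltnW sn) //; apply: cyc_null0.
elim: n ns => [|n IHn] ns; first by rewrite rot0 subrr; apply: cyc_null0.
have -> : pword k s - pword k (rot n.+1 s) =
  (pword k s - pword k (rot n s)) + (pword k (rot n s) - pword k (rot 1 (rot n s))).
  by rewrite addrA subrK -rotS.
apply: cyc_nullD; first exact/IHn/ltnW.
exists [:: (1, rot n s)]; first by rewrite /= cyclic_walk_rot cs.
by rewrite big_seq1 scale1r.
Qed.

Lemma chordless_cyclic s : chordless_walk s -> cyclic_walk s.
Proof. by case/and4P=> s0 cs _ _; rewrite /cyclic_walk s0. Qed.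

Lemma path_unique (D : {pred arr Q}) a s s' : {in D &, injective (@src Q)} ->
  {subset s <= D} -> {subset s' <= D} -> size s = size s' ->
  path (fun c d : arr Q => tgt c == src d) a s ->
  path (fun c d : arr Q => tgt c == src d) a s' -> s = s'.
Proof.
move=> inj; elim: s s' a => [|c s IHs] [|c' s'] a //= sD s'D [ss].
move=> /andP[/eqP ac ps] /andP[/eqP ac' ps'].
have cc : c = c'.
  by apply: inj; [exact/sD/mem_head|exact/s'D/mem_head|rewrite -ac -ac'].
rewrite -cc in ps' *; congr cons; apply: IHs ps ps' => // d ds.
  by apply: sD; rewrite inE ds orbT.
by apply: s'D; rewrite inE ds orbT.
Qed.

Lemma chordless_walk_unique a s s' :
  chordless_walk (a :: s) -> chordless_walk (a :: s') ->
  a :: s =i a :: s' -> s = s'.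
Proof.
move=> ws ws' E; have us := chordless_walk_uniq ws; have us' := chordless_walk_uniq ws'.
have ss : size s = size s'.
  by have /eqP := perm_size (uniq_perm us us' E); rewrite eqSS => /eqP.
apply: (@path_unique [in a :: s] a) => //.
- by apply: uniq_map_inj; case/and4P: ws.
- by move=> c cs; change (c \in a :: s); rewrite inE cs orbT.
- by move=> c cs; change (c \in a :: s); rewrite E inE cs orbT.
- by have /and4P[_ + _ _] := ws; rewrite /= rcons_path => /andP[].
- by have /and4P[_ + _ _] := ws'; rewrite /= rcons_path => /andP[].
Qed.

Lemma chordless_walk_rot_eq s s' : chordless_walk s -> chordless_walk s' ->
  s =i s' -> exists n, s' = rot n s.
Proof.
move=> ws ws' E; case: s' => [|a s'] in ws' E *; first by case/and4P: ws'.
have as_ : a \in s by rewrite E mem_head.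
have [n p rs] := rot_to as_; exists n; rewrite rs; congr cons.
apply: (@chordless_walk_unique a) => //; first by rewrite -rs chordless_walk_rot.
by move=> c; rewrite -rs mem_rot E.
Qed.

Lemma cycle_walkP (C : ccycle Q) :
  chordless_walk (cycle_walk C) /\ val C = [set a in cycle_walk C].
Proof. by have /andP[w /eqP E] := xchooseP (existsP (valP C)). Qed.

(** A chordless cycle has at most one arrow starting at a given vertex, so two walks around
    it differ by a rotation. *)
Lemma cycle_walk_null (C : ccycle Q) s : chordless_walk s -> val C = [set a in s] ->
  cyc_null (pword k s - pword k (cycle_walk C)).
Proof.
move=> ws Es; have [wC EC] := cycle_walkP C.
have [|n ->] := chordless_walk_rot_eq ws wC; last first.
  exact/cyc_null_rot/chordless_cyclic.
by move=> a; move/setP/(_ a): Es; rewrite EC !inE.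
Qed.

End PathBasis.

Section PathMap.
Variables (k : fieldType) (Q Q' : quiver) (f : qhom Q Q').

Lemma walk_map v s : walk v s -> walk (homv f v) (map (homa f) s).
Proof.
by elim: s v => //= a s IHs v /andP[/eqP <- /IHs]; rewrite hom_src eqxx hom_tgt.
Qed.

Definition qmap (p : qpath Q) : qpath Q' :=
  exist _ (homv f (pstart p), map (homa f) (parrs p)) (walk_map (valP p)).

Lemma pend_qmap p : pend (qmap p) = homv f (pend p).
Proof.
rewrite /pend /walk_end -[parrs (qmap p)]/(map (homa f) (parrs p)).
rewrite -[pstart (qmap p)]/(homv f (pstart p)).
have -> : [seq tgt a | a <- map (homa f) (parrs p)] = map (homv f) [seq tgt a | a <- parrs p].
  by rewrite -!map_comp; apply: eq_map => a; exact: hom_tgt.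
by rewrite last_map.
Qed.

Lemma palg_map_bpath p : palg_map f (bpath k p) = bpath k (qmap p).
Proof. by rewrite /palg_map bpathE lextU -[RHS]pvtx_pword. Qed.

Lemma palg_mapE (x : pathalg k Q) :
  palg_map f x = lext (fun p => bpath k (qmap p)) x.
Proof. by apply: lext_ext => p; rewrite -palg_map_bpath /palg_map bpathE lextU. Qed.

Lemma palg_mapD : {morph @palg_map k _ _ f : x y / x + y}.
Proof. by move=> x y; apply: lextD. Qed.
Lemma palg_mapZ c (x : pathalg k Q) : palg_map f (c *: x) = c *: palg_map f x.
Proof. exact: lextZ. Qed.
Lemma palg_mapN (x : pathalg k Q) : palg_map f (- x) = - palg_map f x.
Proof. by rewrite -scaleN1r palg_mapZ scaleN1r. Qed.
Lemma palg_mapB : {morph @palg_map k _ _ f : x y / x - y}.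
Proof. by move=> x y; rewrite palg_mapD palg_mapN. Qed.
Lemma palg_map0 : palg_map f (0 : pathalg k Q) = 0.
Proof. by rewrite -[0](scale0r (0 : pathalg k Q)) palg_mapZ scale0r. Qed.
Lemma palg_map_sum I (r : seq I) (P : pred I) (F : I -> pathalg k Q) :
  palg_map f (\sum_(i <- r | P i) F i) = \sum_(i <- r | P i) palg_map f (F i).
Proof.
exact: (big_morph _ palg_mapD palg_map0).
Qed.

Lemma cyclic_walk_map s : cyclic_walk s -> cyclic_walk (map (homa f) s).
Proof.
rewrite /cyclic_walk => /andP[s0 cs]; apply/andP; split; first by case: (s) s0.
rewrite cycle_map; apply: sub_cycle cs => a b /eqP ab.
by rewrite /= hom_src hom_tgt ab.
Qed.

Lemma palg_map_pword s : cyclic_walk s ->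
  palg_map f (pword k s) = pword k (map (homa f) s).
Proof.
move=> cs; have [p [ps ->]] := cyclic_path k cs.
rewrite palg_map_bpath -ps; case: s => [|a s] // in cs ps.
apply: esym; apply: (@pword_cons k _ (qmap p) (homa f a) (map (homa f) s)).
by rewrite -map_cons -ps.
Qed.

Lemma cyc_null_map (x : pathalg k Q) : cyc_null x -> cyc_null (palg_map f x).
Proof.
move=> [l /allP al ->]; rewrite palg_map_sum.
exists [seq (t.1, map (homa f) t.2) | t <- l].
  by rewrite all_map; apply/allP => t /al; apply: cyclic_walk_map.
rewrite big_map !big_seq; apply: eq_bigr => t /al ct.
have cr : cyclic_walk (rot 1 t.2) by rewrite cyclic_walk_rot.
by rewrite palg_mapZ palg_mapB (palg_map_pword ct) (palg_map_pword cr) map_rot.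
Qed.

Lemma msupp_palg_map (x : pathalg k Q) q : q \in msupp (palg_map f x) ->
  exists2 p, p \in msupp x & q = qmap p.
Proof.
rewrite -mcoeff_neq0 palg_mapE lextE (raddf_sum (mcoeff q)) /= => H.
have /hasP[p px] : has (fun p => q == qmap p) (msupp x).
  apply: contraR H => /hasPn nq; rewrite big_seq big1 // => p /nq qp.
  by rewrite mcoeffZ bpathE mcoeffU eq_sym (negbTE qp) mulr0.
by move/eqP ->; exists p.
Qed.

Lemma is_potential_map (x : pathalg k Q) : is_potential x -> is_potential (palg_map f x).
Proof.
by move=> px q /msupp_palg_map[p /px cp ->]; apply: cyclic_walk_map.
Qed.

(** If the map identified two vertices, paths that do not compose could have images that
    do. *)
Lemma palg_mapM : injective (homv f) -> {morph @palg_map k _ _ f : x y / x * y}.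
Proof.
move=> fI x y.
have H p q : palg_map f (bpath k p * bpath k q) = bpath k (qmap p) * bpath k (qmap q).
  have [epq|npq] := eqVneq (pend p) (pstart q).
    have [r [_ sr ar]] := pcat_Some epq.
    rewrite (bpathM k epq sr ar) palg_map_bpath (@bpathM k _ _ _ (qmap r)) //.
    - by rewrite pend_qmap epq.
    - by rewrite /pstart /= -/(pstart r) sr.
    - by rewrite /parrs /= -/(parrs r) ar map_cat.
  rewrite (bpathM0 k (elimN eqP npq)) palg_map0; apply/esym/bpathM0.
  by rewrite pend_qmap => /fI/eqP; apply/negP.
have [d [c ->]] := bpath_span x; have [d' [c' ->]] := bpath_span y.
have mulE (d1 : seq (qpath Q)) (F1 : _ -> pathalg k Q) (d2 : seq (qpath Q)) F2 :
    (\sum_(p <- d1) F1 p) * (\sum_(q <- d2) F2 q) = \sum_(p <- d1) \sum_(q <- d2) F1 p * F2 q.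
  by rewrite mulr_suml; apply: eq_bigr => p _; rewrite mulr_sumr.
have mulE' (d1 : seq (qpath Q)) (F1 : _ -> pathalg k Q') (d2 : seq (qpath Q)) F2 :
    (\sum_(p <- d1) F1 p) * (\sum_(q <- d2) F2 q) = \sum_(p <- d1) \sum_(q <- d2) F1 p * F2 q.
  by rewrite mulr_suml; apply: eq_bigr => p _; rewrite mulr_sumr.
have scE (c1 c2 : k) (u v : pathalg k Q) : (c1 *: u) * (c2 *: v) = c1 *: (c2 *: (u * v)).
  by rewrite -pathalg_scaleAl -pathalg_scaleAr.
have scE' (c1 c2 : k) (u v : pathalg k Q') : (c1 *: u) * (c2 *: v) = c1 *: (c2 *: (u * v)).
  by rewrite -pathalg_scaleAl -pathalg_scaleAr.
(* Equations are chained by transitivity, since rewriting would unfold the products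
     of path algebras. *)
apply: etrans (congr1 _ (mulE _ _ _ _)) _; apply: etrans (palg_map_sum _ _ _) _.
apply/esym; apply: etrans (congr2 *%R (palg_map_sum _ _ _) (palg_map_sum _ _ _)) _.
apply: etrans (mulE' _ _ _ _) _; apply: eq_bigr => p _.
apply/esym; apply: etrans (palg_map_sum _ _ _) _; apply: eq_bigr => q _.
have mZ a p' : palg_map f (a *: bpath k p') = a *: bpath k (qmap p').
  by rewrite palg_mapZ palg_map_bpath.
apply: etrans (congr1 (@palg_map k _ _ f) (scE _ _ _ _)) _.
apply: etrans (palg_mapZ _ _) _.
apply: etrans (congr1 ( *:%R (c p)) (palg_mapZ _ _)) _.
apply: etrans (congr1 (fun z => c p *: (c' q *: z)) (H p q)) _; apply: esym.
by apply: etrans (congr2 *%R (mZ _ _) (mZ _ _)) _; apply: scE'.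
Qed.

End PathMap.

(** * The potential of the fibered product *)

Lemma subrACA (V : zmodType) (u v w z : V) : u - v - (w - z) = u - w - (v - z).
Proof. by rewrite !opprB addrACA [in LHS](addrC (- v)) [z - v]addrC addrACA [- v + z]addrC -!addrA; congr (_ + _); rewrite addrCA. Qed.

Lemma cyc_null_eq (k : fieldType) (Q : quiver) (x y : pathalg k Q) :
  x = y -> cyc_null y -> cyc_null x.
Proof. by move->. Qed.

Section FiberedPotential.
Variables (k : fieldType) (Q0 : quiver) (a0 : arr Q0).
Notation Q := (fp_quiver a0).
Implicit Types x : pathalg k Q0.

Lemma qmap_sigmaK (p : qpath Q) : qmap (fp_sigma a0) (qmap (fp_sigma a0) p) = p.
Proof.
apply: qpath_inj; first by rewrite /pstart /= sigmavK.
by rewrite /parrs /= -map_comp -[RHS]map_id; apply: eq_map => a; rewrite /= sigmaaK.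
Qed.

Lemma palg_sigmaK (y : pathalg k Q) :
  palg_map (fp_sigma a0) (palg_map (fp_sigma a0) y) = y.
Proof.
rewrite (palg_mapE _ y) lextE palg_map_sum -[RHS]lext_id lextE.
apply: eq_bigr => p _; rewrite palg_mapZ palg_map_bpath qmap_sigmaK.
by rewrite bpathE.
Qed.

Lemma sigma_potential x :
  palg_map (fp_sigma a0) (fp_potential a0 x) = - fp_potential a0 x.
Proof. by rewrite /fp_potential palg_mapB palg_sigmaK opprB. Qed.

Lemma is_potential_fp x : is_potential x -> is_potential (fp_potential a0 x).
Proof.
move=> px p; have p1 := is_potential_map (f := fp_copy1 a0) px.
have p2 := is_potential_map (f := fp_sigma a0) p1.
move/(fsubsetP (msuppB_le _ _)); rewrite in_fsetE => /orP[/p1|/p2] //.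
Qed.

Lemma cyc_null_fp x : cyc_null x -> cyc_null (fp_potential a0 x).
Proof. by move=> nx; apply: cyc_nullB; do ?apply: cyc_null_map. Qed.

Lemma fp_potentialB x y : fp_potential a0 (x - y) = fp_potential a0 x - fp_potential a0 y.
Proof.
by rewrite /fp_potential !palg_mapB; apply: subrACA.
Qed.

Lemma fp_potentialZ c x : fp_potential a0 (c *: x) = c *: fp_potential a0 x.
Proof. by rewrite /fp_potential !palg_mapZ -scalerBr. Qed.

Section Signs.
Variables (R : realFieldType).
Hypothesis dim0 : dimer_tree_quiver Q0.
Variables (pos : vert Q0 -> R) (top : ccycle Q0 -> arr Q0) (dep : arr Q0 -> nat).
Hypothesis L : laid_out a0 [set: ccycle Q0] [set: arr Q0] [set: vert Q0] pos top dep.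

Local Notation noloop := (dimer_noloop dim0).
Local Notation no2 := (dimer_no2cycle dim0).
Local Notation cov := (dimer_cov dim0).
Local Notation cpc := (copyc a0 noloop no2 cov).

(** Both potentials are signed sums over the copies of the cycles of Q0.  Their signs agree
    up to a global one by [fp_sign] and [base_sign], and the walks around a cycle agree up
    to rotation. *)
Lemma dimer_potential_fp C0 b C : exists n : nat,
  cyc_null (fp_potential a0 (dimer_potential k C0) -
            (-1) ^+ n *: dimer_potential k (cpc b C)).
Proof.
pose n := (b + dep (top C) + dep (top C0))%N; exists n.
have bij : bijective (fun p : bool * ccycle Q0 => cpc p.1 p.2).
  exists (fun D => xchoose (ccycle_unfold_ex (Q0 := Q0) (a0 := a0) dim0 D)) => [[b' D]|D].
    have /eqP/copyc_inj[] := xchooseP (ccycle_unfold_ex (a0 := a0) dim0 (cpc b' D)).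
    by case: (xchoose _) => ? ? /= <- <-.
  by have /eqP <- := xchooseP (ccycle_unfold_ex (a0 := a0) dim0 D).
have -> : dimer_potential k (cpc b C) = \sum_(p : bool * ccycle Q0)
    (-1) ^+ dcyc (cpc b C) (cpc p.1 p.2) *: pword k (cycle_walk (cpc p.1 p.2)).
  by rewrite /dimer_potential (reindex _ (onW_bij _ bij)).
rewrite -(pair_bigA _ (fun b' D =>
  (-1) ^+ dcyc (cpc b C) (cpc b' D) *: pword k (cycle_walk (cpc b' D)))) /=.
have sgn b' D : (-1) ^+ n * (-1) ^+ dcyc (cpc b C) (cpc b' D) =
    (-1) ^+ b' * (-1) ^+ dcyc C0 D :> k.
  rewrite -!exprD -signr_odd -[RHS]signr_odd !oddD (fp_sign dim0 L) (base_sign dim0 L).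
  rewrite /n !oddD !oddb.
  by case: (b) (b') (odd _) (odd _) (odd _) => [][][][][].
have walkE b' D : cyc_null (pword k (map (copya a0 b') (cycle_walk D)) -
    pword k (cycle_walk (cpc b' D))).
  have [wD ED] := cycle_walkP D.
  apply: cycle_walk_null; first by rewrite (copy_chordless_walk a0 noloop no2 cov).
  rewrite /= ED; apply/setP=> u; rewrite inE; apply/imsetP/mapP => -[a].
    by rewrite inE => aD ->; exists a.
  by move=> aD ->; exists a; rewrite ?inE.
have cycD D : cyclic_walk (cycle_walk D : seq (arr Q0)).
  by apply: chordless_cyclic; case: (cycle_walkP D).
pose W b' := \sum_(D : ccycle Q0) (-1) ^+ dcyc C0 D *:
  pword k (map (copya a0 b') (cycle_walk D)).
pose V b' := \sum_(D : ccycle Q0) (-1) ^+ dcyc C0 D *: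
  pword k (cycle_walk (cpc b' D)).
have EW0 : palg_map (fp_copy1 a0) (dimer_potential k C0) = W false.
  rewrite /dimer_potential palg_map_sum; apply: eq_bigr => D _.
  by rewrite palg_mapZ (palg_map_pword _ _ (cycD D)).
have EW1 : palg_map (fp_sigma a0) (W false) = W true.
  rewrite /W palg_map_sum; apply: eq_bigr => D _.
  have cD := cyclic_walk_map (fp_copy1 a0) (cycD D).
  rewrite palg_mapZ; congr (_ *: _); apply: etrans (palg_map_pword k (fp_sigma a0) cD) _.
  by congr pword; rewrite -map_comp; apply: eq_map.
have EV b' : (-1) ^+ n *: (\sum_(D : ccycle Q0)
    (-1) ^+ dcyc (cpc b C) (cpc b' D) *: pword k (cycle_walk (cpc b' D))) =
    (-1) ^+ b' *: V b'.
  rewrite /V !scaler_sumr; apply: eq_bigr => D _.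
  by rewrite !scalerA (sgn b' D).
have nul b' : cyc_null (W b' - V b').
  rewrite /W /V -sumrB; apply: cyc_null_sum => D _.
  by rewrite -scalerBr; apply: cyc_nullZ; apply: walkE.
have -> : fp_potential a0 (dimer_potential k C0) = W false - W true.
  by rewrite /fp_potential EW0 EW1.
have Etot (F : bool -> pathalg k Q) : (forall b', (-1) ^+ n *: F b' = (-1) ^+ b' *: V b') ->
    (-1) ^+ n *: (\sum_b' F b') = V false - V true.
  by move=> FE; rewrite big_bool scalerDr !FE expr0 expr1 scale1r scaleN1r addrC.
apply: cyc_null_eq (congr1 (fun z => W false - W true - z) (Etot _ EV)) _.
rewrite subrACA; exact: cyc_nullB.
Qed.

End Signs.
End FiberedPotential.

Lemma sub_sign_trans (k : fieldType) (V : lmodType k) (e n : nat) (u v w : V) :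
  u - (-1) ^+ (e + n) *: w = (u - (-1) ^+ e *: v) + (-1) ^+ e *: (v - (-1) ^+ n *: w).
Proof. by rewrite scalerBr scalerA -exprD addrA subrK. Qed.

Lemma dimer_tree_qp_fp (k : fieldType) (Q0 : quiver) (a0 : arr Q0) (w0 : pathalg k Q0) :
  boundary a0 -> dimer_tree_qp w0 -> dimer_tree_qp (fp_potential a0 w0).
Proof.
move=> ba0 [dim0 pot0 [C0 _ eq0]].
have [pos [top [dep L]]] := dimer_layout rat dim0 ba0.
have [b [C baseC]] := base_cycle_fp dim0 L.
split; [exact: (dimer_tree_fp dim0 ba0 L)|exact: is_potential_fp|].
exists (copyc a0 (dimer_noloop dim0) (dimer_no2cycle dim0) (dimer_cov dim0) b C) => //.
have [n nulln] := dimer_potential_fp k dim0 L C0 b C.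
set dpC := dimer_potential k (copyc _ _ _ _ _ _) in nulln *.
have [e null0] : exists e : bool, cyc_null (w0 - (-1) ^+ e *: dimer_potential k C0).
  case: eq0 => eq0; [exists false|exists true]; first by rewrite expr0 scale1r.
  by rewrite expr1 scaleN1r.
have : cyc_null (fp_potential a0 w0 - (-1) ^+ (e + n) *: dpC).
  have nz : cyc_null (fp_potential a0 w0 - (-1) ^+ e *: fp_potential a0 (dimer_potential k C0)).
    have := cyc_null_fp a0 null0; rewrite fp_potentialB fp_potentialZ; exact.
  apply: (cyc_null_eq _ (cyc_nullD nz (cyc_nullZ ((-1) ^+ e) nulln))).
  exact: sub_sign_trans.
rewrite -signr_odd; case: odd => /=.
  by rewrite expr1 scaleN1r => H; right.
by rewrite expr0 scale1r => H; left.
Qed.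

(** * The action on the Jacobian algebra *)

Section Derivatives.
Variables (k : fieldType) (Q Q' : quiver) (f : qhom Q Q').
Hypothesis fvI : injective (homv f).

Lemma palg_map_pvtx_pword v s :
  palg_map f (pvtx k v * pword k s) = pvtx k (homv f v) * pword k (map (homa f) s).
Proof.
have fa a : palg_map f (bpath k (arrow_path a)) = bpath k (arrow_path (homa f a)).
  rewrite palg_map_bpath; congr bpath; apply: qpath_inj => //.
  by rewrite /pstart /= hom_src.
elim/last_ind: s => [|s a IHs].
  rewrite !pwordE !big_nil !mulr1 !pvtxE palg_map_bpath.
  by congr bpath; apply: qpath_inj.
rewrite map_rcons !pwordE !big_rcons /= -!pwordE.
apply: etrans (congr1 (@palg_map k _ _ f) (mulrA _ _ _)) _.
apply: etrans (palg_mapM fvI _ _) _.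
by apply: etrans (congr2 *%R IHs (fa a)) _; apply: esym (mulrA _ _ _).
Qed.

Lemma cyclic_walk_mapE s : cyclic_walk (map (homa f) s) = cyclic_walk s.
Proof.
rewrite /cyclic_walk; congr (_ && _); first by case: s.
by rewrite cycle_map; apply: eq_cycle => a b; rewrite /= hom_tgt hom_src inj_eq.
Qed.

Lemma cderivZ c a (x : pathalg k Q) : cderiv a (c *: x) = c *: cderiv a x.
Proof. exact: lextZ. Qed.

Lemma cderiv_bpath a p : cderiv a (bpath k p) = let s := parrs p in
    if cyclic_walk s then
      \sum_(0 <= l < size s | nth a s l == a)
        pvtx k (tgt a) * pword k (drop l.+1 s ++ take l s)
    else 0 : pathalg k Q.
Proof. by rewrite bpathE /cderiv lextU. Qed.
End Derivatives.

(** As the map is injective on arrows, the occurrences of a in a cyclic path are those of its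
    image in the image path. *)
Lemma cderiv_map (k : fieldType) (Q Q' : quiver) (f : qhom Q Q') a (x : pathalg k Q) :
  injective (homv f) -> injective (homa f) ->
  palg_map f (cderiv a x) = cderiv (homa f a) (palg_map f x).
Proof.
move=> fvI faI.
have H p : palg_map f (cderiv a (bpath k p)) = cderiv (homa f a) (bpath k (qmap f p)).
  apply: etrans (congr1 (@palg_map k _ _ f) (cderiv_bpath k a p)) _; apply: esym.
  apply: etrans (cderiv_bpath k _ _) _; cbv zeta.
  rewrite -[parrs (qmap f p)]/(map (homa f) (parrs p)) (cyclic_walk_mapE fvI).
  case: ifP => _; last by rewrite palg_map0.
  apply: esym; apply: etrans (palg_map_sum _ _ _ _) _.
  rewrite size_map big_nat_cond [RHS]big_nat_cond; apply: eq_big => l.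
    case: (ltnP l (size (parrs p))) => ls; last by rewrite andbF.
    by rewrite (nth_map a) // (inj_eq faI).
  move=> _; apply: etrans (palg_map_pvtx_pword k fvI _ _) _.
  by rewrite hom_tgt map_cat map_drop map_take.
have [d [c ->]] := bpath_span x.
have sumE (I : seq (qpath Q)) (F : qpath Q -> pathalg k Q) :
    cderiv a (\sum_(p <- I) F p) = \sum_(p <- I) cderiv a (F p).
  exact: lext_sum.
have sumE' (I : seq (qpath Q)) (F : qpath Q -> pathalg k Q') :
    cderiv (homa f a) (\sum_(p <- I) F p) = \sum_(p <- I) cderiv (homa f a) (F p).
  exact: lext_sum.
apply: etrans (congr1 (@palg_map k _ _ f) (sumE _ _)) _.
apply: etrans (palg_map_sum _ _ _ _) _; apply: esym.
apply: etrans (congr1 (cderiv (homa f a)) (palg_map_sum _ _ _ _)) _.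
apply: etrans (sumE' _ _) _; apply: eq_bigr => p _.
apply: etrans (congr1 (cderiv (homa f a)) (palg_mapZ _ _ _)) _.
apply: etrans (cderivZ _ _ _) _; apply: esym.
apply: etrans (congr1 (@palg_map k _ _ f) (cderivZ _ _ _)) _.
apply: etrans (palg_mapZ _ _ _) _.
by apply: (congr1 ( *:%R (c p))); rewrite H -palg_map_bpath.
Qed.

Section JacobianAction.
Variables (k : fieldType) (Q0 : quiver) (a0 : arr Q0) (w0 : pathalg k Q0).
Notation Q := (fp_quiver a0).
Notation w := (fp_potential a0 w0).
Local Notation phi := (@palg_map k _ _ (fp_sigma a0)).

Lemma sigmav_inj : injective (homv (fp_sigma a0)).
Proof. exact: inv_inj (@sigmavK _ a0). Qed.
Lemma sigmaa_inj : injective (homa (fp_sigma a0)).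
Proof. exact: inv_inj (@sigmaaK _ a0). Qed.

Lemma phiM (x y : pathalg k Q) : phi (x * y) = phi x * phi y.
Proof. exact: (palg_mapM sigmav_inj). Qed.

Lemma phi1 : phi 1 = 1.
Proof.
have oneE : (1 : pathalg k Q) = \sum_v bpath k (trivial_path v).
  by apply: eq_bigr => v _; rewrite bpathE.
have bij : bijective (homv (fp_sigma a0)) by exists (homv (fp_sigma a0)); exact: sigmavK.
apply: etrans (congr1 phi oneE) _; apply: etrans (palg_map_sum _ _ _ _) _; apply: esym.
apply: etrans oneE _; rewrite (reindex _ (onW_bij _ bij)); apply: eq_bigr => v _.
apply: esym; apply: etrans (palg_map_bpath _ _ _) _.
by congr bpath; apply: qpath_inj.
Qed.

Lemma cderivN a (x : pathalg k Q) : cderiv a (- x) = - cderiv a x.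
Proof. by rewrite -scaleN1r cderivZ scaleN1r. Qed.

(** The potential is mapped to its opposite, so each of its derivatives is mapped to the
    opposite of a derivative. *)
Lemma jideal_phi x : jacobian_ideal w x -> jacobian_ideal w (phi x).
Proof.
case=> l ->; exists [seq (- phi t.1.1, homa (fp_sigma a0) t.1.2, phi t.2) | t <- l].
rewrite big_map; apply: etrans (palg_map_sum _ _ _ _) _; apply: eq_bigr => t _ /=.
apply: etrans (phiM _ _) _; congr (_ * _); apply: etrans (phiM _ _) _.
have E : phi (cderiv t.1.2 w) = - cderiv (homa (fp_sigma a0) t.1.2) w.
  apply: etrans (cderiv_map _ _ sigmav_inj sigmaa_inj) _.
  by apply: etrans (congr1 (cderiv _) (sigma_potential a0 w0)) _; apply: cderivN.
apply: etrans (congr1 (fun z => phi t.1.1 * z) E) _; exact: etrans (mulrN _ _) (esym (mulNr _ _)).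
Qed.

Definition jsigma (x : Jac w) : Jac w := jpi w (phi (repr x)).

Lemma jsigma_pi x : jsigma (jpi w x) = jpi w (phi x).
Proof.
apply: jpi_eq; rewrite -palg_mapB; apply: jideal_phi; exact: jac_repr_pi.
Qed.

Lemma jsigmaK : involutive jsigma.
Proof.
by elim/jac_ind => x; rewrite !jsigma_pi palg_sigmaK.
Qed.

Lemma jsigma_morphism : is_alg_morphism jsigma.
Proof.
split.
- move=> c; elim/jac_ind => x; elim/jac_ind => y.
  rewrite -jpiZ -jpiD !jsigma_pi -jpiZ -jpiD; congr jpi.
  by rewrite palg_mapD palg_mapZ.
- elim/jac_ind => x; elim/jac_ind => y.
  by rewrite -jpiM !jsigma_pi -jpiM; congr jpi; apply: phiM.
- by apply: etrans (jsigma_pi 1) _; congr jpi; apply: phi1.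
Qed.

Lemma jsigma_vtx x : jsigma (jvtx w x) = jvtx w (homv (fp_sigma a0) x).
Proof.
rewrite /jvtx jsigma_pi; congr jpi; rewrite !pvtxE.
by apply: etrans (palg_map_bpath _ _ _) _; congr bpath; apply: qpath_inj.
Qed.

Lemma jsigma_arrow a : jsigma (jarrow w a) = jarrow w (homa (fp_sigma a0) a).
Proof.
rewrite /jarrow jsigma_pi; congr jpi.
have pE (b : arr Q) : parrow k b = bpath k (arrow_path b) by rewrite bpathE.
rewrite !pE; apply: etrans (palg_map_bpath _ _ _) _; congr bpath.
by apply: qpath_inj => //; exact: (esym (sigma_src a)).
Qed.

Variables (gT : finGroupType) (s : gT).
Hypotheses (hG : #|[set: gT]| = 2%N) (hs : s != 1%g).

Lemma order2_elements (g : gT) : g = 1%g \/ g = s.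
Proof.
have E : [set 1%g; s] = [set: gT].
  by apply/eqP; rewrite eqEcard subsetT hG cards2 eq_sym hs.
have : g \in [set 1%g; s] by rewrite E inE.
by rewrite !inE => /orP[]/eqP; auto.
Qed.

Definition jact (x : Jac w) (g : gT) := if g == 1%g then x else jsigma x.

Lemma jact_s x : jact x s = jsigma x.
Proof. by rewrite /jact (negbTE hs). Qed.

Lemma jact1 x : jact x 1%g = x.
Proof. by rewrite /jact eqxx. Qed.

Lemma jactM x : act_morph jact x.
Proof.
have ss : (s * s = 1)%g.
  by case: (order2_elements (s * s)%g) => // /eqP; rewrite -[X in _ == X]mulg1 (inj_eq (mulgI s)) (negbTE hs).
move=> g h; case: (order2_elements g) => ->; first by rewrite mul1g jact1.
case: (order2_elements h) => ->; first by rewrite mulg1 jact1.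
by rewrite ss jact1 !jact_s jsigmaK.
Qed.

Definition jaction : {action gT &-> Jac w} := TotalAction jact1 jactM.

Lemma jaction_vtx x : jaction (jvtx w x) s = jvtx w (homv (fp_sigma a0) x).
Proof. by rewrite /= jact_s jsigma_vtx. Qed.

Lemma jaction_arrow a : jaction (jarrow w a) s = jarrow w (homa (fp_sigma a0) a).
Proof. by rewrite /= jact_s jsigma_arrow. Qed.

Lemma jaction_admissible : admissible_action jaction.
Proof.
split.
- move=> g; have [-> |->] := order2_elements g.
    by split=> [c x y|x y|] /=; rewrite !jact1.
  have [lin mul one] := jsigma_morphism.
  split=> [c x y|x y|] /=; rewrite !jact_s; [exact: lin|exact: mul|exact: one].
- move=> g v; have [-> |->] := order2_elements g; first by exists v; rewrite /= jact1.
  by exists (homv (fp_sigma a0) v); rewrite /= jact_s jsigma_vtx.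
- move=> g a; have [-> |->] := order2_elements g; first by exists a; rewrite /= jact1.
  by exists (homa (fp_sigma a0) a); rewrite /= jact_s jsigma_arrow.
- exists (inl (src a0)) => g; have [-> |->] := order2_elements g; first by rewrite /= jact1.
  by rewrite /= jact_s jsigma_vtx /= copy2v_src.
Qed.

End JacobianAction.

(** * Arcs in the plane *)

From mathcomp Require Import classical_sets boolp reals topology normedtype derive.
Import numFieldNormedType.Exports.
Local Open Scope ring_scope.

Section Arcs.
Variable R : realType.
Implicit Types (z w : plane R) (b : bool).

Lemma polynomial_arc (p q : {poly R}) (A : set (plane R)) :
  {in [pred t : R | 0 <= t <= 1] &, injective (fun t => (p.[t], q.[t]))} ->
  (forall z, A z <-> exists2 t, 0 <= t <= 1 & z = (p.[t], q.[t])) ->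
  is_arc A (p.[0], q.[0]) (p.[1], q.[1]).
Proof.
move=> inj AE; exists (fun t => (p.[t], q.[t])); split=> //.
  apply: continuous_subspaceT => t.
  have cp := @continuous_horner R p t; have cq := @continuous_horner R q t.
  exact: (cvg_pair cp cq).
by apply/seteqP; split=> z; [move/AE => [t t01 ->]; exists t|move=> [t t01 <-]; apply/AE; exists t].
Qed.

Lemma segmentP z w v : segment z w v <->
  exists2 t, 0 <= t <= 1 & v = (z.1 + t * (w.1 - z.1), z.2 + t * (w.2 - z.2)).
Proof.
by split=> [[t /= t01 <-]|[t t01 ->]]; exists t.
Qed.

Lemma segment_arc z w : z <> w -> is_arc (segment z w) z w.
Proof.
move=> zw; pose lin (x y : R) : {poly R} := x%:P + (y - x) *: 'X.
have linE x y t : (lin x y).[t] = x + t * (y - x) by rewrite /lin !hornerE mulrC.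
have := @polynomial_arc (lin z.1 w.1) (lin z.2 w.2) (segment z w).
rewrite !linE !mul0r !mul1r !addr0 ![_ + (_ - _)]addrC !subrK -!surjective_pairing; apply.
  move=> t u _ _; rewrite !linE => -[/addrI E1 /addrI E2]; apply/eqP/negPn/negP => tu.
  have tu0 : t - u != 0 by rewrite subr_eq0.
  apply: zw; rewrite [z]surjective_pairing [w]surjective_pairing; congr pair;
    apply/esym/eqP; rewrite -subr_eq0; apply/eqP; apply: (mulfI tu0).
    by rewrite mulr0 mulrBl E1 subrr.
  by rewrite mulr0 mulrBl E2 subrr.
move=> v; rewrite segmentP.
by split=> -[t t01 ->]; exists t => //; rewrite !linE.
Qed.

Definition flip b z : plane R := if b then (z.1, - z.2) else z.

Lemma flipK b : involutive (flip b).
Proof. by case: b => // -[x y]; rewrite /flip /= opprK. Qed.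

Lemma flip_inj b : injective (flip b).
Proof. exact: inv_inj (flipK b). Qed.

Lemma flip_neg b z : flip true (flip b z) = flip (~~ b) z.
Proof. by case: b => //; rewrite [LHS](flipK true). Qed.

Lemma flip1 b z : (flip b z).1 = z.1. Proof. by case: b. Qed.

Lemma flip_image (A : set (plane R)) b : (flip b @` A)%classic = (fun z => A (flip b z)).
Proof.
apply/seteqP; split=> z; first by move=> [w Aw <-] /=; rewrite flipK.
by move=> Az; exists (flip b z) => //; rewrite flipK.
Qed.

(** The closed half planes on the two sides of the x-axis meet only in the axis. *)
Lemma flip_cross b b' z w : b != b' -> 0 <= z.2 -> 0 <= w.2 ->
  flip b z = flip b' w -> z = w /\ z.2 = 0.
Proof.
case: z w => [x y] [x' y'] /=; case: b b' => [][] // _ y0 y'0 [-> E];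
  have y2 : y = 0 by lra.
  by split=> //; congr pair; lra.
by split=> //; congr pair; lra.
Qed.

Lemma flip_same b b' z w : 0 < z.2 -> 0 <= w.2 -> flip b z = flip b' w -> b = b' /\ z = w.
Proof.
move=> z0 w0 E; have [bb|bb] := eqVneq b b'.
  by split=> //; rewrite bb in E; apply: flip_inj E.
by have [_ z00] := flip_cross bb (ltW z0) w0 E; rewrite z00 ltxx in z0.
Qed.

Lemma flip_segment b z w v : segment (flip b z) (flip b w) (flip b v) <-> segment z w v.
Proof.
have gen z' w' v' : segment z' w' v' -> segment (flip b z') (flip b w') (flip b v').
  rewrite !segmentP => -[t t01 ->]; exists t => //; case: b => //=.
  by congr pair; ring.
by split=> [/gen|/gen //]; rewrite !flipK.
Qed.

Lemma reflection_flip (p u z : plane R) : p.2 = 0 -> u.2 = 0 -> u.1 != 0 ->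
  reflection p u z = flip true z.
Proof.
case: p u z => [px py] [ux uy] [x y] /= -> -> ux0.
pose c : R := 2 * (((x - px) * ux + (y - 0) * 0) / (ux * ux + 0 * 0)).
transitivity ((px + c * ux - (x - px), 0 + c * 0 - (y - 0)) : plane R); first by [].
have -> : c * ux = 2 * (x - px) by rewrite /c !mulr0 !addr0; field.
by rewrite /flip; congr pair => /=; ring.
Qed.

End Arcs.

(** * Drawings of the fibered product and of its dual graph *)

Section Drawings.
Variables (R : realType) (Q0 : quiver) (a0 : arr Q0).
Hypothesis dim0 : dimer_tree_quiver Q0.
Variables (pos : vert Q0 -> R) (top : ccycle Q0 -> arr Q0) (dep : arr Q0 -> nat).
Hypothesis L : laid_out a0 [set: ccycle Q0]%SET [set: arr Q0]%SET [set: vert Q0]%SET pos top dep.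
Notation Q := (fp_quiver a0).
Implicit Types (a c : arr Q0) (x g t u : R) (b : bool) (v : vert Q0).
Local Notation mid := (chord_mid pos).
Local Notation hw := (chord_half pos).
Local Notation par := (par top).
Local Notation chord a x := (height (mid a) (hw a) x).
Local Notation lx a t := (link_x (mid a) (mid (par a)) t).
Local Notation lg a t := (link_g (hw a) (hw (par a)) t).
Local Notation code := (@code Q0 a0 dim0 top).
Local Notation lend := (lend dim0 L).
Local Notation uend := (uend dim0 L).

(** The point at the gap g below the parabola y = x (1 - x). *)
Definition arch x g : plane R := (x, x * (1 - x) - g).
Definition vpoint v : plane R := arch (pos v) 0.
Definition npoint c : plane R := arch (mid c) (hw c ^+ 2 / 2).
Definition lpoint a t : plane R := arch (lx a t) (lg a t).

Lemma arch_inj x g x' g' : arch x g = arch x' g' -> x = x' /\ g = g'.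
Proof. by case=> -> /addrI/oppr_inj ->. Qed.

Definition vplace (v : mvert (underlying Q)) : plane R :=
  match v with inl x => vpoint x | inr x => flip true (vpoint (val x)) end.

Definition quiver_drawing : drawing R (underlying Q) :=
  @Drawing R (underlying Q) vplace (fun u : arr Q => segment (vplace (src u)) (vplace (tgt u))).

Definition dual_curve (u : arr Q) : set (plane R) :=
  if u == inl a0 then segment (npoint a0) (flip true (npoint a0))
  else fun z => exists2 t, 0 <= t <= 1 &
         z = flip (unfold_arr u).1 (lpoint (unfold_arr u).2 t).

Definition dual_place (n : mvert (dual Q)) := flip (code n).1 (npoint (code n).2).

Definition fp_dual_drawing : drawing R (dual Q) :=
  @Drawing R (dual Q) dual_place (fun e => dual_curve (dlabel e)).

Local Notation D := quiver_drawing.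
Local Notation D' := fp_dual_drawing.

Lemma pos_root : pos (src a0) = 0 /\ pos (tgt a0) = 1.
Proof. exact: lo_root L. Qed.

Lemma vpoint0 v : pos v * (1 - pos v) = 0 -> v = src a0 \/ v = tgt a0.
Proof.
have [p0 p1] := pos_root; move=> /eqP; rewrite mulf_eq0 => /orP[/eqP|/eqP] E.
  by left; apply: (pos_inj L); rewrite p0.
by right; apply: (pos_inj L); rewrite p1; lra.
Qed.

Lemma copyv_axis b b' v : pos v * (1 - pos v) = 0 -> copyv a0 b v = copyv a0 b' v.
Proof. by case/vpoint0 => ->; rewrite ?copyv_src0 ?copyv_tgt0. Qed.

Lemma vplaceE b v : vplace (copyv a0 b v) = flip b (vpoint v).
Proof.
case: b; last by [].
rewrite /copyv /copy2v; case: insubP => [x _ <- //|].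
rewrite negb_and !negbK => H; have [p0 p1] := pos_root.
have E : vpoint v = (pos v, 0).
  by case/orP: H => /eqP ->; rewrite /vpoint /arch ?p0 ?p1; congr pair; ring.
by rewrite /vplace E /flip /= oppr0.
Qed.

Lemma vpoint_ge0 v : 0 <= (vpoint v).2.
Proof. by rewrite /vpoint /= subr0 (pos_above dim0 L). Qed.

Lemma npoint_gt0 c : 0 < (npoint c).2.
Proof.
have c2 := half_sqr_gt0 dim0 L c.
have cc : chord c (mid c) = hw c ^+ 2 by rewrite /height subrr expr0n /= subr0.
have : chord c (mid c) <= mid c * (1 - mid c).
  by apply: (chord_above dim0 L); rewrite cc ltW.
by rewrite cc /npoint /=; lra.
Qed.

Lemma lpoint_gt0 a t : a != a0 -> 0 <= t <= 1 -> 0 < (lpoint a t).2.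
Proof. by move=> aa0 t01; rewrite /lpoint /= subr_gt0 (link_above dim0 L). Qed.

Lemma chord_arch_ge0 a x : 0 <= chord a x -> 0 <= (arch x (chord a x)).2.
Proof. by move=> ax; rewrite /arch /= subr_ge0 (chord_above dim0 L). Qed.

(** A segment between points of the parabola with abscissae s and e is at the gap
    t (1 - t) (e - s)^2 when a fraction t of it has been covered. *)
Lemma quiver_curveP b a z : dcurve D (copya a0 b a : arr Q) z <->
  exists2 x, 0 <= chord a x & z = flip b (arch x (chord a x)).
Proof.
rewrite /D /= -[fp_src _]/(src (copya a0 b a)) -[fp_tgt _]/(tgt (copya a0 b a)).
rewrite copya_src copya_tgt !vplaceE -[z](flipK b) flip_segment.
set s := pos (src a); set e := pos (tgt a).
have se : e - s != 0.
  by rewrite subr_eq0; apply: contraNneq (dimer_noloop dim0 a) => /(pos_inj L) ->.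
have cE t : chord a (s + t * (e - s)) = t * (1 - t) * (e - s) ^+ 2.
  rewrite /height /chord_mid /chord_half -/s -/e expr_div_n.
  by rewrite real_normK ?num_real //; field.
have pE t : arch (s + t * (e - s)) (t * (1 - t) * (e - s) ^+ 2) =
    (s + t * (e - s), (vpoint (src a)).2 + t * ((vpoint (tgt a)).2 - (vpoint (src a)).2)).
  by rewrite /arch /vpoint /= -/s -/e; congr pair; ring.
have e2 : 0 < (e - s) ^+ 2 by rewrite exprn_even_gt0 //= se.
rewrite segmentP; split=> [[t /andP[t0 t1] E]|[x cx E]].
  exists (s + t * (e - s)); last by rewrite cE pE E.
  rewrite cE; apply: mulr_ge0; last exact: ltW.
  by apply: mulr_ge0 => //; rewrite subr_ge0.
pose t := (x - s) / (e - s).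
have xE : x = s + t * (e - s) by rewrite divfK // addrC subrK.
have tt : 0 <= t * (1 - t) by rewrite -(pmulr_lge0 _ e2) -cE -xE.
exists t; last by rewrite (flip_inj E) xE cE pE.
by apply/andP; split; rewrite leNgt; apply/negP => ?; nra.
Qed.

Lemma npoint_inj a c : npoint a = npoint c -> a = c.
Proof. by case/arch_inj; apply: (node_inj dim0 L). Qed.

Lemma npoint_root : npoint a0 = (1 / 2, 1 / 8).
Proof. by rewrite /npoint (mid_root L) (half_sqr_root L) /arch; congr pair; field. Qed.

Lemma root_curveP z : segment (npoint a0) (flip true (npoint a0)) z <->
  z.1 = 1 / 2 /\ - (1 / 8) <= z.2 <= 1 / 8.
Proof.
rewrite segmentP npoint_root /=; split=> [[t t01 ->] /=|[z1 z2]].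
  by split; lra.
exists ((1 / 8 - z.2) * 4); first by lra.
by rewrite [LHS]surjective_pairing z1; congr pair; lra.
Qed.

Lemma dposD b v : dpos D (copyv a0 b v : vert Q) = flip b (vpoint v).
Proof. exact: vplaceE. Qed.

Lemma dposD_inj : injective (dpos D).
Proof.
move=> u w; have [b [x ->]] := copyv_ex u; have [b' [y ->]] := copyv_ex w.
rewrite !dposD => E; have [bb|bb] := eqVneq b b'.
  by rewrite bb in E *; move/flip_inj: E => /arch_inj[/(pos_inj L) ->].
have [/arch_inj[/(pos_inj L) <- _] y0] := flip_cross bb (vpoint_ge0 x) (vpoint_ge0 y) E.
by apply: copyv_axis; move: y0; rewrite /= subr0.
Qed.

Lemma chord_vertex b a x : chord a x = 0 -> exists2 v, v = src a \/ v = tgt a &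
  flip b (arch x (chord a x)) = dpos D (copyv a0 b v : vert Q).
Proof.
move=> c0; rewrite c0; case: (chord_ends c0) => ->; [exists (src a)|exists (tgt a)];
  by rewrite ?dposD; auto.
Qed.

Lemma mends_copyP b a v : v = src a \/ v = tgt a ->
  (copyv a0 b v : mvert (underlying Q)) \in mends (copya a0 b a : medge (underlying Q)).
Proof.
by rewrite mends_copy => H; apply: imset_f; rewrite finset.in_set2; case: H => ->; rewrite eqxx ?orbT.
Qed.

Lemma vertex_on_curve b a (w : vert Q) : dcurve D (copya a0 b a : arr Q) (dpos D w) ->
  w \in mends (copya a0 b a : medge (underlying Q)).
Proof.
have [b' [y ->]] := copyv_ex w; rewrite dposD => /quiver_curveP[x cx E].
have {}E : flip b (vpoint y) = flip b (arch x (chord a x)) /\ copyv a0 b' y = copyv a0 b y.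
  move: E; have [-> //|bb] := eqVneq b' b; move=> E.
  have [Ez y0] := flip_cross bb (vpoint_ge0 y) (chord_arch_ge0 cx) E.
  split; first by rewrite Ez.
  by apply: copyv_axis; move: y0; rewrite /= subr0.
case: E => /flip_inj/arch_inj[Ex Ec] ->; rewrite -Ex in Ec.
apply: mends_copyP; case: (chord_ends (esym Ec)) => /(pos_inj L); auto.
Qed.

Lemma planar_quiver_drawing : planar_drawing D.
Proof.
split.
- exact: dposD_inj.
- move=> e; exists (src e), (tgt e); split=> //; apply: segment_arc.
  move=> /dposD_inj /eqP; apply/negP.
  exact: (noloop_fp (dimer_noloop dim0)).
- by move=> e w; have [b [a ->]] := copya_ex e; apply: vertex_on_curve.
move=> e e' p; have [b [a ->]] := copya_ex e; have [b' [a' ->]] := copya_ex e'.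
move=> ee' /quiver_curveP[x cx Ep] /quiver_curveP[x' cx' Ep'].
suff [c0 c0'] : chord a x = 0 /\ chord a' x' = 0.
  have [v va Ev] := chord_vertex b c0; have [v' va' Ev'] := chord_vertex b' c0'.
  exists (copyv a0 b v : vert Q); last by rewrite Ep Ev.
  rewrite finset.in_setI mends_copyP //=.
  have -> : copyv a0 b v = copyv a0 b' v' by apply: dposD_inj; rewrite -Ev -Ev' -Ep -Ep'.
  exact: mends_copyP.
rewrite {}Ep in Ep'; have [bb|bb] := eqVneq b b'.
  rewrite bb in Ep' ee'; have [Ex Ec] := arch_inj (flip_inj Ep').
  have aa : a != a' by apply: contraNneq ee' => ->.
  rewrite -Ex in Ec; have c0 := chords_meet dim0 L aa cx Ec.
  by rewrite -Ex -Ec c0.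
have [/arch_inj[Ex Ec] y0] := flip_cross bb (chord_arch_ge0 cx) (chord_arch_ge0 cx') Ep'.
move: y0 => /= /eqP; rewrite subr_eq0 eq_sym => /eqP y0.
suff c0 : chord a x = 0 by rewrite -Ec.
have [aa0|] := eqVneq a a0; last by move=> aa0; apply: (chord_above_eq dim0 L aa0).
have a'a0 : a' != a0.
  by apply: contraNneq ee' => ->; rewrite aa0 !copya0.
rewrite Ec; apply: (chord_above_eq dim0 L a'a0) => //.
by rewrite -Ec y0 Ex.
Qed.

Lemma glued_quiver_drawing : glued_along D.
Proof.
have [p0 p1] := pos_root.
have pE : dpos D (inl (src a0) : vert Q) = (0, 0) by rewrite /= /vpoint /arch p0; congr pair; ring.
have qE : dpos D (inl (tgt a0) : vert Q) = (1, 0) by rewrite /= /vpoint /arch p1; congr pair; ring.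
have dotE z : dot (z - (0, 0)) (perp ((1, 0) - (0, 0))) = z.2 :> R.
  transitivity ((z.1 - 0) * - (0 - 0) + (z.2 - 0) * (1 - 0)); first by [].
  by ring.
split=> // a z; rewrite pE qE dotE.
  by move/(quiver_curveP false) => [x cx ->]; apply: chord_arch_ge0.
by move/(quiver_curveP true) => [x cx ->]; rewrite /= oppr_le0; apply: chord_arch_ge0.
Qed.

Lemma reflect_quiver_drawing :
  acts_by D (flip true) (homv (fp_sigma a0)) (homa (fp_sigma a0)).
Proof.
split=> [w|u].
  have [b [v ->]] := copyv_ex w.
  have -> : homv (fp_sigma a0) (copyv a0 b v) = copyv a0 (~~ b) v by exact: sigmav_copy.
  by rewrite !dposD flip_neg.
have [b [a ->]] := copya_ex u; rewrite flip_image.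
have -> : homa (fp_sigma a0) (copya a0 b a) = copya a0 (~~ b) a by exact: sigmaa_copy.
apply/funext => z; apply/propext; rewrite quiver_curveP quiver_curveP.
split=> -[x cx E]; exists x => //; first by rewrite E flip_neg negbK.
by rewrite -(flipK true z) E flip_neg.
Qed.

Implicit Types (e : medge (dual Q)) (n : mvert (dual Q)).

Lemma dposD'E n : dpos D' n = flip (code n).1 (npoint (code n).2).
Proof. by []. Qed.

Lemma side_curveP b a e z : a != a0 -> dlabel e = copya a0 b a ->
  dcurve D' e z <-> exists2 t, 0 <= t <= 1 & z = flip b (lpoint a t).
Proof.
by move=> aa0 E; rewrite /D' /= E /dual_curve copya_eq0 (negbTE aa0) unfold_copya.
Qed.

Lemma root_edgeP e z : dlabel e = inl a0 ->
  dcurve D' e z <-> z.1 = 1 / 2 /\ - (1 / 8) <= z.2 <= 1 / 8.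
Proof. by move=> E; rewrite -root_curveP /D' /= E /dual_curve eqxx. Qed.

Lemma dposD'_inj : injective (dpos D').
Proof.
move=> n n'; rewrite !dposD'E => /(flip_same (npoint_gt0 _) (ltW (npoint_gt0 _)))[E1 /npoint_inj E2].
by apply: (code_inj L); rewrite (surjective_pairing (code n)) E1 E2 -surjective_pairing.
Qed.

Lemma mem_lend (e : medge (dual Q)) n : code n = code (lend e) -> n \in mends e.
Proof. by move/(code_inj L) ->; rewrite (mends_fp dim0 L) finset.in_set2 eqxx. Qed.

Lemma mem_uend (e : medge (dual Q)) n : code n = code (uend e) -> n \in mends e.
Proof. by move/(code_inj L) ->; rewrite (mends_fp dim0 L) finset.in_set2 eqxx orbT. Qed.

Lemma lpoint_start a : lpoint a 0 = npoint a.
Proof. by rewrite /lpoint /npoint; have [-> ->] := link_start pos top a. Qed.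

Lemma lpoint_end a : lpoint a 1 = npoint (par a).
Proof. by rewrite /lpoint /npoint; have [-> ->] := link_end pos top a. Qed.

Lemma lpoint_inj a : a != a0 -> injective (lpoint a).
Proof.
move=> aa0 t u /arch_inj[_]; apply: link_g_inj; first exact: (half_gt0 dim0 L).
exact: (below_par L).
Qed.

Lemma side_arc b a e : a != a0 -> dlabel e = copya a0 b a ->
  is_arc (dcurve D' e) (flip b (npoint a)) (flip b (npoint (par a))).
Proof.
move=> aa0 E.
have line (x y : R) : exists X : {poly R}, forall t, X.[t] = x + t * (y - x).
  exists (x%:P + (y - x) *: 'X) => t.
  by rewrite hornerD hornerC hornerZ hornerX [X in _ + X]mulrC.
have [X XE] := line (mid a) (mid (par a)).
have [G GE] := line (hw a ^+ 2 / 2) (hw (par a) ^+ 2 / 2).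
pose Y : {poly R} := (if b then -1 else 1) *: (X * (1 - X) - G).
have YE t : (X.[t], Y.[t]) = flip b (lpoint a t).
  rewrite /Y !hornerE XE GE /flip /lpoint /arch /link_x /link_g; case: (b) => /=; congr pair; ring.
rewrite -lpoint_start -lpoint_end -!YE; apply: polynomial_arc.
  by move=> t u _ _; rewrite !YE => /flip_inj/(lpoint_inj aa0).
move=> z; rewrite (side_curveP z aa0 E).
by split=> -[t t01 ->]; exists t; rewrite ?YE.
Qed.

Lemma node_on_dual_curve e n : dcurve D' e (dpos D' n) -> n \in mends e.
Proof.
rewrite dposD'E; case: (fp_edgeP dim0 L e) => [E cl cu|b a aa0 E cl cu].
  rewrite root_edgeP // flip1 => -[/= m12 /andP[y1 y2]].
  have [c0|nc0] := eqVneq (code n).2 a0; last first.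
    have := half_sqr_small dim0 L nc0; move: y1 y2; case: (code n).1 => /=;
      by rewrite m12; have := half_sqr_gt0 dim0 L (code n).2; lra.
  case Ec : (code n) c0 => [[] c] /= ca0; rewrite ca0 in Ec.
    by apply: mem_lend; rewrite cl Ec.
  by apply: mem_uend; rewrite cu Ec.
move/(side_curveP _ aa0 E) => [t t01].
case/(flip_same (npoint_gt0 _) (ltW (lpoint_gt0 aa0 t01))) => Eb /arch_inj[Em Eh].
have Ec : code n = (b, (code n).2) by rewrite -Eb -surjective_pairing.
have [ca|ca] := node_link dim0 L aa0 t01 (esym Em) (esym Eh).
  by apply: mem_lend; rewrite cl Ec ca.
by apply: mem_uend; rewrite cu Ec ca.
Qed.

(** The segment that draws the edge a0 has |y| <= 1/8 at x = 1/2, hence gap at least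
    1/8, which a link attains only at its end, in one of the nodes joined by a0. *)
Lemma root_side_meet e e' z b a : dlabel e = inl a0 -> code (lend e) = (true, a0) ->
  code (uend e) = (false, a0) -> a != a0 -> dlabel e' = copya a0 b a ->
  code (uend e') = (b, par a) -> dcurve D' e z -> dcurve D' e' z ->
  exists2 n, n \in mends e :&: mends e' & z = dpos D' n.
Proof.
move=> E cl cu aa0 E' cu' /(root_edgeP _ E)[z1 /andP[y1 y2]] /(side_curveP _ aa0 E')[t t01 Ez].
have lg8 : 1 / 8 <= lg a t.
  by move: z1 y1 y2; rewrite Ez flip1; case: (b) => /= ->; lra.
have [pa t1] := link_high dim0 L aa0 t01 lg8.
exists (uend e'); last by rewrite dposD'E cu' Ez t1 lpoint_end.
apply/finset.setIP; split; last exact: mem_uend.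
rewrite pa in cu'.
by case: (b) cu' => cu'; [apply: mem_lend; rewrite cl|apply: mem_uend; rewrite cu].
Qed.

Lemma planar_dual_drawing : planar_drawing D'.
Proof.
split.
- exact: dposD'_inj.
- move=> e; case: (fp_edgeP dim0 L e) => [E cl cu|b a aa0 E cl cu].
    exists (uend e), (lend e); split; first by rewrite (mends_fp dim0 L) finset.setUC.
    rewrite !dposD'E cl cu /D' /= E /dual_curve eqxx; apply: segment_arc.
    by rewrite npoint_root /flip /= => -[]; lra.
  exists (lend e), (uend e); split; first exact: (mends_fp dim0 L).
  by rewrite !dposD'E cl cu; apply: side_arc.
- exact: node_on_dual_curve.
move=> e e' z ee'.
case: (fp_edgeP dim0 L e) (fp_edgeP dim0 L e') => [E cl cu|b a aa0 E cl cu] [E' cl' cu'|b' a' aa0' E' cl' cu'].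
- by case/eqP: ee'; apply: (dlabel_inj dim0 L); rewrite E E'.
- by move=> ez e'z; apply: (root_side_meet E cl cu aa0' E' cu').
- by move=> ez e'z; rewrite finset.setIC; apply: (root_side_meet E' cl' cu' aa0 E cu).
move=> /(side_curveP _ aa0 E)[t t01 ->] /(side_curveP _ aa0' E')[u u01].
case/(flip_same (lpoint_gt0 aa0 t01) (ltW (lpoint_gt0 aa0' u01))) => Eb /arch_inj[Ex Eg].
have aa' : a != a'.
  by apply: contraNneq ee' => Ea; apply/eqP/(dlabel_inj dim0 L); rewrite E E' Eb Ea.
have [c [ca ca' cx cg]] := link_link dim0 L aa' aa0 aa0' t01 u01 Ex Eg.
have lE : flip b (lpoint a t) = flip b (npoint c) by rewrite /lpoint cx cg.
have [n [cn ne]] : exists n, code n = (b, c) /\ n \in mends e.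
  case: ca => ->; [exists (lend e)|exists (uend e)]; split=> //;
    by [apply: mem_lend|apply: mem_uend].
exists n; last by rewrite lE dposD'E cn.
rewrite finset.in_setI ne /=; rewrite Eb in cn.
by case: ca' cn => -> cn; [apply: mem_lend; rewrite cl'|apply: mem_uend; rewrite cu'].
Qed.

(** The edge a0 crosses the arrow a0 at (1/2, 0); any other edge crosses its arrow at the
    parameter given by [link_crossing]. *)
Lemma dual_drawing_fp : dual_drawing D D'.
Proof.
split.
- move=> n u; have [b [c ->]] := copya_ex u; rewrite dposD'E => /quiver_curveP[x cx].
  case/(flip_same (npoint_gt0 _) (chord_arch_ge0 cx)) => _ /arch_inj[Ex Eh].
  by apply: (node_chord dim0 L (a := c) (c := (code n).2)); rewrite Ex -Eh.
- move=> e u; have [b' [c ->]] := copya_ex u.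
  case: (fp_edgeP dim0 L e) => [E cl cu|b a aa0 E cl cu] nlab; apply/seteqP; split=> // z [].
    move=> /(root_edgeP _ E)[z1 /andP[y1 y2]] /quiver_curveP[x cx Ez].
    have cc0 : c != a0 by apply: contraNneq nlab => ->; rewrite E copya0.
    have := half_sqr_small dim0 L cc0; have := height_le (mid c) (hw c) x.
    by move: z1 y1 y2; rewrite Ez flip1; case: (b') => /= ->; lra.
  move=> /(side_curveP _ aa0 E)[t t01 ->] /quiver_curveP[x cx].
  case/(flip_same (lpoint_gt0 aa0 t01) (chord_arch_ge0 cx)) => Eb /arch_inj[Ex Eg].
  have ca : c != a by apply: contraNneq nlab => ->; rewrite E Eb.
  by apply: (link_chord dim0 L aa0 ca t01); rewrite Eg Ex.
move=> e; case: (fp_edgeP dim0 L e) => [E cl cu|b a aa0 E cl cu].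
  have m0 := mid_root L; have h0 := half_root L.
  exists ((1 / 2, 0) : plane R).
    rewrite E; apply/seteqP; split=> z /=.
      move=> [/(root_edgeP _ E)[z1 _] /(quiver_curveP false)[x cx Ez]].
      move: z1; rewrite Ez (chord_root L) /arch /= => ->.
      by congr pair; ring.
    move=> ->; split; first by apply/(root_edgeP _ E) => /=; split; lra.
    apply/(quiver_curveP false); exists (1 / 2); rewrite (chord_root L); first by lra.
    by rewrite /arch /=; congr pair; ring.
  move=> v; have [b [y ->]] := copyv_ex v; rewrite dposD => Ev.
  have := congr1 fst Ev; have := congr1 snd Ev; rewrite flip1 /vpoint /=.
  by move=> + y12; rewrite -y12; case: (b) => /=; lra.
have [t [t0 t1 tE tu]] := link_crossing (half_gt0 dim0 L a) (below_par L aa0).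
have t01 : 0 <= t <= 1 by rewrite !ltW.
have g0 : 0 < lg a t by apply: (link_gt0 dim0 L) => //; apply: ltW.
exists (flip b (lpoint a t)).
  rewrite E; apply/seteqP; split=> z /=.
    move=> [/(side_curveP _ aa0 E)[u u01 ->] /quiver_curveP[x cx]] /flip_inj/arch_inj[Ex Eg].
    by rewrite (tu u) // Eg Ex.
  move=> ->; split; first by apply/(side_curveP _ aa0 E); exists t.
  apply/quiver_curveP; exists (lx a t); first by rewrite -tE ltW.
  by rewrite -tE.
move=> v; have [b' [y ->]] := copyv_ex v; rewrite dposD.
case/(flip_same (lpoint_gt0 aa0 t01) (vpoint_ge0 y)) => _ /arch_inj[_ E0].
by rewrite E0 ltxx in g0.
Qed.

Lemma reflect_dual_drawing (f := dual_reflection dim0 L) :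
  acts_by D' (flip true) (autv f) (aute f).
Proof.
split=> [n|e].
  by rewrite !dposD'E code_sigma flip_neg.
rewrite flip_image; apply/funext => z; apply/propext.
have El := dlabel_sigma dim0 L e.
case: (fp_edgeP dim0 L e) => [E _ _|b a aa0 E _ _]; rewrite E in El.
  have {}El : dlabel (aute f e) = inl a0 by rewrite El -(copya0 a0 false) sigmaa_copy copya0.
  by rewrite !root_edgeP // flip1 /=; split=> -[-> H]; split=> //; lra.
rewrite sigmaa_copy in El; rewrite (side_curveP _ aa0 El) (side_curveP _ aa0 E).
split=> -[t t01 Ez]; exists t => //; first by rewrite Ez flip_neg negbK.
by rewrite -(flipK true z) Ez flip_neg.
Qed.

End Drawings.

Theorem proposition4p9 (k : closedFieldType) (hk : 2%N \notin [pchar k])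
    (gT : finGroupType) (hG : #|[set: gT]| = 2%N) (s : gT) (hs : s != 1%g)
    (Q0 : quiver) (w0 : pathalg k Q0) (hA0 : dimer_tree_qp w0)
    (a0 : arr Q0) (ha0 : boundary a0) (R : realType) :
  let Q := fp_quiver a0 in
  let w := fp_potential a0 w0 in
  let sv : vert Q -> vert Q := homv (fp_sigma a0) in
  let sa : arr Q -> arr Q := homa (fp_sigma a0) in
  let i : vert Q := inl (src a0) in
  let j : vert Q := inl (tgt a0) in
  let alpha : arr Q := inl a0 in
  dimer_tree_qp w /\
  (exists to : {action gT &-> Jac w},
     [/\ admissible_action to,
         forall x : vert Q, to (jvtx w x) s = jvtx w (sv x)
       & forall b : arr Q, to (jarrow w b) s = jarrow w (sa b)]) /\
  (exists (D : drawing R (underlying Q)) (D' : drawing R (dual Q))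
      (f : mgraph_aut (dual Q)) (e : medge (dual Q)) (c c' : mvert (dual Q)),
     [/\ planar_drawing D /\ glued_along D,
         planar_drawing D' /\ dual_drawing D D',
         acts_by D (reflection (dpos D i) (dpos D j - dpos D i)) sv sa,
         induced_on_dual (fp_sigma a0) f
       & [/\ dlabel e = alpha, mends e = [set c; c']%SET,
             dcurve D' e = segment (dpos D' c) (dpos D' c')
           & acts_by D'
               (reflection (midpoint (dpos D' c) (dpos D' c'))
                           (perp (dpos D' c' - dpos D' c)))
               (autv f) (aute f)]]) /\
  [set x | sv x == x]%SET = [set i; j]%SET /\
  [set b | sa b == b]%SET = [set alpha]%SET.
Proof.
have [dim0 _ _] := hA0.
have [pos [top [dep L]]] := dimer_layout R dim0 ha0.
have [e [Ee cl cu]] : exists e : medge (dual (fp_quiver a0)), [/\ dlabel e = inl a0,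
    code dim0 top (lend dim0 L e) = (true, a0) & code dim0 top (uend dim0 L e) = (false, a0)].
  have [e Ee] := root_edge dim0 L; exists e.
  case: (fp_edgeP dim0 L e) => [-> -> -> //|b a aa0 E].
  by move: (copya_eq0 a0 b a); rewrite -E Ee eqxx (negbTE aa0).
move=> Q w sv sa i j alpha; split; first exact: dimer_tree_qp_fp.
split.
  exists (jaction a0 w0 hG hs); split.
  - exact: jaction_admissible.
  - exact: jaction_vtx.
  - exact: jaction_arrow.
split; last by split; [exact: sigmav_fix|exact: sigmaa_fix].
pose D := quiver_drawing a0 pos; pose D' := fp_dual_drawing a0 dim0 pos top.
exists D, D', (dual_reflection dim0 L), e, (uend dim0 L e), (lend dim0 L e).
have [p0 p1] := pos_root L.
have Di : dpos D i = (0, 0) by rewrite /= /vpoint /arch p0; congr pair; ring.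
have Dj : dpos D j = (1, 0) by rewrite /= /vpoint /arch p1; congr pair; ring.
have reflD : reflection (dpos D i) (dpos D j - dpos D i) = flip true.
  rewrite Di Dj; apply/funext => z; apply: reflection_flip => //.
    by transitivity (0 - 0 : R); rewrite // subrr.
  by rewrite (_ : _.1 = 1 - 0 :> R) // subr0 oner_neq0.
have Dc : dpos D' (uend dim0 L e) = npoint pos a0 by rewrite /D' dposD'E cu.
have Dc' : dpos D' (lend dim0 L e) = flip true (npoint pos a0) by rewrite /D' dposD'E cl.
split.
- by split; [exact: (planar_quiver_drawing dim0 L)|exact: (glued_quiver_drawing dim0 L)].
- by split; [exact: (planar_dual_drawing dim0 L)|exact: (dual_drawing_fp dim0 L)].
- by rewrite reflD; apply: (reflect_quiver_drawing dim0 L).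
- exact: dual_reflection_induced.
split=> //.
- by rewrite (mends_fp dim0 L) finset.setUC.
- by rewrite Dc Dc' /= /dual_curve Ee eqxx.
rewrite Dc Dc' (npoint_root L).
have -> : reflection (midpoint (1 / 2, 1 / 8) (flip true (1 / 2, 1 / 8)))
    (perp (flip true (1 / 2, 1 / 8) - (1 / 2, 1 / 8))) = flip true :> (plane R -> plane R).
  apply/funext => z; apply: reflection_flip.
  - by transitivity (2^-1 * (1 / 8 + - (1 / 8)) : R); rewrite // subrr mulr0.
  - by transitivity (1 / 2 - 1 / 2 : R); rewrite // subrr.
  - by apply/eqP => E; have : - (- (1 / 8) - 1 / 8) = 0 :> R := E; lra.
exact: (reflect_dual_drawing dim0 L).
Qed.
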